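(* Let $1\le d\le m$, $k\in\mathbb{N}$ and $\alpha=(\alpha_1,\dots,\alpha_m)$ with $\alpha_j>0$ for all $j$. Let $\mathcal{H}^{(\alpha)}(\mathbb{D}^m)$ be the weighted Bergman space on the polydisc $\mathbb{D}^m$ with reproducing kernel $\prod_{j=1}^m(1-z_j\bar w_j)^{-\alpha_j}$, let $\mathcal{H}^{(\alpha)}_0$ be the subspace of functions vanishing to order $k$ along $\Delta_d=\{z\in\mathbb{D}^m:z_1=\cdots=z_d\}$, and $\mathcal{H}^{(\alpha)}_q=\mathcal{H}^{(\alpha)}(\mathbb{D}^m)\ominus\mathcal{H}^{(\alpha)}_0$. Then the compression $\boldsymbol{M}^{(\alpha)}_k$ onto $\mathcal{H}^{(\alpha)}_q$ of the tuple of multiplication operators by the coordinate functions on $\mathcal{H}^{(\alpha)}(\mathbb{D}^m)$ is homogeneous with respect to the group $\text{Möb}(\mathbb{D})^{m-d+1}$.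
   Context: A holomorphic function vanishes to order $k$ along $\Delta_d$ if all its partial derivatives of order $\le k-1$ vanish at every point of $\Delta_d$. $\Delta_d$ is identified with $\mathbb{D}^{m-d+1}$ via $z\mapsto(z_1,z_{d+1},\dots,z_m)$. The compression onto $\mathcal{H}^{(\alpha)}_q$ is taken for the coordinate functions parametrizing $\Delta_d$, i.e. $\boldsymbol{M}^{(\alpha)}_k=(T_1,T_{d+1},\dots,T_m)$ with $T_i=PM_{z_i}|_{\mathcal{H}^{(\alpha)}_q}$ and $P$ the orthogonal projection onto $\mathcal{H}^{(\alpha)}_q$. $\text{Möb}(\mathbb{D})$ is the group of biholomorphic automorphisms of the unit disc $\mathbb{D}$. A commuting tuple $(T_1,\dots,T_n)$ (with joint spectrum in $\overline{\mathbb{D}}^n$) is homogeneous with respect to $\text{Möb}(\mathbb{D})^n$ if for every $(g_1,\dots,g_n)\in\text{Möb}(\mathbb{D})^n$ the tuple $(g_1(T_1),\dots,g_n(T_n))$, defined by holomorphic functional calculus, is unitarily equivalent to $(T_1,\dots,T_n)$ by a single unitary. *)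

(* Defs.v *)
From HB Require Import structures.
From mathcomp Require Import all_boot all_order all_algebra.
From mathcomp Require Import sesquilinear complex.
From mathcomp Require Import all_classical all_reals all_analysis.

Set Implicit Arguments.
Unset Strict Implicit.
Unset Printing Implicit Defensive.

Import Order.TTheory GRing.Theory Num.Theory Num.Def.
Import numFieldNormedType.Exports.

Local Open Scope classical_set_scope.
Local Open Scope ring_scope.
Local Open Scope complex_scope.

Section OneVariable.
Variable R : realType.
Local Notation C := (R[i]).

Definition disc (r : R) : set C := [set z | `|z| < r%:C].

Definition holomorphic_on (D : set C) (g : C -> C) : Prop :=
  forall z, D z -> derivable (g : C^o -> C^o) z 1.

(* Only the values of g on the open unit disc matter. *)
Definition mobius (g : C -> C) : Prop :=
  exists h : C -> C,
    [/\ holomorphic_on (disc 1) g, holomorphic_on (disc 1) h,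
        (forall z, disc 1 z -> disc 1 (g z) /\ disc 1 (h z))
      & (forall z, disc 1 z -> h (g z) = z /\ g (h z) = z)].

(* principal argument, with values in ]-pi, pi] for u != 0 *)
Definition arg (u : C) : R :=
  let t := acos (complex.Re u / complex.Re `|u|) in
  if complex.Im u < 0 then - t else t.

(* principal branch of u ^ s, for u != 0 *)
Definition cpow (u : C) (s : R) : C :=
  (complex.Re `|u| `^ s)%:C * (cos (s * arg u) +i* sin (s * arg u)).

Definition circle (r t : R) : C := r%:C * (cos t +i* sin t).

Definition contour_integral (r : R) (F : C -> C) : C :=
  let f t := F (circle r t) * ('i%C * circle r t) in
  (\int[lebesgue_measure]_(t in `[0, 2 * pi]) complex.Re (f t)) +i*
  (\int[lebesgue_measure]_(t in `[0, 2 * pi]) complex.Im (f t)).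

End OneVariable.

Section Operators.
Variables (R : realType) (V : lmodType R[i]) (ip : {dot V for conjC}).
Local Notation C := (R[i]).

Definition hilbert_complete : Prop :=
  forall u : nat -> V,
    (forall e : R, 0 < e -> exists N : nat, forall p q : nat,
       (N <= p)%N -> (N <= q)%N -> ip (u p - u q) (u p - u q) < e%:C) ->
    exists l : V, forall e : R, 0 < e -> exists N : nat, forall p : nat,
       (N <= p)%N -> ip (u p - l) (u p - l) < e%:C.

Definition bounded_operator (T : V -> V) : Prop :=
  linear T /\ exists M : R, forall x, ip (T x) (T x) <= M%:C * ip x x.

Definition unitary (U : V -> V) : Prop :=
  [/\ linear U, (forall y, exists x, U x = y)
    & (forall x y, ip (U x) (U y) = ip x y)].

Definition is_resolvent (T : V -> V) (z : C) (S : V -> V) : Prop :=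
  [/\ bounded_operator S, (forall x, z *: S x - T (S x) = x)
    & (forall x, S (z *: x - T x) = x)].

(* A = g(T) in the Riesz-Dunford calculus, for T with spectrum in the closed
   unit disc and g with a holomorphic extension G to some disc of radius
   rho > 1: A is the weak integral (2 i pi)^-1 \oint G(z) (z - T)^-1 dz over
   any circle |z| = r with 1 < r < rho. *)
Definition holomorphic_calculus (T : V -> V) (g : C -> C) (A : V -> V) : Prop :=
  exists (rho : R) (G : C -> C) (res : C -> V -> V),
    [/\ 1 < rho, holomorphic_on (disc rho) G,
        (forall z, disc 1 z -> G z = g z),
        (forall z : C, 1 < `|z| -> is_resolvent T z (res z))
      & (forall r, 1 < r < rho -> forall x y,
           ip (A x) y = (2 * pi%:C * 'i%C)^-1 *
             contour_integral r (fun z => G z * ip (res z x) y))].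

Variables (n : nat) (T : 'I_n -> V -> V).

(* Differential of the cohomological Koszul complex of T - lambda. A cochain
   is the family of its coefficients on the basis e_S of the exterior algebra
   (all degrees together), and the differential maps v e_S to
   \sum_i (T_i - lambda_i) v (e_i /\ e_S). *)
Definition koszul (lambda : 'I_n -> C) (x : {ffun {set 'I_n} -> V}) :
    {ffun {set 'I_n} -> V} :=
  [ffun S : {set 'I_n} =>
    \sum_(i in S) (-1) ^+ #|[set j in S | (j < i)%N]| *:
      (T i (x (S :\ i)%SET) - lambda i *: x (S :\ i)%SET)].

(* Taylor joint spectrum. The differential has degree one, so exactness of the
   total complex is exactness in every degree. *)
Definition joint_spectrum : set ('I_n -> C) :=
  [set lambda | ~ forall x, koszul lambda x = 0 ->
                  exists y, koszul lambda y = x].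

Definition homogeneous : Prop :=
  [/\ (forall i, bounded_operator (T i)),
      (forall i j x, T i (T j x) = T j (T i x)),
      (forall lambda, joint_spectrum lambda -> forall i, `|lambda i| <= 1)
    & (forall g : 'I_n -> C -> C, (forall i, mobius (g i)) ->
       exists (A : 'I_n -> V -> V) (U : V -> V),
         [/\ (forall i, bounded_operator (A i)),
             (forall i, holomorphic_calculus (T i) (g i) (A i)),
             unitary U
           & (forall i x, U (A i x) = T i (U x))])].

End Operators.

Section OrthogonalComplement.
Variables (R : realType) (V : lmodType R[i]) (ip : {dot V for conjC}).
Variable S : set V.

Definition orth_pred : {pred V} :=
  fun x => `[< forall y, S y -> ip x y = 0 >].

Fact orth_submod_closed : submod_closed orth_pred.
Proof.
split=> [|a x y]; first by apply/asboolP => y _; rewrite linear0l.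
move=> /asboolP hx /asboolP hy; apply/asboolP => z Sz.
by rewrite linearPl [X in a * X]hx // [X in _ + X]hy // mulr0 addr0.
Qed.

HB.instance Definition _ :=
  GRing.isSubmodClosed.Build R[i] V orth_pred orth_submod_closed.

Record orthc := Orthc { orth_val : V; _ : orth_pred orth_val }.
HB.instance Definition _ := [isSub for orth_val].
HB.instance Definition _ := [Choice of orthc by <:].
HB.instance Definition _ := [SubChoice_isSubLmodule of orthc by <:].

Definition orth_ip (x y : orthc) : R[i] := ip (val x) (val y).

Fact orth_ip_bilinear : bilinear_for
  (GRing.Scale.Law.clone _ _ *%R _)
  (GRing.Scale.Law.clone _ _ (conjC \; *%R) _) orth_ip.
Proof.
have valD a (u v : orthc) : val (a *: u + v) = a *: val u + val v by rewrite linearP.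
split=> [y|x] a u v; rewrite /orth_ip valD; first exact: linearPl.
exact: (@linearPr _ _ _ _ _ _ ip).
Qed.
HB.instance Definition _ := bilinear_isBilinear.Build R[i] orthc orthc R[i]
  _ _ orth_ip orth_ip_bilinear.

Fact orth_ip_herm x y : orth_ip x y = (-1) ^+ false * conjC (orth_ip y x).
Proof. exact: hermitian_subproof. Qed.
HB.instance Definition _ := isHermitianSesquilinear.Build R[i] orthc false conjC
  orth_ip orth_ip_herm.

Fact orth_ip_gt0 x : x != 0 -> 0 < orth_ip x x.
Proof. by move=> x0; apply: neq0_dnorm_gt0; rewrite -(inj_eq val_inj) in x0. Qed.
HB.instance Definition _ := isDotProduct.Build R[i] orthc orth_ip orth_ip_gt0.

Definition orth_dot : {dot orthc for conjC} := orth_ip.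

Definition orthogonal_projection (P : V -> orthc) : Prop :=
  forall (f : V) (q : orthc), ip (f - val (P f)) (val q) = 0.

End OrthogonalComplement.

Section Polydisc.
Variables (R : realType) (m : nat).
Local Notation C := (R[i]).

Definition polydisc : set 'rV[C]_m := [set z | forall j, disc 1 (z 0 j)].

Definition diagonal (d : nat) : set 'rV[C]_m :=
  [set z | polydisc z /\
           forall i j : 'I_m, (i < d)%N -> (j < d)%N -> z 0 i = z 0 j].

Definition partial (i : 'I_m) (f : 'rV[C]_m -> C) : 'rV[C]_m -> C :=
  'D_('e_i) (f : 'rV[C]_m -> C^o).

Definition vanishes_to_order (k : nat) (D : set 'rV[C]_m)
    (f : 'rV[C]_m -> C) : Prop :=
  forall s : seq 'I_m, (size s < k)%N ->
    forall z, D z -> foldr partial f s z = 0.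

Definition bergman_kernel (alpha : 'I_m -> R) (z w : 'rV[C]_m) : C :=
  \prod_(j < m) cpow (1 - z 0 j * (w 0 j)^*) (- alpha j).

(* The Hilbert space (H, ip), its elements read as functions through ev, is
   the space of functions on D with reproducing kernel K. Values of ev f
   outside D are irrelevant. *)
Record reproducing_kernel_space (D : set 'rV[C]_m) (K : 'rV[C]_m -> 'rV[C]_m -> C)
    (H : lmodType C) (ip : {dot H for conjC}) (ev : H -> 'rV[C]_m -> C) : Prop :=
  ReproducingKernelSpace {
    rk_complete : hilbert_complete ip;
    rk_linear : forall z, D z -> forall (a : C) (f g : H),
      ev (a *: f + g) z = a * ev f z + ev g z;
    rk_inj : forall f g : H, (forall z, D z -> ev f z = ev g z) -> f = g;
    rk_reproducing : forall w, D w -> exists kw : H,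
      (forall z, D z -> ev kw z = K z w) /\ (forall f, ev f w = ip f kw)
  }.

Definition multiplication_operator (D : set 'rV[C]_m) (H : lmodType C)
    (ev : H -> 'rV[C]_m -> C) (i : 'I_m) (M : H -> H) : Prop :=
  forall f z, D z -> ev (M f) z = z 0 i * ev f z.

Definition quotient_space (d k : nat) (H : lmodType C) (ip : {dot H for conjC})
    (ev : H -> 'rV[C]_m -> C) :=
  orthc ip [set f | vanishes_to_order k (diagonal d) (ev f)].

End Polydisc.
Arguments polydisc {R} m.

Section DiagonalCoordinates.
Variables (m d : nat).
Hypothesis hd : (0 < d <= m)%N.

Fact diag_coord_proof (j : 'I_(m - d + 1)) :
  ((if j == 0 :> nat then 0 else (d + j).-1) < m)%N.
Proof.
case: j => j hj /=; case/andP: hd => d0 dm.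
case: ifP => [_|]; first exact: leq_trans dm.
move=> /negbT; rewrite -lt0n => j0.
by move: hj; rewrite addn1 ltnS prednK ?addn_gt0 ?d0 // leq_subRL.
Qed.

(* Positions of z_1, z_(d+1), ..., z_m, counted from 0. *)
Definition diag_coord (j : 'I_(m - d + 1)) : 'I_m := Ordinal (diag_coord_proof j).

End DiagonalCoordinates.

(* Main.v *)
(* For automorphisms of the disc phi_j the kernel is quasi-invariant:
   K(z, w) = psi(z) K(phi z, phi w) conj (psi w), where psi is a product of powers
   of the factors 1 - conj a_j z_j. Hence U f = psi * (f o phi) is unitary. If phi
   uses the same automorphism in the first d variables, it preserves the diagonal,
   so U preserves the functions vanishing to order k there, and it restricts to a
   unitary of the orthogonal complement. The subspace of vanishing functions is
   closed and invariant under bounded multipliers, so compression is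
   multiplicative on multipliers: the resolvent of the compression T_j of z_j at
   l is the compression of (l - z_j)^-1, which bounds the joint spectrum through
   the Koszul complex, and g_j(T_j) is the compression of g_j(z_j), as one sees by
   evaluating the contour integral for g_j(z) = c (z - a) / (1 - conj a z). That
   every g_j has this form is the Schwarz lemma. The intertwining relation
   U z_j = phi_j U then gives the unitary equivalence. *)
Require Import Defs.
From HB Require Import structures.
From mathcomp Require Import all_boot all_order all_algebra.
From mathcomp Require Import sesquilinear complex.
From mathcomp Require Import all_classical all_reals all_analysis.
From mathcomp Require Import ring lra.
Set Implicit Arguments.
Unset Strict Implicit.
Unset Printing Implicit Defensive.
Import Order.TTheory GRing.Theory Num.Theory Num.Def.
Import numFieldNormedType.Exports.
Local Open Scope classical_set_scope.
Local Open Scope ring_scope.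
Local Open Scope complex_scope.
Import Normc.

(** * Complex derivatives *)

(** The space is given only through its reproducing kernel, so every analytic fact about its
    functions is extracted from the kernel; operators are obtained from the action of their adjoints
    on kernel functions and the Riesz theorem. For alpha_j < 1 multiplication by z_j is not a
    contraction, so neither a norm estimate in the Neumann series nor a sup-norm bound yields the
    resolvent for all |l| > 1. Instead, (1 - conj a z_j)^-1 is an affine function of the
    automorphism vanishing at a, and multiplication by that automorphism is unitarily equivalent to
    multiplication by z_j; boundedness of the coordinates alone then gives all multipliers that
    occur. Complex analysis is reduced to one fact: the mean of a holomorphic function over |z| = r
    does not depend on r in an annulus. Read off near 0 or near infinity, it evaluates the integrals
    of the functional calculus and bounds g'(0) in the Schwarz lemma. The lemma itself follows by
    integrating the Schwarz-Pick inequality along a radius, without the maximum principle. *)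

Section ComplexModulus.
Variable R : realType.
Implicit Types (z w : R[i]) (x : R).

Lemma normr_normc z : `|z| = (normc z)%:C.
Proof. by case: z. Qed.

Lemma normc_ge0 z : 0 <= normc z.
Proof. by case: z => a b; exact: sqrtr_ge0. Qed.

Lemma normcBC z w : normc (z - w) = normc (w - z).
Proof. by rewrite -normcN opprB. Qed.

Lemma normc_sub z w : normc (z - w) <= normc z + normc w.
Proof. by rewrite -(normcN w); exact: le_normcD. Qed.

Lemma normc_subr z w : normc z - normc w <= normc (z - w).
Proof. by rewrite lerBlDr -{1}(subrK w z); exact: le_normcD. Qed.

Lemma normc_real x : normc x%:C = `|x|.
Proof. by rewrite /normc/= expr0n addr0 sqrtr_sqr. Qed.

Lemma normc_nat n : normc (n%:R : R[i]) = n%:R.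
Proof. by rewrite -(rmorph_nat (real_complex R)) normc_real ger0_norm. Qed.

Lemma normcJ z : normc (conjC z) = normc z.
Proof. by case: z => a b; rewrite /= sqrrN. Qed.

Lemma normc_eq0 z : (normc z == 0) = (z == 0).
Proof. by apply/eqP/eqP => [/eq0_normc|->] //; rewrite normc0. Qed.

Lemma normc_gt0 z : (0 < normc z) = (z != 0).
Proof. by rewrite lt_neqAle normc_ge0 eq_sym normc_eq0 andbT. Qed.

Lemma sqr_normcE z : normc z ^+ 2 = complex.Re z ^+ 2 + complex.Im z ^+ 2.
Proof. by case: z => a b /=; rewrite sqr_sqrtr ?addr_ge0 ?sqr_ge0. Qed.

Lemma mulcJ z : z * conjC z = (normc z ^+ 2)%:C.
Proof.
by rewrite sqr_normcE; case: z => a b; apply/eqP; rewrite eq_complex /=;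
  apply/andP; split; apply/eqP; ring.
Qed.

Lemma ler_Re_normc z : `|complex.Re z| <= normc z.
Proof.
rewrite -sqrtr_sqr; case: z => a b /=; apply: ler_wsqrtr.
by rewrite lerDl sqr_ge0.
Qed.

Lemma ler_Im_normc z : `|complex.Im z| <= normc z.
Proof.
rewrite -sqrtr_sqr; case: z => a b /=; apply: ler_wsqrtr.
by rewrite lerDr sqr_ge0.
Qed.

Lemma Re_le_normc z : complex.Re z <= normc z.
Proof. exact: le_trans (ler_norm _) (ler_Re_normc z). Qed.

Lemma normc_le_ReIm z : normc z <= `|complex.Re z| + `|complex.Im z|.
Proof.
case: z => a b /=; rewrite -[leRHS]ger0_norm ?addr_ge0// -sqrtr_sqr.
apply: ler_wsqrtr; rewrite -(real_normK (num_real a)) -(real_normK (num_real b)).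
by rewrite sqrrD addrAC lerDl mulrn_wge0// mulr_ge0.
Qed.

Lemma normcX z n : normc (z ^+ n) = normc z ^+ n.
Proof. by elim: n => [|n IH]; rewrite ?expr0 ?normc1// !exprS normcM IH. Qed.

Lemma normc_i : normc ('i%C : R[i]) = 1.
Proof. by rewrite /= expr0n add0r expr1n sqrtr1. Qed.

Lemma Re_real_complexM x z : complex.Re (x%:C * z) = x * complex.Re z.
Proof. by case: z => a b /=; ring. Qed.

Lemma Im_real_complexM x z : complex.Im (x%:C * z) = x * complex.Im z.
Proof. by case: z => a b /=; ring. Qed.

Lemma one_sub_sqr_normc z : (1 - normc z ^+ 2)%:C = 1 - z * conjC z.
Proof. by rewrite mulcJ rmorphB rmorph1. Qed.

Lemma normc_rotation z : z != 0 -> exists2 u, normc u = 1 & u * z = (normc z)%:C.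
Proof.
move=> z0; have n0 : 0 < normc z by rewrite normc_gt0.
exists (conjC z / (normc z)%:C).
  by rewrite normcM normcV normcJ normc_real gtr0_norm// mulfV// gt_eqF.
rewrite mulrAC (mulrC (conjC _)) mulcJ expr2 rmorphM/= mulfK//.
by rewrite -normc_gt0 normc_real gtr0_norm.
Qed.

Lemma conjC_realE x : conjC (x%:C) = x%:C.
Proof. exact: conjc_real. Qed.

Lemma Re_conjC z : complex.Re (conjC z) = complex.Re z.
Proof. by case: z. Qed.

Lemma ReD z w : complex.Re (z + w) = complex.Re z + complex.Re w.
Proof. by case: z; case: w. Qed.
Lemma ImD z w : complex.Im (z + w) = complex.Im z + complex.Im w.
Proof. by case: z; case: w. Qed.
Lemma ReN z : complex.Re (- z) = - complex.Re z.
Proof. by case: z. Qed.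
Lemma ImN z : complex.Im (- z) = - complex.Im z.
Proof. by case: z. Qed.

Lemma disc1E z : disc 1 z = (normc z < 1) :> Prop.
Proof. by rewrite /disc /= normr_normc ltcR. Qed.

Lemma discE (r : R) z : disc r z = (normc z < r) :> Prop.
Proof. by rewrite /disc /= normr_normc ltcR. Qed.

End ComplexModulus.

(* The derivative of F at x along an additive map e into the complex plane:
   e is the identity for complex derivatives and the inclusion of the reals for
   derivatives of curves. *)
Definition cderiv_along (R : realType) (X : zmodType) (e : X -> R[i])
    (F : X -> R[i]) (x : X) (l : R[i]) : Prop :=
  forall eps : R, 0 < eps -> exists2 del : R, 0 < del & forall h : X,
    normc (e h) < del ->
    normc (F (x + h) - F x - e h * l) <= eps * normc (e h).

Notation cderiv := (cderiv_along (fun z => z)).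
Notation curve_deriv := (cderiv_along (fun t => t%:C)).

Section DerivAlong.
Variables (R : realType) (X : zmodType) (e : X -> R[i]).
Local Notation D := (cderiv_along e).
Implicit Types (F G : X -> R[i]).

Lemma cderiv_along_cst (c : R[i]) x : D (fun _ => c) x 0.
Proof.
move=> eps e0; exists 1 => // h _.
by rewrite subrr mulr0 subr0 normc0 mulr_ge0 ?normc_ge0// ltW.
Qed.

Lemma cderiv_along_add F G x l m : D F x l -> D G x m ->
  D (fun y => F y + G y) x (l + m).
Proof.
move=> hF hG eps e0; have e2 : 0 < eps / 2 by rewrite divr_gt0.
have [d1 d10 h1] := hF _ e2; have [d2 d20 h2] := hG _ e2.
exists (Num.min d1 d2) => [|h]; first by rewrite lt_min d10.
rewrite lt_min => /andP[/h1 k1 /h2 k2].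
have -> : F (x + h) + G (x + h) - (F x + G x) - e h * (l + m) =
  (F (x + h) - F x - e h * l) + (G (x + h) - G x - e h * m) by ring.
by apply: le_trans (le_normcD _ _) _; lra.
Qed.

Lemma cderiv_along_cont F x l : D F x l -> forall eps, 0 < eps ->
  exists2 del, 0 < del & forall h, normc (e h) < del ->
    normc (F (x + h) - F x) <= eps.
Proof.
move=> hF eps e0; have [d1 d10 h1] := hF 1 ltr01.
set K := 1 + normc l; have K0 : 0 < K by rewrite ltr_wpDr ?normc_ge0.
exists (Num.min d1 (eps / K)) => [|h]; first by rewrite lt_min d10 divr_gt0.
rewrite lt_min => /andP[/h1 k1]; rewrite ltr_pdivlMr// => k2.
have -> : F (x + h) - F x = (F (x + h) - F x - e h * l) + e h * l by ring.
apply: le_trans (le_normcD _ _) _; rewrite normcM.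
by apply: le_trans (ltW k2); rewrite /K; lra.
Qed.

Lemma cderiv_along_comp F (G : R[i] -> R[i]) x l m :
  D F x l -> cderiv G (F x) m -> D (fun y => G (F y)) x (m * l).
Proof.
move=> hF hG eps e0.
set K := 1 + normc l; have K0 : 0 < K by rewrite ltr_wpDr ?normc_ge0.
set M := 1 + normc m; have M0 : 0 < M by rewrite ltr_wpDr ?normc_ge0.
have e2 : 0 < eps / 2 / K by rewrite !divr_gt0.
(* The entry 1 makes the increment k of F at most K |h|; the entry eps / 2 / M keeps the error of F
   below eps / 2 |h| after multiplication by m. *)
have e3 : 0 < Num.min 1 (eps / 2 / M) by rewrite lt_min ltr01 !divr_gt0.
have [d2 d20 h2] := hG _ e2.
have [d1 d10 h1] := hF _ e3.
exists (Num.min d1 (d2 / K / 2)) => [|h]; first by rewrite lt_min d10 !divr_gt0.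
rewrite lt_min => /andP[/h1 k1 k3].
set k := F (x + h) - F x.
have kE : F (x + h) = F x + k by rewrite /k; ring.
have nh := normc_ge0 (e h).
have k1' : normc (k - e h * l) <= normc (e h).
  by apply: le_trans k1 _; rewrite ler_piMl ?normc_ge0// ge_min lexx.
have k1'' : normc (k - e h * l) * M <= eps / 2 * normc (e h).
  rewrite -ler_pdivlMr//; apply: le_trans k1 _.
  by rewrite [leRHS]mulrAC ler_wpM2r// ge_min lexx orbT.
have nk : normc k <= K * normc (e h).
  rewrite -(subrK (e h * l) k); apply: le_trans (le_normcD _ _) _.
  by rewrite normcM /K; lra.
have kd : normc k < d2.
  apply: le_lt_trans nk _.
  rewrite mulrC -ltr_pdivlMr//; apply: lt_le_trans k3 _.
  by rewrite ler_pdivrMr// ler_peMr ?divr_ge0 ?ltW// ltr1n.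
have := h2 _ kd; rewrite -kE => k4.
have -> : G (F (x + h)) - G (F x) - e h * (m * l) =
   (G (F (x + h)) - G (F x) - k * m) + m * (k - e h * l) by ring.
apply: le_trans (le_normcD _ _) _; rewrite normcM.
have s1 : eps / 2 / K * normc k <= eps / 2 * normc (e h).
  rewrite -mulrA ler_wpM2l ?divr_ge0 ?(ltW e0)//.
  by rewrite mulrC ler_pdivrMr// mulrC.
have s2 : normc m * normc (k - e h * l) <= eps / 2 * normc (e h).
  apply: le_trans k1''; rewrite mulrC ler_wpM2l ?normc_ge0// /M; lra.
lra.
Qed.

Lemma cderiv_along_eq F x l m : D F x l -> l = m -> D F x m.
Proof. by move=> h <-. Qed.

Lemma cderiv_along_ext F G x l r : 0 < r ->
  (forall h, normc (e h) < r -> F (x + h) = G (x + h)) -> e 0 = 0 ->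
  D F x l -> D G x l.
Proof.
move=> r0 FG ze hF eps e0; have [d d0 hd] := hF _ e0.
exists (Num.min d r) => [|h]; first by rewrite lt_min d0.
rewrite lt_min => /andP[/hd k1 k2].
by rewrite -FG// -[in G x](addr0 x) -FG ?addr0// ze normc0.
Qed.

End DerivAlong.

Section ComplexDeriv.
Variable R : realType.
Local Notation C := (R[i]).

Lemma cderiv_id (z : C) : cderiv (fun z => z) z 1.
Proof.
move=> eps e0; exists 1 => // h _.
by rewrite (_ : _ - _ = 0) ?normc0 ?mulr_ge0 ?normc_ge0 ?ltW//; ring.
Qed.

Lemma curve_deriv_id (t : R) : curve_deriv (fun t => t%:C) t 1.
Proof.
move=> eps e0; exists 1 => // h _.
rewrite (_ : _ - _ = 0) ?normc0 ?mulr_ge0 ?normc_ge0 ?ltW//.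
by rewrite rmorphD/=; ring.
Qed.

Lemma cderiv_sqr (z : C) : cderiv (fun z => z * z) z (2 * z).
Proof.
move=> eps e0; exists eps => // h hh.
rewrite (_ : _ - _ = h * h); last by ring.
by rewrite normcM ler_wpM2r ?normc_ge0 ?ltW.
Qed.

Lemma cderiv_scale (c z : C) : cderiv (fun z => c * z) z c.
Proof.
move=> eps e0; exists 1 => // h _.
by rewrite (_ : _ - _ = 0) ?normc0 ?mulr_ge0 ?normc_ge0 ?ltW//; ring.
Qed.

Lemma cderiv_inv (z : C) : z != 0 -> cderiv (fun z => z^-1) z (- (z^-1 * z^-1)).
Proof.
move=> z0 eps e0; have nz : 0 < normc z by rewrite normc_gt0.
exists (Num.min (normc z / 2) (eps * normc z ^+ 3 / 2)) => [|h].
  by rewrite lt_min !divr_gt0// mulr_gt0// exprn_gt0.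
rewrite lt_min => /andP[h1 h2].
have nzh : normc z / 2 <= normc (z + h).
  by have := normc_subr z (- h); rewrite normcN opprK; lra.
have zh0 : z + h != 0 by rewrite -normc_gt0; apply: lt_le_trans nzh; lra.
have -> : (z + h)^-1 - z^-1 - h * - (z^-1 * z^-1) = h * (h / (z * z * (z + h))).
  by field; rewrite z0 zh0.
rewrite normcM mulrC ler_wpM2r ?normc_ge0// normcM normcV !normcM.
rewrite ler_pdivrMr; last by rewrite !mulr_gt0// normc_gt0.
apply: le_trans (ltW h2) _.
have -> : eps * normc z ^+ 3 / 2 = eps * (normc z * normc z * (normc z / 2)) by field.
by rewrite ler_wpM2l ?(ltW e0)// ler_wpM2l// mulr_ge0 ?(ltW nz).
Qed.

End ComplexDeriv.

Section DerivRules.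
Variables (R : realType) (X : zmodType) (e : X -> R[i]).
Local Notation D := (cderiv_along e).
Implicit Types (F G : X -> R[i]).

Lemma cderiv_along_scale c F x l : D F x l -> D (fun y => c * F y) x (c * l).
Proof. by move=> hF; exact: cderiv_along_comp hF (cderiv_scale _ _). Qed.

Lemma cderiv_along_opp F x l : D F x l -> D (fun y => - F y) x (- l).
Proof.
move=> /(cderiv_along_scale (-1)) h eps e0; have [d d0 k] := h _ e0.
by exists d => // y /k; rewrite !mulN1r.
Qed.

Lemma cderiv_along_sub F G x l m : D F x l -> D G x m ->
  D (fun y => F y - G y) x (l - m).
Proof. by move=> hF /cderiv_along_opp; exact: cderiv_along_add. Qed.

(** Polarization: 4 F G = (F + G)^2 - (F - G)^2, so the chain rule with the square and the rules for
    sums suffice. *)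
Lemma cderiv_along_mul F G x l m : D F x l -> D G x m ->
  D (fun y => F y * G y) x (l * G x + F x * m).
Proof.
move=> hF hG.
have sq H k : D H x k -> D (fun y => H y * H y) x (2 * H x * k).
  by move=> h; exact: cderiv_along_comp h (cderiv_sqr _).
have := cderiv_along_sub (sq _ _ (cderiv_along_add hF hG))
                          (sq _ _ (cderiv_along_sub hF hG)).
move/(cderiv_along_scale (4^-1)) => h eps e0; have [d d0 k] := h _ e0.
exists d => // y /k; apply: le_trans.
by rewrite le_eqVlt; apply/orP; left; apply/eqP; congr normc; field.
Qed.

Lemma cderiv_along_inv F x l : D F x l -> F x != 0 ->
  D (fun y => (F y)^-1) x (- l / (F x * F x)).
Proof.
move=> hF F0; apply: cderiv_along_eq (cderiv_along_comp hF (cderiv_inv F0)) _.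
by field.
Qed.

Lemma cderiv_along_exp F x l n : D F x l ->
  D (fun y => F y ^+ n) x (n%:R * F x ^+ n.-1 * l).
Proof.
move=> hF; elim: n => [|n IH].
  by rewrite !mul0r; exact: cderiv_along_cst.
have := cderiv_along_mul hF IH.
rewrite [X in D _ x X](_ : _ = n.+1%:R * F x ^+ n.+1.-1 * l).
  by move=> h eps /h[d d0 k]; exists d => // y /k; rewrite !exprS.
case: n {IH} => [|n] /=; first by rewrite !expr0; ring.
by rewrite -[in RHS]natr1 exprS; ring.
Qed.

Lemma cderiv_along_sum (n : nat) (F : nat -> X -> R[i]) x l :
  (forall i, D (F i) x (l i)) ->
  D (fun y => \sum_(i < n) F i y) x (\sum_(i < n) l i).
Proof.
move=> hF; elim: n => [|n IH].
  rewrite big_ord0 => eps e0; exists 1 => // h _.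
  by rewrite !big_ord0 subrr mulr0 subr0 normc0 mulr_ge0 ?normc_ge0// ltW.
rewrite big_ord_recr => eps e0 /=.
have [d d0 k] := cderiv_along_add IH (hF n) e0.
by exists d => // h /k; rewrite !big_ord_recr.
Qed.

End DerivRules.

Section DerivLink.
Variable R : realType.
Local Notation C := (R[i]).

(** The inequality of [cderiv] is the convergence of the difference quotient multiplied through by
    |h|. The version with a direction v serves both one complex variable and the definition of
    [partial]. *)
Lemma is_derive_cderiv (V : normedModType C) (f : V -> C^o) (a v : V) (l : C) :
  is_derive a v f l <-> cderiv (fun h : C => f (h *: v + a) : C) 0 l.
Proof.
split.
  case=> df dl; have := df; rewrite /derivable => /cvg_ex[l' hl'].
  have ll' : l' = l by rewrite -dl; apply/esym/cvg_lim.
  rewrite {}ll' in hl' => eps e0.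
  move/cvgr_dist_lt: hl' => /(_ eps%:C); rewrite ltcR => /(_ e0).
  case=> d /= d0 hd.
  exists (complex.Re d) => [|h hh]; first by move: d0; rewrite ltcE/= => /andP[].
  have [->|h0] := eqVneq h 0.
    by rewrite addr0 subrr mul0r subr0 normc0 mulr0.
  have := hd h; rewrite /ball_ /= sub0r normrN normr_normc.
  move=> /(_ _ h0); rewrite ltcE /=.
  move: d0; rewrite ltcE => /andP[/= id0 _].
  rewrite id0 hh => /(_ isT).
  rewrite normr_normc ltcR add0r => /ltW k.
  have -> : f (h *: v + a) - f (0 *: v + a) - h * l =
     - h * (l - h^-1 * (f (h *: v + a) - f a)).
    by rewrite scale0r add0r; field.
  by rewrite normcM normcN mulrC ler_wpM2r ?normc_ge0.
move=> hd.
have cv : (fun h : C^o => h^-1 *: ((f \o shift a) (h *: v) - f a)) @ 0^' -->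
          (l : C^o).
  apply/cvgrPdist_le => e; case: e => e1 e2; rewrite ltcE /= => /andP[/eqP-> e0].
  have [d d0 k] := hd _ e0.
  exists d%:C => /=; first by rewrite ltcR.
  move=> h /=; rewrite /ball_/= sub0r normrN normr_normc ltcR => /k k1 h0.
  rewrite normr_normc lecR.
  have : normc h * normc (l - h^-1 * (f (h *: v + a) - f a)) <=
         normc h * e1.
    rewrite -normcM [leRHS]mulrC -normcN; apply: le_trans k1.
    rewrite le_eqVlt; apply/orP; left; apply/eqP; congr normc.
    by rewrite add0r scale0r add0r; field.
  by rewrite ler_pM2l// normc_gt0.
split; first by apply/cvg_ex; exists l.
exact/cvg_lim.
Qed.

Lemma derivable_cderiv (g : C -> C) (z : C) :
  derivable (g : C^o -> C^o) z 1 <-> exists l, cderiv g z l.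
Proof.
have E l : cderiv (fun h : C => g (h *: (1 : C^o) + z)) 0 l <-> cderiv g z l.
  have yE (y : C) : y *: (1 : C^o) = y by exact: mulr1.
  by split=> h eps /h[d d0 k]; exists d => // y /k;
    rewrite add0r scale0r add0r yE (addrC y).
split=> [h|[l]].
  exists ('D_1 (g : C^o -> C^o) z).
  by apply/E/(@is_derive_cderiv C^o); exact/derivableP.
by move=> /E/(@is_derive_cderiv C^o)[].
Qed.

End DerivLink.

(** * Curves in the complex plane and the mean value inequality *)

Section Curves.
Variable R : realType.
Local Notation C := (R[i]).
Implicit Types (u : R -> C).

Lemma cderiv_curve (F : C -> C) u t l m : cderiv F (u t) m -> curve_deriv u t l ->
  curve_deriv (fun t => F (u t)) t (m * l).
Proof. by move=> hF hu; exact: cderiv_along_comp hu hF. Qed.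

(** Reduces a curve to two real functions, to which the real mean value theorem and the derivatives
    of ln, atan, exp, sin and cos apply. *)
Lemma curve_deriv_ReIm u t l : curve_deriv u t l <->
  is_derive t 1 (fun t => complex.Re (u t)) (complex.Re l) /\
  is_derive t 1 (fun t => complex.Im (u t)) (complex.Im l).
Proof.
have fwd (f : R -> R) (k : R) :
   (forall eps, 0 < eps -> exists2 d : R, 0 < d & forall h, `|h| < d ->
      `|f (t + h) - f t - h * k| <= eps * `|h|) <-> is_derive t 1 f k.
  split=> [hd|[df dl] eps e0].
    have cv : (fun h : R => h^-1 *: ((f \o shift t) (h *: (1 : R)) - f t)) @ 0^'
          --> k.
      apply/cvgrPdist_le => eps e0; have [d d0 kd] := hd _ e0.
      exists d => //= h; rewrite /ball_/= sub0r normrN => /kd k1 h0.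
      rewrite -(ler_pM2l (_ : 0 < `|h|)) ?normr_gt0// -normrM [leRHS]mulrC.
      apply: le_trans k1; rewrite -normrN le_eqVlt; apply/orP; left; apply/eqP.
      have -> : h%:A = h by exact: mulr1.
      rewrite (addrC t) (_ : h^-1 *: (f (h + t) - f t) = h^-1 * (f (h + t) - f t))//.
      by congr `| _ |; field.
    split; first by apply/cvg_ex; exists k.
    exact/cvg_lim.
  have := df; rewrite /derivable => /cvg_ex[l' hl'].
  have ll' : l' = k by rewrite -dl; apply/esym/cvg_lim.
  rewrite {}ll' in hl'.
  move/cvgr_dist_le: hl' => /(_ eps e0)[d /= d0 kd].
  exists d => // h hh.
  have [->|h0] := eqVneq h 0.
    by rewrite addr0 subrr mul0r subr0 normr0 mulr0.
  have := kd h; rewrite /ball_/= sub0r normrN => /(_ hh h0).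
  rewrite -(ler_pM2l (_ : 0 < `|h|)) ?normr_gt0// -normrM [leRHS]mulrC.
  apply: le_trans; rewrite -normrN le_eqVlt; apply/orP; left; apply/eqP.
  have -> : h%:A = h by exact: mulr1.
      rewrite (addrC t) (_ : h^-1 *: (f (h + t) - f t) = h^-1 * (f (h + t) - f t))//.
      by congr `| _ |; field.
have bd h : (complex.Re (u (t + h) - u t - h%:C * l) =
      complex.Re (u (t + h)) - complex.Re (u t) - h * complex.Re l) *
    (complex.Im (u (t + h) - u t - h%:C * l) =
      complex.Im (u (t + h)) - complex.Im (u t) - h * complex.Im l).
  by rewrite !ReD !ImD !ReN !ImN Re_real_complexM Im_real_complexM.
split=> [hu|[/fwd h1 /fwd h2] eps e0].
  split; apply/fwd => eps /hu[d d0 k]; exists d => // h hh;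
    have := k h; rewrite normc_real => /(_ hh).
    by rewrite -bd; apply: le_trans; exact: ler_Re_normc.
  by rewrite -bd; apply: le_trans; exact: ler_Im_normc.
have e2 : 0 < eps / 2 by rewrite divr_gt0.
have [d1 d10 k1] := h1 _ e2; have [d2 d20 k2] := h2 _ e2.
exists (Num.min d1 d2) => [|h]; first by rewrite lt_min d10.
rewrite normc_real lt_min => /andP[/k1 m1 /k2 m2].
by apply: le_trans (normc_le_ReIm _) _; rewrite !bd; lra.
Qed.

Lemma curve_deriv_continuous u t l : curve_deriv u t l ->
  {for t, continuous (fun t => complex.Re (u t))} /\
  {for t, continuous (fun t => complex.Im (u t))}.
Proof.
move=> /curve_deriv_ReIm[[d1 _] [d2 _]].
by split; apply: differentiable_continuous; apply/derivable1_diffP.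
Qed.

(** The factor 2 comes from applying the real mean value theorem to the real and imaginary parts
    separately, at two different intermediate points. *)
Lemma curve_mean_value u (du : R -> C) (a b K : R) : a <= b ->
  (forall t, a <= t <= b -> curve_deriv u t (du t)) ->
  (forall t, a <= t <= b -> normc (du t) <= K) ->
  normc (u b - u a) <= 2 * K * (b - a).
Proof.
rewrite le_eqVlt => /predU1P[->|ab] hu hK.
  by rewrite !subrr normc0 mulr0.
have itv t : t \in `]a, b[ -> a <= t <= b.
  by rewrite in_itv/= => /andP[/ltW-> /ltW->].
have [c1 c1ab e1] : exists2 c, c \in `]a, b[ &
    complex.Re (u b) - complex.Re (u a) = complex.Re (du c) * (b - a).
  apply: (@MVT _ (fun t => complex.Re (u t))) => // [t /itv /hu /curve_deriv_ReIm[]//|].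
  apply: continuous_in_subspaceT => t; rewrite inE/= in_itv/= => tab.
  by have [] := curve_deriv_continuous (hu t tab).
have [c2 c2ab e2] : exists2 c, c \in `]a, b[ &
    complex.Im (u b) - complex.Im (u a) = complex.Im (du c) * (b - a).
  apply: (@MVT _ (fun t => complex.Im (u t))) => // [t /itv /hu /curve_deriv_ReIm[]//|].
  apply: continuous_in_subspaceT => t; rewrite inE/= in_itv/= => tab.
  by have [] := curve_deriv_continuous (hu t tab).
apply: le_trans (normc_le_ReIm _) _.
rewrite !ReD !ImD !ReN !ImN e1 e2 !normrM (gtr0_norm (_ : 0 < b - a)) ?subr_gt0//.
rewrite -mulrDl ler_wpM2r ?subr_ge0 ?(ltW ab)//.
have := le_trans (ler_Re_normc _) (hK c1 (itv _ c1ab)).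
have := le_trans (ler_Im_normc _) (hK c2 (itv _ c2ab)).
lra.
Qed.

End Curves.

(** * Principal powers and the binomial series *)

Section PrincipalPowers.
Variable R : realType.
Local Notation C := (R[i]).
Implicit Types (u v z : C) (s t : R).

Definition expi t : C := cos t +i* sin t.

Lemma expiD s t : expi (s + t) = expi s * expi t.
Proof.
apply/eqP; rewrite eq_complex /= cosD sinD; apply/andP; split; apply/eqP; ring.
Qed.

Lemma expi0 : expi 0 = 1.
Proof. by rewrite /expi cos0 sin0. Qed.

Lemma normc_expi t : normc (expi t) = 1.
Proof. by rewrite /= cos2Dsin2 sqrtr1. Qed.

Lemma expi_neq0 t : expi t != 0.
Proof. by rewrite -normc_gt0 normc_expi. Qed.

Lemma expiJ t : conjC (expi t) = expi (- t).
Proof. by rewrite /expi cosN sinN. Qed.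

(** For 0 < x < 2 pi, sin (x / 2) > 0 and cos x = 1 - 2 sin^2 (x / 2) exclude cos x = 1; negative t
    is treated by conjugation. *)
Lemma expi_eq1 t : - (2 * pi) < t < 2 * pi -> expi t = 1 -> t = 0.
Proof.
have pos x : 0 < x < 2 * pi -> expi x = 1 -> False.
  move=> /andP[x0 x2] [c1 _].
  have /sin_gt0_pi : 0 < x / 2 < pi by apply/andP; split; lra.
  have : cos x = cos (x / 2 + x / 2) by congr cos; field.
  rewrite cosD -!expr2 c1 cos2sin2 => h; nra.
move=> /andP[t1 t2] h; apply/eqP; rewrite eq_le !leNgt.
apply/andP; split; apply/negP => ht.
  by apply: (pos t) => //; rewrite ht.
apply: (pos (- t)) => //; first by apply/andP; split; lra.
by rewrite -expiJ h rmorph1.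
Qed.

(** Powers are only taken of numbers with positive real part, such as 1 - z conj w in the disc.
    There the case distinction in [arg] disappears in favour of a differentiable formula. *)
Lemma arg_atan u : 0 < complex.Re u -> arg u = atan (complex.Im u / complex.Re u).
Proof.
case: u => x y /= x0; set q := y / x.
have r0 : 0 < Num.sqrt (x ^+ 2 + y ^+ 2).
  by rewrite sqrtr_gt0 ltr_wpDr ?sqr_ge0// exprn_gt0.
have cq : cos (atan q) = x / Num.sqrt (x ^+ 2 + y ^+ 2).
  rewrite cos_atan -[RHS]invrK invf_div; congr (_ ^-1).
  rewrite -{2}(gtr0_norm x0) -sqrtr_sqr -sqrtrV ?sqr_ge0// -sqrtrM ?addr_ge0 ?sqr_ge0//.
  by congr Num.sqrt; rewrite /q; field; rewrite gt_eqF.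
have pos : forall p : R, 0 <= p -> acos (cos (atan p)) = atan p.
  move=> p p0; apply: cosK; rewrite in_itv/=; apply/andP; split.
    by rewrite -(@atan0 R) le_atan.
  by have := atan_ltpi2 p; have := pi_gt0 R; lra.
rewrite /arg /= -cq; have [y0|y0] := ltP.
  have q0 : 0 <= - q by rewrite oppr_ge0 /q pmulr_lle0 ?invr_gt0 ?ltW.
  by rewrite -cosN -atanN pos// atanN opprK.
by rewrite pos// /q divr_ge0// ltW.
Qed.

Lemma arg_bounds u : 0 < complex.Re u -> - (pi / 2) < arg u < pi / 2.
Proof. by move=> u0; rewrite arg_atan// atan_gtNpi2 atan_ltpi2. Qed.

Lemma polar u : 0 < complex.Re u -> u = (normc u)%:C * expi (arg u).
Proof.
move=> u0; rewrite arg_atan//; case: u u0 => x y /= x0; set q := y / x.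
have r0 : 0 < Num.sqrt (x ^+ 2 + y ^+ 2).
  by rewrite sqrtr_gt0 ltr_wpDr ?sqr_ge0// exprn_gt0.
have cq : cos (atan q) = x / Num.sqrt (x ^+ 2 + y ^+ 2).
  rewrite cos_atan -[RHS]invrK invf_div; congr (_ ^-1).
  rewrite -{2}(gtr0_norm x0) -sqrtr_sqr -sqrtrV ?sqr_ge0// -sqrtrM ?addr_ge0 ?sqr_ge0//.
  by congr Num.sqrt; rewrite /q; field; rewrite gt_eqF.
have c0 : cos (atan q) != 0 by rewrite cq mulf_neq0 ?invr_eq0 ?gt_eqF.
have sq : sin (atan q) = q * cos (atan q).
  by have := atanK q; rewrite /tan => {2}<-; rewrite divfK.
apply/eqP; rewrite eq_complex /= sq cq /q; apply/andP; split; apply/eqP; field;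
  by rewrite ?(gt_eqF r0) ?(gt_eqF x0).
Qed.

Lemma cpowE u s : cpow u s = (normc u `^ s)%:C * expi (s * arg u).
Proof. by rewrite /cpow normr_normc. Qed.

Lemma Re_gt0_neq0 u : 0 < complex.Re u -> 0 < normc u.
Proof. by move=> /lt_le_trans; apply; exact: Re_le_normc. Qed.

(** All four arguments lie strictly between -pi/2 and pi/2, so the defect of additivity lies
    strictly between -2 pi and 2 pi, where 0 is the only zero of expi t = 1. This is just enough for
    the three factors on one side of [mob_kernel]. *)
Lemma arg_mul3 u v p q : 0 < complex.Re u -> 0 < complex.Re v ->
  0 < complex.Re p -> 0 < complex.Re q -> u = v * p * q ->
  arg u = arg v + arg p + arg q.
Proof.
move=> u0 v0 p0 q0 e.
have /eqP : arg v + arg p + arg q - arg u = 0; last first.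
  by rewrite subr_eq0 => /eqP.
apply: expi_eq1.
  have := arg_bounds u0; have := arg_bounds v0; have := arg_bounds p0.
  by have := arg_bounds q0; move=> /andP[? ?] /andP[? ?] /andP[? ?] /andP[? ?];
    apply/andP; split; lra.
have nu := Re_gt0_neq0 u0.
have h : (normc u)%:C * expi (arg v + arg p + arg q) = (normc u)%:C * expi (arg u).
  rewrite -polar// {2}e {2}(polar v0) {2}(polar p0) {2}(polar q0) !expiD e !normcM.
  by rewrite !rmorphM/=; ring.
rewrite expiD; have /mulfI -> := h; last first.
  by rewrite -normc_gt0 normc_real gtr0_norm.
by rewrite -expiD subrr expi0.
Qed.

Lemma cpow_mul3 u v p q s : 0 < complex.Re u -> 0 < complex.Re v ->
  0 < complex.Re p -> 0 < complex.Re q -> u = v * p * q ->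
  cpow u s = cpow v s * cpow p s * cpow q s.
Proof.
move=> u0 v0 p0 q0 e; rewrite !cpowE (arg_mul3 u0 v0 p0 q0 e).
rewrite e !normcM !powRM ?mulr_ge0 ?normc_ge0// !rmorphM/= !mulrDr !expiD; ring.
Qed.

Lemma cpow1 s : cpow (1 : C) s = 1.
Proof.
rewrite cpowE normc1 powR1 arg_atan/= ?ltr01// mul0r atan0 mulr0 expi0.
by rewrite mulr1.
Qed.

Lemma cpow_mul u v s : 0 < complex.Re u -> 0 < complex.Re v ->
  0 < complex.Re (u * v) -> cpow (u * v) s = cpow u s * cpow v s.
Proof.
move=> u0 v0 uv0; rewrite (@cpow_mul3 _ u v 1)// ?cpow1 ?mulr1//=.
Qed.

Lemma cpow_real (x : R) s : 0 < x -> cpow x%:C s = (x `^ s)%:C.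
Proof.
move=> x0; rewrite cpowE normc_real gtr0_norm// arg_atan//= mul0r atan0 mulr0.
by rewrite expi0 mulr1.
Qed.

Lemma cpow_neq0 u s : 0 < complex.Re u -> cpow u s != 0.
Proof.
move=> u0; rewrite cpowE mulf_neq0 ?expi_neq0//.
rewrite -normc_gt0 normc_real gtr0_norm powR_gt0 ?Re_gt0_neq0//.
Qed.

Lemma normc_cpow u s : 0 < complex.Re u -> normc (cpow u s) = normc u `^ s.
Proof.
by move=> u0; rewrite cpowE normcM normc_expi mulr1 normc_real ger0_norm ?powR_ge0.
Qed.

Lemma cpowD u s t : 0 < complex.Re u -> cpow u (s + t) = cpow u s * cpow u t.
Proof.
move=> u0; rewrite !cpowE mulrDl expiD powRD; last first.
  by apply/implyP => _; rewrite gt_eqF ?Re_gt0_neq0.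
by rewrite rmorphM/=; ring.
Qed.

Lemma cpowN u s : 0 < complex.Re u -> cpow u (- s) = (cpow u s)^-1.
Proof.
move=> u0; apply: (mulfI (cpow_neq0 s u0)); rewrite -cpowD// subrr.
rewrite mulfV ?cpow_neq0// cpowE powRr0 mul0r expi0 mulr1//.
Qed.

Lemma cpow_pow1 u : 0 < complex.Re u -> cpow u 1 = u.
Proof.
by move=> u0; rewrite cpowE powRr1 ?normc_ge0// mul1r -polar.
Qed.

Lemma cpowJ u s : 0 < complex.Re u -> cpow (conjC u) s = conjC (cpow u s).
Proof.
move=> u0; rewrite !cpowE rmorphM/= conjC_realE expiJ normcJ.
rewrite !arg_atan//; last by case: u u0.
by congr (_ * expi _); case: u {u0} => x y /=; rewrite mulNr atanN mulrN.
Qed.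

Definition cexp z : C := (expR (complex.Re z))%:C * expi (complex.Im z).

(** The principal logarithm is written as ln (|u|^2) / 2 + i atan (Im u / Re u), without a square
    root, so that both components can be differentiated directly. *)
Lemma cpow_cexp u s : 0 < complex.Re u ->
  cpow u s = cexp (s%:C * (ln (complex.Re u ^+ 2 + complex.Im u ^+ 2) / 2 +i*
                           atan (complex.Im u / complex.Re u))).
Proof.
move=> u0; rewrite /cexp Re_real_complexM Im_real_complexM /= cpowE arg_atan//.
congr (_%:C * _); rewrite /powR gt_eqF ?Re_gt0_neq0//; congr (expR (_ * _)).
have n0 := Re_gt0_neq0 u0.
by rewrite -sqr_normcE lnXn// mulr2n; field.
Qed.

Lemma curve_deriv_cexp (w : R -> C) t l : curve_deriv w t l ->
  curve_deriv (fun t => cexp (w t)) t (l * cexp (w t)).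
Proof.
move=> /curve_deriv_ReIm[h1 h2]; apply/curve_deriv_ReIm.
have hE := is_derive1_comp (is_derive_expR (complex.Re (w t))) h1.
have hC := is_derive1_comp (is_derive_cos (complex.Im (w t))) h2.
have hS := is_derive1_comp (is_derive_sin (complex.Im (w t))) h2.
have eR : (fun t => complex.Re (cexp (w t))) =
   (expR \o (fun t => complex.Re (w t))) * (cos \o (fun t => complex.Im (w t))).
  by apply/funext => x; rewrite /cexp /= mul0r subr0.
have eI : (fun t => complex.Im (cexp (w t))) =
   (expR \o (fun t => complex.Re (w t))) * (sin \o (fun t => complex.Im (w t))).
  by apply/funext => x; rewrite /cexp /= mul0r addr0.
rewrite eR eI; split.
  apply: is_derive_eq; rewrite /cexp /=; case: l {h1 h2 hE hC hS} => a b /=.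
  by rewrite /GRing.scale /=; ring.
apply: is_derive_eq; rewrite /cexp /=; case: l {h1 h2 hE hC hS} => a b /=.
by rewrite /GRing.scale /=; ring.
Qed.

Lemma curve_deriv_cpow (u : R -> C) s t l : curve_deriv u t l ->
  0 < complex.Re (u t) ->
  curve_deriv (fun t => cpow (u t) s) t (s%:C * (l / u t) * cpow (u t) s).
Proof.
move=> hu u0.
(* The logarithmic formula is only valid in the right half plane, so the curve is first confined to
   it near t. *)
have [d d0 hd] : exists2 d : R, 0 < d &
    forall h : R, normc h%:C < d -> 0 < complex.Re (u (t + h)).
  have e0 : 0 < complex.Re (u t) / 2 by rewrite divr_gt0.
  have [d d0 hd] := cderiv_along_cont hu e0; exists d => // h /hd k.
  have := le_trans (ler_Re_normc _) k; rewrite ReD ReN ler_norml => /andP[]; lra.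
set w := fun t => s%:C * (ln (complex.Re (u t) ^+ 2 + complex.Im (u t) ^+ 2) / 2 +i*
                           atan (complex.Im (u t) / complex.Re (u t))).
apply: (@cderiv_along_ext _ _ _ (fun t => cexp (w t)) _ _ _ d) => // [h /hd k|].
  by rewrite cpow_cexp.
rewrite (cpow_cexp s u0); apply: curve_deriv_cexp.
apply: cderiv_along_scale; apply/curve_deriv_ReIm => /=.
have [hx hy] := (curve_deriv_ReIm u t l).1 hu.
set x := fun t => complex.Re (u t) in hx *.
set y := fun t => complex.Im (u t) in hy *.
have x0 : x t != 0 by rewrite gt_eqF.
have r0 : 0 < x t ^+ 2 + y t ^+ 2.
  by rewrite ltr_wpDr ?sqr_ge0// exprn_gt0.
have e : l / u t = ((complex.Re l * x t + complex.Im l * y t) / (x t ^+ 2 + y t ^+ 2)) +i*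
  ((complex.Im l * x t - complex.Re l * y t) / (x t ^+ 2 + y t ^+ 2)).
  rewrite /x /y in r0 *; case: (u t) r0 => a b /= r0; case: (l) => c f.
  by apply/eqP; rewrite eq_complex /=; apply/andP; split; apply/eqP; field; rewrite gt_eqF.
rewrite e /=; split.
  have hsum : is_derive t 1 (fun t => x t ^+ 2 + y t ^+ 2)
      (2 * x t * complex.Re l + 2 * y t * complex.Im l).
    rewrite (_ : (fun _ => _) = x ^+ 2 + y ^+ 2); last first.
      by apply/funext => z; rewrite /= !fctE.
    by apply: is_derive_eq; rewrite /GRing.scale/= !expr1; ring.
  have hl := @is_derive1_comp R (@ln R) (fun t => x t ^+ 2 + y t ^+ 2) t _ _
    (is_derive1_ln r0) hsum.
  rewrite (_ : (fun _ => _) = 2^-1 *: (@ln R \o (fun t => x t ^+ 2 + y t ^+ 2))); last first.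
    by apply/funext => z /=; rewrite mulrC.
  apply: is_derive_eq; rewrite /GRing.scale/=; field; rewrite gt_eqF//.
have hq : is_derive t 1 (fun t => y t / x t)
    ((complex.Im l * x t - complex.Re l * y t) / x t ^+ 2).
  have hv := is_deriveV x0 hx.
  rewrite (_ : (fun _ => _) = y * (fun t => (x t)^-1)); last by apply/funext.
  by apply: is_derive_eq; rewrite /GRing.scale/=; field.
have ha := @is_derive1_comp R (@atan R) (fun t => y t / x t) t _ _
  (is_derive1_atan (y t / x t)) hq.
apply: (is_derive_eq ha); field; rewrite x0 gt_eqF//.
Qed.

End PrincipalPowers.

Definition clim (R : realType) (u : nat -> R[i]) (l : R[i]) : Prop :=
  forall eps : R, 0 < eps -> exists N : nat, forall n : nat, (N <= n)%N ->
    normc (u n - l) <= eps.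

Section ComplexLimits.
Variable R : realType.
Implicit Types (u v : nat -> R[i]).

Lemma clim_add u v l m : clim u l -> clim v m -> clim (fun n => u n + v n) (l + m).
Proof.
move=> hu hv eps e0; have e2 : 0 < eps / 2 by rewrite divr_gt0.
have [N1 h1] := hu _ e2; have [N2 h2] := hv _ e2.
exists (maxn N1 N2) => n; rewrite geq_max => /andP[/h1 k1 /h2 k2].
rewrite (_ : _ - _ = (u n - l) + (v n - m)); last by ring.
by apply: le_trans (le_normcD _ _) _; lra.
Qed.

Lemma clim_scale (c : R[i]) u l : clim u l -> clim (fun n => c * u n) (c * l).
Proof.
move=> hu eps e0; have c0 : 0 < 1 + normc c by rewrite ltr_wpDr ?normc_ge0.
have [N h] := hu _ (divr_gt0 e0 c0); exists N => n /h.
rewrite ler_pdivlMr// => k; rewrite -mulrBr normcM mulrC.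
by apply: le_trans k; rewrite ler_wpM2l ?normc_ge0//; lra.
Qed.

Lemma clim_sum (I : eqType) (r : seq I) (u : I -> nat -> R[i]) (l : I -> R[i]) :
  (forall i, i \in r -> clim (u i) (l i)) ->
  clim (fun n => \sum_(i <- r) u i n) (\sum_(i <- r) l i).
Proof.
elim: r => [|i r IH] hu.
  by rewrite big_nil => eps e0; exists 0%N => n _; rewrite big_nil subrr normc0 ltW.
have {}IH := IH (fun j hj => hu j (@mem_behead _ (i :: r) j hj)).
rewrite big_cons => eps e0; have [N h] := clim_add (hu i (mem_head _ _)) IH e0.
by exists N => n /h; rewrite big_cons.
Qed.

Lemma clim_Re_ge0 u l : clim u l -> (forall n, 0 <= complex.Re (u n)) ->
  0 <= complex.Re l.
Proof.
move=> hu u0; rewrite leNgt; apply/negP => l0.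
have e0 : 0 < - complex.Re l / 2 by rewrite divr_gt0// oppr_gt0.
have [N /(_ N (leqnn _)) h] := hu _ e0.
have := le_trans (Re_le_normc _) h; rewrite ReD ReN.
by have := u0 N; lra.
Qed.

Lemma clim_unique u l m : clim u l -> clim u m -> l = m.
Proof.
move=> hl hm; apply/eqP; rewrite -subr_eq0 -normc_eq0 eq_le normc_ge0 andbT leNgt.
apply/negP => d0; have e0 : 0 < normc (l - m) / 3 by rewrite divr_gt0.
have [N1 h1] := hl _ e0; have [N2 h2] := hm _ e0.
have k1 := h1 (maxn N1 N2) (leq_maxl _ _); have k2 := h2 (maxn N1 N2) (leq_maxr _ _).
have := normc_sub (u (maxn N1 N2) - m) (u (maxn N1 N2) - l).
rewrite (_ : _ - _ - _ = l - m); last by ring.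
lra.
Qed.

Lemma ratio_lim0 (c : nat -> R) (r : R) (N0 : nat) : 0 <= r -> r < 1 ->
  (forall n, 0 <= c n) -> (forall n, (N0 <= n)%N -> c n.+1 <= r * c n) ->
  forall eps, 0 < eps -> exists N : nat, forall n, (N <= n)%N -> c n <= eps.
Proof.
move=> r0 r1 c0 hc eps e0.
have bd k : c (N0 + k)%N <= c N0 * r ^+ k.
  elim: k => [|k IH]; first by rewrite addn0 expr0 mulr1.
  rewrite addnS exprS mulrCA; apply: le_trans (hc _ (leq_addr _ _)) _.
  by rewrite ler_wpM2l.
have := @cvg_geometric R (c N0) r; rewrite ger0_norm// => /(_ r1).
move=> /cvgrPdist_le/(_ _ e0)[N _ hN].
exists (N0 + N)%N => n hn; have le0 : (N0 <= n)%N by apply: leq_trans hn; exact: leq_addr.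
rewrite -(subnKC le0); apply: le_trans (bd _) _.
have /hN : (N <= n - N0)%N by rewrite leq_subRL.
by rewrite /geometric /= sub0r normrN => /(le_trans (ler_norm _)).
Qed.

End ComplexLimits.

(** * The binomial series of (1 - x)^(-b) *)

Section BinomialSeries.
Variable R : realType.
Local Notation C := (R[i]).

(* The coefficient of x^n in (1 - x)^(-b). *)
Definition bincoef (b : R) (n : nat) : R := \prod_(i < n) ((b + i%:R) / i.+1%:R).

Lemma bincoef0 b : bincoef b 0 = 1.
Proof. by rewrite /bincoef big_ord0. Qed.

Lemma bincoefS b n : n.+1%:R * bincoef b n.+1 = (b + n%:R) * bincoef b n.
Proof.
by rewrite /bincoef big_ord_recr /= mulrC -mulrA divfK ?pnatr_eq0// mulrC.
Qed.

Lemma bincoef_gt0 b n : 0 < b -> 0 < bincoef b n.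
Proof.
by move=> b0; apply: prodr_gt0 => i _; rewrite divr_gt0 ?ltr0n// ltr_wpDr.
Qed.

Lemma bincoef_ratio b n : 0 < b -> bincoef b n.+1 <= Num.max 1 b * bincoef b n.
Proof.
move=> b0; rewrite -(ler_pM2l (_ : 0 < n.+1%:R)) ?ltr0n// bincoefS.
rewrite mulrA ler_wpM2r ?(ltW (bincoef_gt0 _ _))// -natr1 mulrDl mul1r addrC lerD//.
  by rewrite ler_peMr// le_max lexx.
by rewrite le_max lexx orbT.
Qed.

Lemma bincoef_le b n : 0 < b -> bincoef b n <= Num.max 1 b ^+ n.
Proof.
move=> b0; elim: n => [|n IH]; first by rewrite bincoef0 expr0.
apply: le_trans (bincoef_ratio n b0) _; rewrite exprS ler_wpM2l//.
by rewrite le_max ler01.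
Qed.

(** The ratio of consecutive terms is rho (b + n) / n. It is at most the midpoint r of rho and 1 as
    soon as n >= rho b / (r - rho), which is where M comes from. *)
Lemma bincoef_growth b rho : 0 < b -> 0 <= rho -> rho < 1 -> forall eps, 0 < eps ->
  exists N : nat, forall n, (N <= n)%N -> n%:R * bincoef b n * rho ^+ n <= eps.
Proof.
move=> b0 rho0 rho1.
set r := (1 + rho) / 2.
have [M hM] : exists M : nat, rho * b / (r - rho) <= M%:R.
  exists (Num.bound (rho * b / (r - rho))).
  apply: ltW; apply: archi_boundP.
  by rewrite divr_ge0 ?mulr_ge0 ?(ltW b0)// /r; lra.
apply: (@ratio_lim0 _ _ r M); rewrite ?/r; [lra|lra| |].
  by move=> n; rewrite !mulr_ge0 ?exprn_ge0 ?(ltW (bincoef_gt0 _ _)).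
move=> n Mn; rewrite bincoefS exprS -/r.
have hn : rho * b <= (r - rho) * n%:R.
  rewrite [leRHS]mulrC -ler_pdivrMr; last by rewrite /r; lra.
  by apply: le_trans hM _; rewrite ler_nat.
have -> : (b + n%:R) * bincoef b n * (rho * rho ^+ n) =
  (rho * (b + n%:R)) * (bincoef b n * rho ^+ n) by ring.
have -> : r * (n%:R * bincoef b n * rho ^+ n) = (r * n%:R) * (bincoef b n * rho ^+ n).
  by ring.
rewrite ler_wpM2r//; last by lra.
by rewrite mulr_ge0 ?exprn_ge0 ?(ltW (bincoef_gt0 _ _)).
Qed.

Definition binsum (b : R) (x : C) (n : nat) : C :=
  \sum_(i < n) (bincoef b i)%:C * x ^+ i.

Lemma Re_1sub_gt0 (x : C) : normc x < 1 -> 0 < complex.Re (1 - x).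
Proof. by move=> h; rewrite ReD ReN /=; have := Re_le_normc x; lra. Qed.

(* Differentiating t |-> (partial sum at tx) * (1 - tx)^b leaves only the
   contribution of the last term. *)
Lemma binsum_clim (b : R) (x : C) : 0 < b -> normc x < 1 ->
  clim (binsum b x) (cpow (1 - x) (- b)).
Proof.
move=> b0 x1; pose ct (t : R) := cpow (1 - t%:C * x) b.
pose dy n (t : R) := \sum_(i < n) (bincoef b i)%:C * (i%:R * (t%:C * x) ^+ i.-1 * x).
have tx t : 0 <= t <= 1 -> normc (t%:C * x) <= normc x.
  move=> /andP[t0 t1]; rewrite normcM normc_real ger0_norm//.
  by rewrite ler_piMl ?normc_ge0.
have Dy n t : curve_deriv (fun t => binsum b (t%:C * x) n) t (dy n t).
  apply: (@cderiv_along_sum _ _ _ n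
    (fun i t => (bincoef b i)%:C * (t%:C * x) ^+ i) t
    (fun i => (bincoef b i)%:C * (i%:R * (t%:C * x) ^+ i.-1 * x))) => i.
  apply: cderiv_along_scale; apply: (@cderiv_along_exp _ _ _ (fun t => t%:C * x)).
  apply: cderiv_along_eq (cderiv_along_mul (curve_deriv_id t) (cderiv_along_cst _ x _)) _.
  by ring.
have ode n t : (1 - t%:C * x) * dy n t - b%:C * x * binsum b (t%:C * x) n =
   - (n%:R * (bincoef b n)%:C * (t%:C * x) ^+ n.-1 * x).
  rewrite /dy /binsum; elim: n => [|n IH].
    by rewrite !big_ord0; ring.
  rewrite !big_ord_recr /=.
  have e : n.+1%:R * (bincoef b n.+1)%:C = (b%:C + n%:R) * (bincoef b n)%:C :> C.
    rewrite -[n.+1%:R](rmorph_nat (real_complex R)).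
    by rewrite -rmorphM/= bincoefS rmorphM rmorphD/= rmorph_nat.
  have p : n%:R * (t%:C * x) ^+ n = n%:R * (t%:C * x) ^+ n.-1 * (t%:C * x) :> C.
    by case: n {IH e} => [|n]; rewrite ?mul0r// -mulrA -exprSr.
  rewrite e; move/eqP: IH; rewrite subr_eq => /eqP.
  set S1 := \sum_(i < n) _; set S2 := \sum_(i < n) _ => IH.
  rewrite !mulrDr IH; apply/eqP; rewrite -subr_eq0.
  rewrite (_ : _ - _ = (bincoef b n)%:C * x *
    (n%:R * (t%:C * x) ^+ n - n%:R * (t%:C * x) ^+ n.-1 * (t%:C * x))); last by ring.
  by rewrite p subrr mulr0.
(* This bounds |(1 - t x)^b / (1 - t x)| for t in [0, 1], since |1 - t x| is at most 2 and at least
   1 - |x|. *)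
set K := 2 `^ b / (1 - normc x).
have K0 : 0 <= K by rewrite divr_ge0 ?powR_ge0// subr_ge0 ltW.
have est n : normc (binsum b x n.+1 * cpow (1 - x) b - 1) <=
    2 * K * (n.+1%:R * bincoef b n.+1 * normc x ^+ n.+1).
  pose w t := binsum b (t%:C * x) n.+1 * ct t.
  pose dw t := dy n.+1 t * ct t +
     binsum b (t%:C * x) n.+1 * (b%:C * (- x / (1 - t%:C * x)) * ct t).
  have hre t : 0 <= t <= 1 -> 0 < complex.Re (1 - t%:C * x).
    by move=> h; apply: Re_1sub_gt0; apply: le_lt_trans (tx _ h) x1.
  have hw t : 0 <= t <= 1 -> curve_deriv w t (dw t).
    move=> h; apply: cderiv_along_mul; first exact: Dy.
    apply: curve_deriv_cpow; last exact: hre.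
    apply: cderiv_along_eq (cderiv_along_sub (cderiv_along_cst _ 1 _)
      (cderiv_along_mul (curve_deriv_id t) (cderiv_along_cst _ x _))) _.
    by ring.
  have dwE t : 0 <= t <= 1 -> dw t = - (ct t / (1 - t%:C * x) *
      (n.+1%:R * (bincoef b n.+1)%:C * (t%:C * x) ^+ n * x)).
    move=> h; have nz : 1 - t%:C * x != 0 by rewrite -normc_gt0 Re_gt0_neq0 ?hre.
    have := ode n.+1 t => /= o.
    have -> : dw t = ct t / (1 - t%:C * x) *
      ((1 - t%:C * x) * dy n.+1 t - b%:C * x * binsum b (t%:C * x) n.+1).
      by rewrite /dw; field.
    by rewrite o mulrN.
  have := @curve_mean_value R w dw 0 1 (K * (n.+1%:R * bincoef b n.+1 * normc x ^+ n.+1))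
     ler01 hw.
  rewrite /w /ct mul1r mul0r subr0 cpow1 mulr1.
  have -> : binsum b 0 n.+1 = 1.
    rewrite /binsum big_ord_recl bincoef0 expr0 mulr1 big1 ?addr0// => i _.
    by rewrite expr0n mulr0.
  set T := n.+1%:R * _ * _; have -> : 2 * K * T = 2 * (K * T) * (1 - 0) by ring.
  apply => t ht; rewrite /T.
  rewrite dwE// normcN normcM (normcM (ct t)) (normcM _ x) (normcM _ (_ ^+ n)) (normcM _%:R).
  rewrite normc_nat normc_real (gtr0_norm (bincoef_gt0 _ b0)) normcX.
  rewrite exprSr !mulrA; apply: ler_wpM2r; first exact: normc_ge0.
  rewrite -!mulrA; apply: ler_pM.
  - exact: normc_ge0.
  - by rewrite !mulr_ge0 ?normc_ge0 ?exprn_ge0 ?invr_ge0 ?normc_ge0 ?(ltW (bincoef_gt0 _ _)).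
  - rewrite /ct normc_cpow ?hre//; apply: ge0_ler_powR; rewrite ?nnegrE ?normc_ge0 ?(ltW b0)//.
    apply: le_trans (normc_sub _ _) _; rewrite normc1.
    by have := tx _ ht; lra.
  apply: ler_pM.
  - by rewrite normc_ge0.
  - by rewrite !mulr_ge0 ?exprn_ge0 ?normc_ge0 ?(ltW (bincoef_gt0 _ _)).
  - rewrite normcV lef_pV2 ?posrE ?subr_gt0//; last by rewrite Re_gt0_neq0 ?hre.
    have := normc_subr 1 (t%:C * x); rewrite normc1.
    by have := tx _ ht; lra.
  rewrite !ler_wpM2l// ?(ltW (bincoef_gt0 _ _))//.
  by rewrite lerXn2r ?nnegrE ?normc_ge0// tx.
move=> eps e0.
have rx := Re_1sub_gt0 x1.
set L := normc (cpow (1 - x) (- b)).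
have L0 : 0 < 1 + L * (2 * K).
  exact: ltr_wpDr (mulr_ge0 (normc_ge0 _) (mulr_ge0 (ler0n _ 2) K0)) ltr01.
have [N hN] := bincoef_growth b0 (normc_ge0 x) x1 (divr_gt0 e0 L0).
exists N.+1 => -[//|n] hn.
have := hN n.+1 (leqW hn); rewrite ler_pdivlMr// => k.
have -> : binsum b x n.+1 - cpow (1 - x) (- b) =
    cpow (1 - x) (- b) * (binsum b x n.+1 * cpow (1 - x) b - 1).
  by rewrite cpowN//; field; rewrite cpow_neq0.
rewrite normcM -/L; apply: le_trans (ler_wpM2l (normc_ge0 _) (est n)) _.
apply: le_trans k; set T := n.+1%:R * _ * _.
have T0 : 0 <= T by rewrite /T !mulr_ge0 ?exprn_ge0 ?normc_ge0 ?(ltW (bincoef_gt0 _ _)).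
by rewrite [leRHS]mulrDr mulr1 mulrA [leLHS]mulrC lerDr.
Qed.

End BinomialSeries.

(** * Circle integrals *)

Section RealIntegral.
Variable R : realType.
Local Notation mu := (@lebesgue_measure R).
Implicit Types (f g : R -> R) (a b c : R).

Definition rint f a b : R := \int[mu]_(t in `[a, b]) f t.

Definition continuous_on f a b := forall t, a <= t <= b -> {for t, continuous f}.

Lemma continuous_on_within f a b : continuous_on f a b ->
  {within `[a, b], continuous f}.
Proof.
move=> h; apply: continuous_in_subspaceT => t; rewrite inE/= in_itv/=; exact: h.
Qed.

Lemma continuous_on_integrable f a b : continuous_on f a b ->
  mu.-integrable `[a, b] (EFin \o f).
Proof.
move=> /continuous_on_within h; apply: continuous_compact_integrable => //.
exact: segment_compact.
Qed.

Lemma rint_split f a c b : a <= c -> c <= b -> continuous_on f a b ->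
  rint f a b = rint f a c + rint f c b.
Proof.
move=> ac cb h; have hi := continuous_on_integrable h.
have e := @Rintegral_itvB R f (BLeft a) (BRight b) c hi.
rewrite /rint; apply/eqP; rewrite addrC -subr_eq e ?bnd_simp//.
rewrite Rintegral_itv_obnd_cbnd//.
apply: integrableS hi => //; apply: subset_itvr; by rewrite bnd_simp.
Qed.

Lemma rint_point f a : rint f a a = 0.
Proof. by rewrite /rint set_itv1 Rintegral_set1. Qed.

Lemma rint_add f g a b : continuous_on f a b -> continuous_on g a b ->
  rint (fun t => f t + g t) a b = rint f a b + rint g a b.
Proof.
by move=> hf hg; apply: RintegralD => //; exact: continuous_on_integrable.
Qed.

Lemma rint_scale k f a b : continuous_on f a b ->
  rint (fun t => k * f t) a b = k * rint f a b.
Proof.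
by move=> hf; apply: RintegralZl => //; exact: continuous_on_integrable.
Qed.

Lemma rint_cst k a b : a <= b -> rint (fun _ => k) a b = k * (b - a).
Proof.
move=> ab; rewrite /rint Rintegral_cst//=.
rewrite lebesgue_measure_itv/= lte_fin.
by move: ab; rewrite le_eqVlt => /predU1P[->|->//]; rewrite ltxx subrr.
Qed.

Lemma rint_bound f a b (K : R) : a <= b -> continuous_on f a b ->
  (forall t, a <= t <= b -> `|f t| <= K) -> `|rint f a b| <= K * (b - a).
Proof.
move=> ab hf hK; rewrite -(rint_cst K ab).
have ha : continuous_on (fun t => `|f t|) a b.
  move=> t /hf ht; exact: (@continuous_comp _ _ _ f (fun x => `|x|) t ht (@norm_continuous _ _ _)).
apply: le_trans (le_normr_Rintegral _ (continuous_on_integrable hf)) _ => //.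
apply: le_Rintegral => //.
- exact: continuous_on_integrable ha.
- apply: continuous_on_integrable => t _; exact: cst_continuous.
Qed.

Lemma rint_FTC f F a b : a <= b -> continuous_on f a b ->
  (forall t, a <= t <= b -> is_derive t 1 F (f t)) -> rint f a b = F b - F a.
Proof.
rewrite le_eqVlt => /predU1P[->|ab] hf hF; first by rewrite rint_point subrr.
have itv t : t \in `]a, b[ -> a <= t <= b.
  by rewrite in_itv/= => /andP[/ltW-> /ltW->].
have cF t : a <= t <= b -> {for t, continuous F}.
  move=> /hF[d _]; apply: differentiable_continuous; exact/derivable1_diffP.
rewrite /rint /Rintegral (@continuous_FTC2 R f F a b)//.
- exact: continuous_on_within.
- split.
  + by move=> t /itv /hF[].
  + by apply: cvg_at_right_filter; apply: cF; rewrite lexx ltW.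
  + by apply: cvg_at_left_filter; apply: cF; rewrite lexx ltW.
- by move=> t /itv /hF[_]; rewrite derive1E.
Qed.

End RealIntegral.

Section CurveIntegral.
Variable R : realType.
Local Notation C := (R[i]).
Implicit Types (f g : R -> C) (a b c : R).

Definition cint f a b : C :=
  rint (fun t => complex.Re (f t)) a b +i* rint (fun t => complex.Im (f t)) a b.

(** Differentiability is the regularity assumed of integrands: they are all built from holomorphic
    functions along smooth curves, and continuity, hence integrability, follows. *)
Definition cdiff_on f a b := forall t, a <= t <= b -> exists l, curve_deriv f t l.

Lemma cdiff_on_continuous f a b : cdiff_on f a b ->
  continuous_on (fun t => complex.Re (f t)) a b /\
  continuous_on (fun t => complex.Im (f t)) a b.
Proof.
by move=> h; split=> t /h[l /curve_deriv_continuous[]].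
Qed.

Lemma cdiff_on_sub2 f g a b : cdiff_on f a b -> cdiff_on g a b ->
  cdiff_on (fun t => f t - g t) a b.
Proof.
by move=> hf hg t ht; have [l h1] := hf t ht; have [m h2] := hg t ht;
  exists (l - m); exact: cderiv_along_sub.
Qed.

Lemma eq_cint f g a b : (forall t, a <= t <= b -> f t = g t) ->
  cint f a b = cint g a b.
Proof.
move=> fg; rewrite /cint /rint; congr (_ +i* _); apply: eq_Rintegral => t;
  by rewrite inE/= in_itv/= => /fg ->.
Qed.

Lemma cint_split f a c b : a <= c -> c <= b -> cdiff_on f a b ->
  cint f a b = cint f a c + cint f c b.
Proof.
move=> ac cb /cdiff_on_continuous[h1 h2].
by rewrite /cint (rint_split ac cb h1) (rint_split ac cb h2).
Qed.

Lemma cint_add f g a b : cdiff_on f a b -> cdiff_on g a b ->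
  cint (fun t => f t + g t) a b = cint f a b + cint g a b.
Proof.
move=> /cdiff_on_continuous[f1 f2] /cdiff_on_continuous[g1 g2].
rewrite /cint -[RHS]/(_ +i* _) -!rint_add//.
by congr (_ +i* _); congr rint; apply/funext => t; rewrite ?ReD ?ImD.
Qed.

Lemma cint_scale (k : C) f a b : cdiff_on f a b ->
  cint (fun t => k * f t) a b = k * cint f a b.
Proof.
move=> /cdiff_on_continuous[f1 f2].
have sc (x : R) h : continuous_on h a b -> continuous_on (fun t => x * h t) a b.
  by move=> hh t /hh ht; apply: continuousM => //; exact: cst_continuous.
case: k => x y; rewrite /cint -[RHS]/(_ +i* _).
congr (_ +i* _).
  rewrite -mulNr -!rint_scale// -rint_add; [|exact: sc|exact: sc].
  by congr rint; apply/funext => t; case: (f t) => p q /=; ring.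
rewrite -!rint_scale// -rint_add; [|exact: sc|exact: sc].
by congr rint; apply/funext => t; case: (f t) => p q /=; ring.
Qed.

Lemma cint_sub f g a b : cdiff_on f a b -> cdiff_on g a b ->
  cint (fun t => f t - g t) a b = cint f a b - cint g a b.
Proof.
move=> hf hg; rewrite -mulN1r -cint_scale// -cint_add//.
  by congr cint; apply/funext => t; rewrite mulN1r.
by move=> t /hg[l h]; exists (-1 * l); exact: cderiv_along_scale.
Qed.

(* Rotate the value of the integral to the positive real axis. *)
Lemma cint_bound f a b (K : R) : a <= b -> cdiff_on f a b ->
  (forall t, a <= t <= b -> normc (f t) <= K) -> normc (cint f a b) <= K * (b - a).
Proof.
move=> ab hf hK; have [->|i0] := eqVneq (cint f a b) 0.
  rewrite normc0 mulr_ge0 ?subr_ge0//; apply: le_trans (hK a _); first exact: normc_ge0.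
  by rewrite lexx ab.
have [u nu ue] := normc_rotation i0.
have -> : normc (cint f a b) = complex.Re (cint (fun t => u * f t) a b).
  by rewrite cint_scale// ue.
apply: le_trans (ler_norm _) _; apply: rint_bound => // [|t /hK].
  have hu : cdiff_on (fun t => u * f t) a b.
    by move=> t /hf[l hl]; exists (u * l); exact: cderiv_along_scale.
  by have [] := cdiff_on_continuous hu.
by apply: le_trans; apply: le_trans (ler_Re_normc _) _; rewrite normcM nu mul1r.
Qed.

Lemma cint_cst (k : C) a b : a <= b -> cint (fun _ => k) a b = k * (b - a)%:C.
Proof.
move=> ab; rewrite /cint !rint_cst//; case: k => x y /=.
by apply/eqP; rewrite eq_complex /=; apply/andP; split; apply/eqP; ring.
Qed.

Lemma curve_deriv_expi t : curve_deriv (@expi R) t ('i%C * expi t).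
Proof.
by apply/curve_deriv_ReIm; split; rewrite /=; apply: is_derive_eq; ring.
Qed.

Lemma cint_expi a b : a <= b -> 'i%C * cint (@expi R) a b = expi b - expi a.
Proof.
move=> ab; rewrite /cint /=.
have h1 : rint (fun t => cos t) a b = sin b - sin a.
  apply: (@rint_FTC _ _ (@sin R)) => // t _; exact: continuous_cos.
have h2 : rint (fun t => sin t) a b = - cos b - - cos a.
  apply: (@rint_FTC _ _ (fun t => - cos t)) => // t _; first exact: continuous_sin.
  by apply: is_derive_eq; rewrite opprK.
rewrite h1 h2; apply/eqP; rewrite eq_complex /=.
by apply/andP; split; apply/eqP; ring.
Qed.

Lemma expi_lipschitz s t : normc (expi s - expi t : C) <= 2 * `|s - t|.
Proof.
wlog ts : s t / t <= s => [hw|].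
  have [/hw//|/ltW/hw] := leP t s.
  by rewrite normcBC distrC.
rewrite (ger0_norm (_ : 0 <= s - t)) ?subr_ge0//.
have := @curve_mean_value R (@expi R) (fun t => 'i%C * expi t) t s 1 ts.
rewrite mulr1; apply => x _; first exact: curve_deriv_expi.
by rewrite normcM normc_i normc_expi mulr1.
Qed.

End CurveIntegral.

(** * Goursat's bisection argument *)

Section Subdivision.
Variable R : realType.

Lemma nested_point (lo hi : nat -> R) :
  (forall n, lo n <= lo n.+1) -> (forall n, hi n.+1 <= hi n) ->
  (forall n, lo n <= hi n) -> exists x, forall n, lo n <= x <= hi n.
Proof.
move=> hlo hhi hlh.
have mlo n k : lo n <= lo (n + k)%N.
  by elim: k => [|k IH]; rewrite ?addn0// addnS (le_trans IH).
have mhi n k : hi (n + k)%N <= hi n.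
  by elim: k => [|k IH]; rewrite ?addn0// addnS (le_trans _ IH).
have cross n p : lo n <= hi p.
  have [np|pn] := leqP n p.
    by rewrite -(subnKC np) (le_trans (mlo n (p - n)%N)).
  by rewrite -(subnKC (ltnW pn)) (le_trans (hlh _)).
have ub p : ubound (range lo) (hi p) by move=> _ [n _ <-].
have ne : range lo !=set0 by exists (lo 0%N), 0%N.
exists (sup (range lo)) => n; apply/andP; split.
  by apply: ub_le_sup; [exists (hi 0%N)|exists n].
exact: ge_sup.
Qed.

(** When [m] is additive under cuts of either side, one of the four quarters of a rectangle carries
    at least a quarter of the modulus. The nested quarters shrink to a point, where the bound by eps
    times the squared sum of the sides contradicts this. *)
Lemma rectangle_functional_eq0 (m : R -> R -> R -> R -> R[i]) (s1 s2 t1 t2 : R) :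
  s1 <= s2 -> t1 <= t2 ->
  (forall a c b p q, s1 <= a -> a <= c -> c <= b -> b <= s2 ->
     t1 <= p -> p <= q -> q <= t2 -> m a b p q = m a c p q + m c b p q) ->
  (forall a b p c q, s1 <= a -> a <= b -> b <= s2 ->
     t1 <= p -> p <= c -> c <= q -> q <= t2 -> m a b p q = m a b p c + m a b c q) ->
  (forall s t, s1 <= s <= s2 -> t1 <= t <= t2 -> forall eps, 0 < eps ->
     exists2 d, 0 < d & forall a b p q, s1 <= a -> a <= s <= b -> b <= s2 ->
       t1 <= p -> p <= t <= q -> q <= t2 -> b - a < d -> q - p < d ->
       normc (m a b p q) <= eps * ((b - a) + (q - p)) ^+ 2) ->
  m s1 s2 t1 t2 = 0.
Proof.
move=> s12 t12 splits splitt loc.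
set L := s2 - s1; set W := t2 - t1.
have L0 : 0 <= L by rewrite subr_ge0.
have W0 : 0 <= W by rewrite subr_ge0.
apply/eqP; rewrite -normc_eq0 eq_le normc_ge0 andbT leNgt; apply/negP.
set eta := normc (m s1 s2 t1 t2) => eta0.
(* A rectangle of generation n is recorded by its lower corner alone; its sides are L / 2^n and W /
   2^n. *)
pose big n (x : R * R) := eta / 4 ^+ n <=
  normc (m x.1 (x.1 + L / 2 ^+ n) x.2 (x.2 + W / 2 ^+ n)).
pose ok n (x : R * R) := [/\ s1 <= x.1, x.1 + L / 2 ^+ n <= s2, t1 <= x.2,
  x.2 + W / 2 ^+ n <= t2 & big n x].
pose child n (x y : R * R) :=
  [/\ x.1 <= y.1, y.1 + L / 2 ^+ n.+1 <= x.1 + L / 2 ^+ n,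
      x.2 <= y.2 & y.2 + W / 2 ^+ n.+1 <= x.2 + W / 2 ^+ n].
have step n x : ok n x -> exists y, ok n.+1 y /\ child n x y.
  case: x => a p [/= a1 a2 p1 p2 hb].
  set l := L / 2 ^+ n.+1; set w := W / 2 ^+ n.+1.
  have l0 : 0 <= l by rewrite divr_ge0 ?exprn_ge0.
  have w0 : 0 <= w by rewrite divr_ge0 ?exprn_ge0.
  have lE : L / 2 ^+ n = l + l by rewrite /l exprS; field.
  have wE : W / 2 ^+ n = w + w by rewrite /w exprS; field.
  rewrite /big /= lE wE in hb a2 p2.
  have e4 : eta / 4 ^+ n = 4 * (eta / 4 ^+ n.+1) by rewrite exprS; field.
  pose M b q := normc (m b (b + l) q (q + w)).
  have al1 : a <= a + l by rewrite lerDl.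
  have al2 : a + l <= a + (l + l) by rewrite lerD2l lerDl.
  have pw1 : p <= p + w by rewrite lerDl.
  have pw2 : p + w <= p + (w + w) by rewrite lerD2l lerDl.
  have al3 := le_trans al2 a2; have pw3 := le_trans pw2 p2.
  have al4 := le_trans a1 al1; have pw4 := le_trans p1 pw1.
  have al5 := le_trans al1 al2; have pw5 := le_trans pw1 pw2.
  have le4 : 4 * (eta / 4 ^+ n.+1) <= M a p + M (a + l) p + M a (p + w) + M (a + l) (p + w).
    rewrite -e4; apply: le_trans hb _.
    rewrite (splits a (a + l))// (splitt a (a + l) p (p + w))//.
    rewrite (splitt (a + l) _ p (p + w))//.
    rewrite /M !addrA.
    set z1 := m _ _ _ _; set z2 := m _ _ _ _; set z3 := m _ _ _ _; set z4 := m _ _ _ _.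
    have h1 := le_normcD (z1 + z2 + z3) z4; have h2 := le_normcD (z1 + z2) z3.
    have h3 := le_normcD z1 z2; clear -h1 h2 h3; lra.
  have [h|h1] := leP (eta / 4 ^+ n.+1) (M a p).
    by exists (a, p); split; split=> //=; rewrite ?lE ?wE -/l -/w -?addrA.
  have [h|h2] := leP (eta / 4 ^+ n.+1) (M (a + l) p).
    by exists (a + l, p); split; split=> //=; rewrite ?lE ?wE -/l -/w -?addrA.
  have [h|h3] := leP (eta / 4 ^+ n.+1) (M a (p + w)).
    by exists (a, p + w); split; split=> //=; rewrite ?lE ?wE -/l -/w -?addrA.
  exists (a + l, p + w); split; split; rewrite /= ?lE ?wE -/l -/w -?addrA//.
  by rewrite /big /= -/l -/w -/(M _ _); clear -le4 h1 h2 h3; lra.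
have ok0 : ok 0%N (s1, t1).
  by split; rewrite /big /= ?expr0 ?divr1 ?/L ?/W ?(addrC s1) ?(addrC t1) ?subrK.
(* The default (s1, t1) is never taken, because [step] provides a child of every admissible
   rectangle. *)
pose next n x := xget (s1, t1) [set y | ok n.+1 y /\ child n x y].
pose fix sq n : R * R := if n is k.+1 then next k (sq k) else (s1, t1).
have sq_ok n : ok n (sq n).
  elim: n => [|n IH] //=; rewrite /next; case: xgetP => [y -> []//|hn].
  by have [y hy] := step _ _ IH; have := hn y hy.
have sq_child n : child n (sq n) (sq n.+1).
  rewrite /= /next; case: xgetP => [y -> []//|hn].
  by have [y hy] := step _ _ (sq_ok n); have := hn y hy.
have [s hs] := @nested_point (fun n => (sq n).1) (fun n => (sq n).1 + L / 2 ^+ n)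
  (fun n => let: And4 h _ _ _ := sq_child n in h)
  (fun n => let: And4 _ h _ _ := sq_child n in h)
  (fun n => ltac:(by rewrite lerDl divr_ge0 ?exprn_ge0)).
have [t ht] := @nested_point (fun n => (sq n).2) (fun n => (sq n).2 + W / 2 ^+ n)
  (fun n => let: And4 _ _ h _ := sq_child n in h)
  (fun n => let: And4 _ _ _ h := sq_child n in h)
  (fun n => ltac:(by rewrite lerDl divr_ge0 ?exprn_ge0)).
have s_in : s1 <= s <= s2.
  by have := hs 0%N; rewrite /= expr0 divr1 /L addrC subrK.
have t_in : t1 <= t <= t2.
  by have := ht 0%N; rewrite /= expr0 divr1 /W addrC subrK.
(* Adding 1 keeps the denominator positive for a degenerate rectangle and makes eta (L + W)^2 / (1 +
   (L + W)^2) strictly smaller than eta. *)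
have D0 : 0 < 1 + (L + W) ^+ 2 by rewrite ltr_wpDr ?sqr_ge0.
have [d d0 hd] := loc s t s_in t_in _ (divr_gt0 eta0 D0).
have [n hn] : exists n : nat, (L + W) / 2 ^+ n < d.
  have h2 : `|2^-1 : R| < 1 by rewrite ger0_norm ?invf_lt1 ?ltr1n.
  have /cvgrPdist_lt/(_ _ d0)[N _ hN] := @cvg_geometric R (L + W) _ h2.
  exists N; have := hN N (leqnn _); rewrite /= sub0r normrN exprVn.
  by apply: le_lt_trans; exact: ler_norm.
have p2 : 0 < 2 ^+ n :> R by rewrite exprn_gt0.
case: (sq_ok n) => o1 o2 o3 o4 o5.
have hl : L / 2 ^+ n < d.
  by apply: le_lt_trans hn; rewrite ler_pM2r ?invr_gt0// lerDl.
have hw : W / 2 ^+ n < d.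
  by apply: le_lt_trans hn; rewrite ler_pM2r ?invr_gt0// lerDr.
have e1 (x y : R) : x + y - x = y by ring.
have := hd _ _ _ _ o1 (hs n) o2 o3 (ht n) o4; rewrite !e1.
move=> /(_ hl hw); rewrite -mulrDl expr_div_n => /(le_trans o5).
rewrite -exprM mulnC exprM (_ : 2 ^+ 2 = 4); last by rewrite expr2; ring.
rewrite mulrA ler_pM2r ?invr_gt0 ?exprn_gt0//.
rewrite -mulrA ler_pMr// mulrC ler_pdivlMr// mul1r; lra.
Qed.

End Subdivision.

(** * Independence of circle means from the radius *)

Section CircleMeans.
Variable R : realType.
Local Notation C := (R[i]).

Definition circle_int (psi : C -> C) (r : R) : C :=
  cint (fun t => psi (r%:C * expi t)) 0 (2 * pi).

Lemma normc_circle (r t : R) : 0 <= r -> normc (r%:C * expi t) = r.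
Proof. by move=> r0; rewrite normcM normc_real normc_expi mulr1 ger0_norm. Qed.

Lemma curve_deriv_circle (r t : R) :
  curve_deriv (fun t => r%:C * expi t) t (r%:C * ('i%C * expi t)).
Proof. by apply: cderiv_along_scale; exact: curve_deriv_expi. Qed.

Lemma curve_deriv_ray (w : C) (s : R) : curve_deriv (fun s => s%:C * w) s w.
Proof.
apply: cderiv_along_eq (cderiv_along_mul (curve_deriv_id s) (cderiv_along_cst _ w _)) _.
by ring.
Qed.

(* Goursat's theorem in polar coordinates, for the form dt along circles and
   ds/s along rays. *)
Lemma circle_int_const (psi : C -> C) (a b : R) : 0 < a -> a <= b ->
  (forall z, a <= normc z <= b -> exists l, cderiv psi z l) ->
  circle_int psi a = circle_int psi b.
Proof.
move=> a0 ab hpsi.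
have pi0 : 0 <= 2 * pi :> R by rewrite mulr_ge0 ?pi_ge0.
pose A s t : C := psi (s%:C * expi t).
pose ray p q s := (A s q - A s p) / s%:C.
pose arc s1 s2 t := A s2 t - A s1 t.
(* This is the integral of psi(z) dz / (i z) over the boundary of the polar rectangle s1 <= |z| <=
   s2, p <= arg z <= q: the form is dt on arcs and -i ds / s on rays, and the ray at angle q is
   traversed inwards. *)
pose m s1 s2 p q := cint (arc s1 s2) p q + 'i%C * cint (ray p q) s1 s2.
have pos s : a <= s -> 0 < s by exact: lt_le_trans.
have dA s p q : a <= s <= b -> cdiff_on (A s) p q.
  move=> /andP[as_ sb] t _; have [|l hl] := hpsi (s%:C * expi t).
    by rewrite normc_circle ?as_// ltW// pos.
  by eexists; exact: cderiv_curve hl (curve_deriv_circle s t).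
have darc s1 s2 p q : a <= s1 <= b -> a <= s2 <= b -> cdiff_on (arc s1 s2) p q.
  by move=> h1 h2; apply: cdiff_on_sub2; exact: dA.
have dA' t s1 s2 : a <= s1 -> s2 <= b -> cdiff_on (fun s => A s t) s1 s2.
  move=> h1 h2 s /andP[k1 k2]; have s1s := le_trans h1 k1.
  have [|l hl] := hpsi (s%:C * expi t).
    by rewrite normc_circle ?s1s ?(le_trans k2)// ltW// pos.
  by exists (l * expi t); exact: cderiv_curve hl (curve_deriv_ray (expi t) s).
have dray p q s1 s2 : a <= s1 -> s2 <= b -> cdiff_on (ray p q) s1 s2.
  move=> h1 h2 s hs; have [l hl] := dA' q _ _ h1 h2 s hs.
  have [l' hl'] := dA' p _ _ h1 h2 s hs.
  have s0 : s%:C != 0 :> C.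
    by rewrite eq_complex /= eqxx andbT gt_eqF// pos// (le_trans h1)//; case/andP: hs.
  eexists; apply: cderiv_along_mul (cderiv_along_sub hl hl') _.
  exact: cderiv_along_inv (curve_deriv_id s) s0.
have vanish : m a b 0 (2 * pi) = 0.
  apply: rectangle_functional_eq0 => //.
  - move=> s1 c s2 p q h1 h2 h3 h4 h5 h6 h7.
    have c1 : a <= s1 <= b by rewrite h1 (le_trans h2)// (le_trans h3).
    have c2 : a <= c <= b by rewrite (le_trans h1)// (le_trans h3).
    have c3 : a <= s2 <= b by rewrite (le_trans h1)// (le_trans h2).
    rewrite /m (@cint_split _ (ray p q) s1 c s2)//; last exact: dray.
    have -> : cint (arc s1 s2) p q = cint (arc s1 c) p q + cint (arc c s2) p q.
      rewrite -cint_add; [|exact: darc|exact: darc].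
      by congr cint; apply/funext => t; rewrite /arc; ring.
    by ring.
  - move=> s1 s2 p c q h1 h2 h3 h4 h5 h6 h7.
    have c1 : a <= s1 <= b by rewrite h1 (le_trans h2).
    have c2 : a <= s2 <= b by rewrite (le_trans h1).
    rewrite /m (@cint_split _ (arc s1 s2) p c q)//; last exact: darc.
    have -> : cint (ray p q) s1 s2 = cint (ray p c) s1 s2 + cint (ray c q) s1 s2.
      rewrite -cint_add; [|exact: dray|exact: dray].
      by congr cint; apply/funext => s; rewrite /ray; ring.
    by ring.
  move=> s t hs ht eps e0; have /andP[as_ sb] := hs.
  set z0 := s%:C * expi t.
  have [|l hl] := hpsi z0; first by rewrite normc_circle// ltW// pos.
  (* In the polar rectangle, |z - z0| <= (s2 - s1) + 2 b (q - p) <= K ((s2 - s1) + (q - p)). The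
     value e1 below is chosen so that 2 e1 K (1 + 1/a) = eps. *)
  set K := 1 + 2 * b; have K0 : 0 < K by rewrite /K; have := lt_le_trans a0 ab; clear; lra.
  set e1 := eps / (2 * K * (1 + a^-1)).
  have ia0 : 0 < a^-1 by rewrite invr_gt0.
  have ee0 : 0 < 2 * K * (1 + a^-1) by rewrite !mulr_gt0// addr_gt0.
  have e10 : 0 < e1 by rewrite divr_gt0.
  have [d d0 hd] := hl _ e10.
  exists (d / (2 * K)) => [|s1 s2 p q h1 /andP[h2 h3] h4 k1 /andP[k2 k3] k4 d1 d2].
    by rewrite divr_gt0// mulr_gt0.
  have h23 := le_trans h2 h3; have k23 := le_trans k2 k3.
  set D := K * ((s2 - s1) + (q - p)).
  have Dd : D < d.
    move: d1 d2; rewrite !ltr_pdivlMr ?mulr_gt0// => d1 d2.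
    by rewrite /D; clear -d1 d2; lra.
  have D0 : 0 <= D by rewrite /D mulr_ge0 ?(ltW K0)// addr_ge0 ?subr_ge0.
  pose rho z := psi z - psi z0 - (z - z0) * l.
  have near u v : s1 <= u <= s2 -> p <= v <= q -> normc (rho (u%:C * expi v)) <= e1 * D.
    move=> /andP[u1 u2] /andP[v1 v2]; set z := u%:C * expi v.
    have zD : normc (z - z0) <= D.
      have -> : z - z0 = (u - s)%:C * expi v + s%:C * (expi v - expi t).
        by rewrite /z /z0 rmorphB/=; ring.
      apply: le_trans (le_normcD _ _) _; rewrite !normcM normc_expi mulr1 !normc_real.
      have x1 : `|u - s| <= s2 - s1.
        by clear -u1 u2 h2 h3; rewrite ler_norml; apply/andP; split; lra.
      have x2 : `|v - t| <= q - p.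
        by clear -v1 v2 k2 k3; rewrite ler_norml; apply/andP; split; lra.
      have x3 := expi_lipschitz v t.
      have x4 : `|s| = s by rewrite ger0_norm// ltW// pos.
      rewrite x4; have x5 : s * normc (expi v - expi t : C) <= b * (2 * (q - p)).
        apply: ler_pM => //; [by rewrite ltW// pos|exact: normc_ge0|].
        by apply: le_trans x3 _; rewrite ler_wpM2l.
      have b0 := lt_le_trans a0 ab.
      have bs : 0 <= b * (s2 - s1) by rewrite mulr_ge0 ?subr_ge0// ltW.
      by rewrite /D /K; clear -x1 x2 x5 bs k23; lra.
    have := hd (z - z0) (le_lt_trans zD Dd).
    rewrite (addrC z0) subrK => /le_trans; apply; rewrite ler_wpM2l// ltW//.
  have cc1 : a <= s1 <= b by rewrite h1 (le_trans h23).
  have cc2 : a <= s2 <= b by rewrite (le_trans h1).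
  have cstd (k : C) x y : cdiff_on (fun _ => k) x y.
    by move=> u _; exists 0; exact: cderiv_along_cst.
  have expd (k : C) x y : cdiff_on (fun t => k * expi t) x y.
    by move=> u _; eexists; apply: cderiv_along_scale; exact: curve_deriv_expi.
  (* Subtract the contribution of the affine part of psi at z0. Its constant cancels in [arc] and
     [ray]; the parts of l z on arcs and on rays cancel each other because i * i = -1, so [m] only
     sees the remainder [rho]. *)
  pose lin := l * (s2 - s1)%:C.
  pose ray1 u := ray p q u - l * (expi q - expi p).
  pose arc1 v := arc s1 s2 v - lin * expi v.
  have mE : m s1 s2 p q = cint arc1 p q + 'i%C * cint ray1 s1 s2.
    rewrite /arc1 (@cint_sub _ (arc s1 s2)); [|exact: darc|exact: expd].
    rewrite /ray1 (@cint_sub _ (ray p q)); [|exact: dray|exact: cstd].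
    rewrite cint_cst// cint_scale; last first.
      by move=> u _; eexists; exact: curve_deriv_expi.
    rewrite -(cint_expi k23) /m /lin.
    have i2 : 'i%C * 'i%C = -1 :> C by rewrite -expr2 sqr_i.
    set X := cint (@expi R) p q.
    have -> : forall Y Z : C, Y - l * (s2 - s1)%:C * X +
      'i%C * (Z - l * ('i%C * X) * (s2 - s1)%:C) =
      Y + 'i%C * Z - l * (s2 - s1)%:C * X * (1 + 'i%C * 'i%C) by move=> *; ring.
    by rewrite i2 subrr mulr0 subr0.
  rewrite mE; apply: le_trans (le_normcD _ _) _; rewrite normcM normc_i mul1r.
  have b1 : normc (cint arc1 p q) <= 2 * (e1 * D) * (q - p).
    apply: cint_bound => // [|v hv].
      by apply: cdiff_on_sub2; [exact: darc|exact: expd].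
    have -> : arc1 v = rho (s2%:C * expi v) - rho (s1%:C * expi v).
      by rewrite /arc1 /arc /A /rho /lin rmorphB/=; ring.
    apply: le_trans (normc_sub _ _) _.
    have r1 := near s2 v (ltac:(by rewrite h23 lexx)) hv.
    have r2 := near s1 v (ltac:(by rewrite h23 lexx)) hv; clear -r1 r2; lra.
  have b2 : normc (cint ray1 s1 s2) <= 2 * (e1 * D) * a^-1 * (s2 - s1).
    apply: cint_bound => // [|u hu].
      by apply: cdiff_on_sub2; [exact: dray|exact: cstd].
    have au : a <= u by rewrite (le_trans h1)//; case/andP: hu.
    have u0 : u%:C != 0 :> C.
      by rewrite eq_complex /= eqxx andbT gt_eqF// pos.
    have -> : ray1 u = (rho (u%:C * expi q) - rho (u%:C * expi p)) / u%:C.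
      by rewrite /ray1 /ray /A /rho; field.
    rewrite normcM normcV normc_real (ger0_norm (ltW (pos _ au))).
    apply: ler_pM; rewrite ?normc_ge0 ?invr_ge0 ?(ltW (pos _ au))//.
      apply: le_trans (normc_sub _ _) _.
      have r1 := near u q hu (ltac:(by rewrite k23 lexx)).
      have r2 := near u p hu (ltac:(by rewrite k23 lexx)); clear -r1 r2; lra.
    by rewrite lef_pV2 ?posrE// pos.
  have P0 : 0 <= 2 * (e1 * D).
    by rewrite mulr_ge0// mulr_ge0// ltW.
  set T := (s2 - s1) + (q - p).
  have T1 : 0 <= q - p by rewrite subr_ge0.
  have T2 : 0 <= s2 - s1 by rewrite subr_ge0.
  apply: (@le_trans _ _ (2 * (e1 * D) * (1 + a^-1) * T)).
    have q1 : 2 * (e1 * D) * (q - p) <= 2 * (e1 * D) * T by rewrite ler_wpM2l// /T lerDr.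
    have q2 : 2 * (e1 * D) * a^-1 * (s2 - s1) <= 2 * (e1 * D) * a^-1 * T.
      by rewrite (ler_wpM2l (mulr_ge0 P0 (ltW ia0)))// /T lerDl.
    rewrite [leRHS](_ : _ = 2 * (e1 * D) * T + 2 * (e1 * D) * a^-1 * T); last by ring.
    by clear -q1 q2 b1 b2; lra.
  rewrite le_eqVlt; apply/orP; left; apply/eqP; rewrite /e1 /D -/T.
  by field; rewrite ?(gt_eqF K0) ?(gt_eqF a0) ?gt_eqF ?addr_gt0.
(* The rays at angles 0 and 2 pi coincide, so only the two circles are left of the boundary. *)
have e2pi : expi (2 * pi) = expi 0 :> C.
  by rewrite /expi cos0 sin0 mulr_natl cos2pi sin2pi.
have ray0 : cint (ray 0 (2 * pi)) a b = 0.
  rewrite (_ : ray 0 (2 * pi) = fun _ => 0); last first.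
    by apply/funext => s; rewrite /ray /A e2pi subrr mul0r.
  by rewrite cint_cst// mul0r.
move: vanish; rewrite /m ray0 mulr0 addr0 /arc cint_sub; last 2 first.
- by apply: dA; rewrite lexx ab.
- by apply: dA; rewrite lexx ab.
by move=> /eqP; rewrite subr_eq0 => /eqP.
Qed.

End CircleMeans.

Section CircleMeanLimits.
Variable R : realType.
Local Notation C := (R[i]).
Implicit Types (psi : C -> C) (c : C) (r : R).

Lemma circle_cdiff psi r p q : 0 <= r ->
  (forall z, normc z = r -> exists l, cderiv psi z l) ->
  cdiff_on (fun t => psi (r%:C * expi t)) p q.
Proof.
move=> r0 h t _; have [|l hl] := h (r%:C * expi t); first exact: normc_circle.
by eexists; exact: cderiv_curve hl (curve_deriv_circle r t).
Qed.

Lemma circle_int_bound psi r K : 0 <= r ->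
  (forall z, normc z = r -> exists l, cderiv psi z l) ->
  (forall z, normc z = r -> normc (psi z) <= K) ->
  normc (circle_int psi r) <= K * (2 * pi).
Proof.
move=> r0 hd hK.
have := @cint_bound R (fun t => psi (r%:C * expi t)) 0 (2 * pi) K.
rewrite subr0; apply; first by rewrite mulr_ge0 ?pi_ge0.
  exact: circle_cdiff.
by move=> t _; apply: hK; exact: normc_circle.
Qed.

Lemma circle_int_sub_cst psi r c : 0 <= r ->
  (forall z, normc z = r -> exists l, cderiv psi z l) ->
  circle_int (fun z => psi z - c) r = circle_int psi r - c * (2 * pi)%:C.
Proof.
move=> r0 hd; rewrite /circle_int cint_sub; first last.
- by move=> t _; exists 0; exact: cderiv_along_cst.
- exact: circle_cdiff.
by rewrite cint_cst ?subr0// mulr_ge0 ?pi_ge0.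
Qed.

(** Common core of the two evaluations below: a mean that does not depend on the radius is computed
    on circles where psi is uniformly close to the constant c. *)
Lemma circle_int_eq psi r c : (forall eps, 0 < eps -> exists s, [/\ 0 < s,
    (forall z, normc z = s -> exists l, cderiv psi z l),
    (forall z, normc z = s -> normc (psi z - c) <= eps) &
    circle_int psi r = circle_int psi s]) ->
  circle_int psi r = c * (2 * pi)%:C.
Proof.
move=> h; apply/eqP; rewrite -subr_eq0 -normc_eq0 eq_le normc_ge0 andbT leNgt.
apply/negP => n0; have p0 : 0 < 4 * pi :> R by rewrite mulr_gt0 ?pi_gt0.
have [s [s0 hd hb e]] := h _ (divr_gt0 n0 p0).
have := @circle_int_bound (fun z => psi z - c) s _ (ltW s0) _ hb.
rewrite circle_int_sub_cst ?(ltW s0)// -e; set N := normc _ in n0 *.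
move=> hh; have : N <= N / (4 * pi) * (2 * pi).
  apply: hh => z /hd[l hl]; exists (l - 0); apply: cderiv_along_sub hl _.
  exact: cderiv_along_cst.
have pn : pi != 0 :> R by rewrite gt_eqF ?pi_gt0.
have E (x p : R) : p != 0 -> x / (4 * p) * (2 * p) = x / 2 by move=> ?; field.
rewrite E//.
by clear -n0; lra.
Qed.

(** Nothing is asked of psi at 0 itself, only a limit there, so g(z) / z can be used without
    removing its singularity. *)
Lemma circle_int_center psi r c : 0 < r ->
  (forall z, 0 < normc z <= r -> exists l, cderiv psi z l) ->
  (forall eps, 0 < eps -> exists2 d, 0 < d & forall z, 0 < normc z < d ->
     normc (psi z - c) <= eps) ->
  circle_int psi r = c * (2 * pi)%:C.
Proof.
move=> r0 hd hl; apply: circle_int_eq => eps /hl[d d0 hb].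
have s0 : 0 < Num.min r (d / 2) by rewrite lt_min r0 divr_gt0.
have sr : Num.min r (d / 2) <= r by rewrite ge_min lexx.
exists (Num.min r (d / 2)); split=> // [z zs|z zs|].
- by apply: hd; rewrite zs s0.
- apply: hb; rewrite zs s0; apply: (@le_lt_trans _ _ (d / 2)).
    by rewrite ge_min lexx orbT.
  by clear -d0; lra.
- apply/esym/circle_int_const => // z /andP[z1 z2]; apply: hd.
  by rewrite z2 (lt_le_trans s0).
Qed.

Lemma circle_int_infty psi r c : 0 < r ->
  (forall z, r <= normc z -> exists l, cderiv psi z l) ->
  (forall eps, 0 < eps -> exists2 d, 0 < d & forall z, d <= normc z ->
     normc (psi z - c) <= eps) ->
  circle_int psi r = c * (2 * pi)%:C.
Proof.
move=> r0 hd hl; apply: circle_int_eq => eps /hl[d d0 hb].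
have rs : r <= Num.max r d by rewrite le_max lexx.
exists (Num.max r d); split=> // [|z zs|z zs|].
- exact: lt_le_trans rs.
- by apply: hd; rewrite zs.
- by apply: hb; rewrite zs le_max lexx orbT.
- by apply: circle_int_const => // z /andP[z1 _]; exact: hd.
Qed.

End CircleMeanLimits.

(** * Automorphisms of the disc *)

Section DiscAutomorphisms.
Variable R : realType.
Local Notation C := (R[i]).
Implicit Types (a z w c : C) (g h : C -> C).

Definition mob a z : C := (z - a) / (1 - conjC a * z).

Lemma one_sub_normc_gt0 a z : normc a < 1 -> normc z < 1 -> normc (conjC a * z) < 1.
Proof.
move=> a1 z1; rewrite normcM normcJ; apply: le_lt_trans z1.
by rewrite ler_piMl ?normc_ge0// ltW.
Qed.

Lemma mob_den_Re a z : normc a < 1 -> normc z < 1 ->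
  0 < complex.Re (1 - conjC a * z).
Proof. by move=> a1 z1; apply: Re_1sub_gt0; exact: one_sub_normc_gt0. Qed.

Lemma mob_den a z : normc a < 1 -> normc z < 1 -> 1 - conjC a * z != 0.
Proof.
by move=> a1 z1; rewrite -normc_gt0; apply: Re_gt0_neq0; exact: mob_den_Re.
Qed.

(** Raised to the power -alpha, this identity is the quasi-invariance of the kernel; for w = z it
    shows that [mob a] maps the disc into itself. *)
Lemma mob_kernel a z w : normc a < 1 -> normc z < 1 -> normc w < 1 ->
  (1 - mob a z * conjC (mob a w)) * (1 - conjC a * z) * (1 - a * conjC w) =
  (1 - a * conjC a) * (1 - z * conjC w).
Proof.
move=> a1 z1 w1; have d1 := mob_den a1 z1.
have d2 : 1 - a * conjC w != 0.
  have := mob_den a1 w1; rewrite -(inj_eq (inv_inj (@conjCK _))) rmorphB rmorphM/=.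
  by rewrite rmorph1 rmorph0 conjCK.
rewrite /mob rmorphM/= fmorphV/= !rmorphB rmorphM/= rmorph1 conjCK.
by field; rewrite d1 d2.
Qed.

Lemma sqr_normc_mob a z : normc a < 1 -> normc z < 1 ->
  (1 - normc (mob a z) ^+ 2) * normc (1 - conjC a * z) ^+ 2 =
  (1 - normc a ^+ 2) * (1 - normc z ^+ 2).
Proof.
move=> a1 z1; apply: (@complexI R); rewrite [LHS]rmorphM [RHS]rmorphM/=.
rewrite !one_sub_sqr_normc -mulcJ -(mob_kernel a1 z1 z1) -mulrA; congr (_ * (_ * _)).
by rewrite rmorphB rmorphM/= rmorph1 conjCK.
Qed.

Lemma normc_mob_lt1 a z : normc a < 1 -> normc z < 1 -> normc (mob a z) < 1.
Proof.
move=> a1 z1; have := sqr_normc_mob a1 z1.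
have n0 : 0 < normc (1 - conjC a * z) by rewrite normc_gt0 mob_den.
have s x : 0 <= x -> x < 1 -> 0 < 1 - x ^+ 2 :> R.
  by move=> x0 x1; rewrite subr_gt0 expr_lt1.
have : 0 < (1 - normc a ^+ 2) * (1 - normc z ^+ 2).
  by rewrite mulr_gt0// s// normc_ge0.
move=> p0 e; move: p0; rewrite -e pmulr_lgt0 ?exprn_gt0// subr_gt0.
by rewrite expr_lt1// normc_ge0.
Qed.

Lemma mobK a z : normc a < 1 -> normc z < 1 -> mob (- a) (mob a z) = z.
Proof.
move=> a1 z1; have d1 := mob_den a1 z1; rewrite /mob rmorphN/=.
have d3 : 1 - a * conjC a != 0.
  have p0 : 0 < 1 - normc a ^+ 2 by rewrite subr_gt0 expr_lt1// normc_ge0.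
  by rewrite -one_sub_sqr_normc -normc_gt0 normc_real gtr0_norm.
have e1 : (z - a) / (1 - conjC a * z) - - a = z * (1 - a * conjC a) / (1 - conjC a * z).
  by field.
have e2 : 1 - - conjC a * ((z - a) / (1 - conjC a * z)) =
    (1 - a * conjC a) / (1 - conjC a * z) by field.
by rewrite e1 e2; field; rewrite d1 d3.
Qed.

Lemma mob0 a : mob a a = 0.
Proof. by rewrite /mob subrr mul0r. Qed.

Lemma mob_at0 a : mob a 0 = - a.
Proof. by rewrite /mob sub0r mulr0 subr0 divr1. Qed.

Lemma cderiv_mob a z : 1 - conjC a * z != 0 ->
  cderiv (mob a) z ((1 - a * conjC a) / (1 - conjC a * z) ^+ 2).
Proof.
move=> d.
have h1 := cderiv_along_sub (cderiv_id z) (cderiv_along_cst (fun z => z) a z).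
have h2 := cderiv_along_sub (cderiv_along_cst (fun z => z) 1 z) (cderiv_scale (conjC a) z).
apply: cderiv_along_eq (cderiv_along_mul h1 (cderiv_along_inv h2 d)) _.
by field.
Qed.

Definition self_map g := forall z, normc z < 1 ->
  normc (g z) < 1 /\ exists l, cderiv g z l.

Lemma self_map_mob a : normc a < 1 -> self_map (mob a).
Proof.
move=> a1 z z1; split; first exact: normc_mob_lt1.
by eexists; apply: cderiv_mob; exact: mob_den.
Qed.

Lemma self_map_comp g h : self_map g -> self_map h -> self_map (fun z => g (h z)).
Proof.
move=> hg hh z /hh[z1 [l hl]]; have [g1 [m hm]] := hg _ z1; split=> //.
by eexists; exact: cderiv_along_comp hl hm.
Qed.

Lemma quotient_center g l : cderiv g 0 l -> g 0 = 0 ->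
  forall eps, 0 < eps -> exists2 d : R, 0 < d & forall z, 0 < normc z < d ->
     normc (g z / z - l) <= eps.
Proof.
move=> hl g0 eps /hl[d d0 hd]; exists d => // z /andP[z0 /hd].
rewrite add0r g0 subr0 => k; have zn : z != 0 by rewrite -normc_gt0.
have -> : g z / z - l = (g z - z * l) / z by field.
by rewrite normcM normcV ler_pdivrMr.
Qed.

(** The mean of g(z) / z over |z| = r is l, whence |l| <= 1 / r. If |l| > 1, the midpoint r of 1 /
    |l| and 1 is an admissible radius violating this bound. *)
Lemma schwarz_deriv g l : self_map g -> g 0 = 0 -> cderiv g 0 l -> normc l <= 1.
Proof.
move=> hg g0 hl; rewrite leNgt; apply/negP => l1.
have l0 : 0 < normc l by apply: lt_trans l1.
set r := ((normc l)^-1 + 1) / 2.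
have il : (normc l)^-1 < 1 by rewrite invf_lt1.
have r0 : 0 < r by rewrite divr_gt0// addr_gt0// invr_gt0.
have r1 : r < 1 by rewrite /r; clear -il; lra.
have rl : (normc l)^-1 < r by rewrite /r; clear -il; lra.
have hd z : 0 < normc z <= r -> exists l, cderiv (fun z => g z / z) z l.
  move=> /andP[z0 zr]; have [_ [m hm]] := hg z (le_lt_trans zr r1).
  eexists; apply: cderiv_along_mul hm (cderiv_along_inv (cderiv_id z) _).
  by rewrite -normc_gt0.
have e := circle_int_center r0 hd (quotient_center hl g0).
have := @circle_int_bound R (fun z => g z / z) r r^-1 (ltW r0).
rewrite e normcM normc_real (ger0_norm (_ : 0 <= 2 * pi)); last first.
  by rewrite mulr_ge0 ?pi_ge0.
have p0 : 0 < 2 * pi :> R by rewrite mulr_gt0 ?pi_gt0.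
rewrite ler_pM2r// => h; have : normc l <= r^-1.
  apply: h => z zr; first by apply: hd; rewrite zr r0 lexx.
  rewrite normcM normcV zr ler_piMl ?invr_ge0 ?(ltW r0)//.
  by have [] := hg z; rewrite ?zr// => /ltW.
by rewrite -(invrK (normc l)) lef_pV2 ?posrE ?invr_gt0// leNgt rl.
Qed.

(** Composing with [mob (- a)] before g and with [mob (g a)] after it gives a self-map fixing 0, to
    which the bound on the derivative at 0 applies. *)
Lemma schwarz_pick_deriv g a l : self_map g -> normc a < 1 -> cderiv g a l ->
  normc l * (1 - normc a ^+ 2) <= 1 - normc (g a) ^+ 2.
Proof.
move=> hg a1 hl; have [b1 _] := hg a a1; set b := g a in b1 *.
have na1 : normc (- a) < 1 by rewrite normcN.
have s x : normc x < 1 -> 0 < 1 - normc x ^+ 2 :> R.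
  by move=> x1; rewrite subr_gt0 expr_lt1 ?normc_ge0.
have h0 : normc (0 : C) < 1 by rewrite normc0.
have e0 : mob (- a) 0 = a by rewrite mob_at0 opprK.
have hm : cderiv (mob (- a)) 0 (1 - a * conjC a).
  apply: cderiv_along_eq (cderiv_mob (mob_den na1 h0)) _.
  by rewrite mulr0 subr0 expr1n divr1 rmorphN mulrNN.
have hl' : cderiv g (mob (- a) 0) l by rewrite e0.
have hb := cderiv_mob (mob_den b1 b1).
have hb' : cderiv (mob b) (g (mob (- a) 0)) ((1 - b * conjC b) / (1 - conjC b * b) ^+ 2).
  by rewrite e0.
have hc := cderiv_along_comp (cderiv_along_comp hm hl') hb'.
have := schwarz_deriv (self_map_comp (self_map_mob b1)
  (self_map_comp hg (self_map_mob na1))) _ hc.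
rewrite e0 mob0 => /(_ erefl).
have nb : normc (1 - b * conjC b) = 1 - normc b ^+ 2.
  by rewrite -one_sub_sqr_normc normc_real gtr0_norm// s.
have na : normc (1 - a * conjC a) = 1 - normc a ^+ 2.
  by rewrite -one_sub_sqr_normc normc_real gtr0_norm// s.
rewrite (mulrC (conjC b)) !normcM normcV normcX nb na => h.
have sb := s _ b1.
have e : (1 - normc b ^+ 2) / (1 - normc b ^+ 2) ^+ 2 = (1 - normc b ^+ 2)^-1.
  by field; rewrite gt_eqF.
by move: h; rewrite e mulrC ler_pdivrMr// mul1r.
Qed.

(* Comparison of artanh (Re (c g(tz))) with artanh (t |z|), where c rotates
   g(z) to the positive axis. *)
Lemma schwarz g z : self_map g -> g 0 = 0 -> normc z < 1 -> normc (g z) <= normc z.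
Proof.
move=> hg g0 z1; set r := normc z in z1 *; have r0 : 0 <= r := normc_ge0 z.
have [->|gz0] := eqVneq (g z) 0; first by rewrite normc0.
have ng : 0 < normc (g z) by rewrite normc_gt0.
have [c nc cg] := normc_rotation gz0.
have tz t : 0 <= t <= 1 -> normc (t%:C * z) = t * r.
  by move=> /andP[t0 _]; rewrite normcM normc_real ger0_norm.
have tz1 t : 0 <= t <= 1 -> t * r < 1.
  by move=> /andP[t0 t1]; apply: le_lt_trans z1; rewrite ler_piMl.
pose v (t : R) := complex.Re (c * g (t%:C * z)).
have hv t : 0 <= t <= 1 -> `|v t| < 1 /\ exists2 k, is_derive t 1 v k &
    `|k| * (1 - (t * r) ^+ 2) <= r * (1 - v t ^+ 2).
  move=> ht; have zt : normc (t%:C * z) < 1 by rewrite tz// tz1.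
  have [gt1 [m hm]] := hg _ zt.
  have vle : `|v t| <= normc (g (t%:C * z)).
    by apply: le_trans (ler_Re_normc _) _; rewrite normcM nc mul1r.
  split; first exact: le_lt_trans vle gt1.
  have hc := cderiv_along_scale c (cderiv_curve hm (curve_deriv_ray z t)).
  have [hr _] := (curve_deriv_ReIm _ _ _).1 hc.
  exists (complex.Re (c * (m * z))) => //.
  have sp := schwarz_pick_deriv hg zt hm; rewrite tz// in sp.
  have k1 : `|complex.Re (c * (m * z))| <= normc m * r.
    by apply: le_trans (ler_Re_normc _) _; rewrite !normcM nc mul1r.
  have q0 : 0 <= 1 - (t * r) ^+ 2.
    rewrite subr_ge0 expr_le1 ?mulr_ge0//; last by case/andP: ht.
    exact: ltW (tz1 t ht).
  apply: le_trans (ler_wpM2r q0 k1) _; rewrite mulrAC mulrC ler_wpM2l//.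
  apply: le_trans sp _; rewrite lerD2l lerN2 -(real_normK (num_real (v t))).
  by rewrite lerXn2r ?nnegrE ?normc_ge0.
(* This is 2 (artanh (v t) - artanh (t r)). The Schwarz-Pick inequality makes it nonincreasing, and
   it vanishes at t = 0. *)
pose A (t : R) := ln (1 + v t) - ln (1 - v t) - (ln (1 + t * r) - ln (1 - t * r)).
have hA (t : R) : 0 <= t <= 1 -> exists2 k : R, is_derive t 1 A k & k <= 0.
  move=> ht; have [v1 [k hk kle]] := hv t ht.
  have trr : 0 <= t * r by rewrite mulr_ge0//; case/andP: ht.
  have tr1 := tz1 t ht.
  move: v1; rewrite ltr_norml => /andP[v1 v2].
  have p1 : 0 < 1 + v t by clear -v1; lra.
  have p2 : 0 < 1 - v t by clear -v2; lra.
  have p3 : 0 < 1 + t * r by clear -trr; lra.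
  have p4 : 0 < 1 - t * r by clear -tr1; lra.
  have d1 : is_derive t 1 (fun t => 1 + v t) k.
    by rewrite (_ : (fun _ => _) = cst 1 + v)//; apply: is_derive_eq; rewrite add0r.
  have d2 : is_derive t 1 (fun t => 1 - v t) (- k).
    by rewrite (_ : (fun _ => _) = cst 1 - v)//; apply: is_derive_eq; rewrite add0r.
  have dr : is_derive t 1 (fun t => t * r) r.
    rewrite (_ : (fun _ => _) = r *: id); last by apply/funext => x /=; rewrite mulrC.
    by apply: is_derive_eq; rewrite /GRing.scale/= mulr1.
  have d3 : is_derive t 1 (fun t => 1 + t * r) r.
    by rewrite (_ : (fun _ => _) = cst 1 + (fun t => t * r))//; apply: is_derive_eq; rewrite add0r.
  have d4 : is_derive t 1 (fun t => 1 - t * r) (- r).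
    by rewrite (_ : (fun _ => _) = cst 1 - (fun t => t * r))//; apply: is_derive_eq; rewrite add0r.
  have l1 := @is_derive1_comp R (@ln R) (fun t => 1 + v t) t _ _ (is_derive1_ln p1) d1.
  have l2 := @is_derive1_comp R (@ln R) (fun t => 1 - v t) t _ _ (is_derive1_ln p2) d2.
  have l3 := @is_derive1_comp R (@ln R) (fun t => 1 + t * r) t _ _ (is_derive1_ln p3) d3.
  have l4 := @is_derive1_comp R (@ln R) (fun t => 1 - t * r) t _ _ (is_derive1_ln p4) d4.
  exists (((1 + v t)^-1 * k - (1 - v t)^-1 * - k) -
          ((1 + t * r)^-1 * r - (1 - t * r)^-1 * - r)).
    rewrite (_ : A = ((@ln R \o (fun t => 1 + v t)) - (@ln R \o (fun t => 1 - v t))) -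
       ((@ln R \o (fun t : R => 1 + t * r)) - (@ln R \o (fun t : R => 1 - t * r)))) //.
    exact: is_deriveB (is_deriveB l1 l2) (is_deriveB l3 l4).
  have q1 : 0 < 1 - v t ^+ 2 by rewrite (_ : _ - _ = (1 + v t) * (1 - v t)) ?mulr_gt0//; ring.
  have q2 : 0 < 1 - (t * r) ^+ 2.
    by rewrite (_ : _ - _ = (1 + t * r) * (1 - t * r)) ?mulr_gt0//; ring.
  rewrite (_ : _ - _ = 2 * (k / (1 - v t ^+ 2) - r / (1 - (t * r) ^+ 2))); last first.
    field; rewrite (gt_eqF p1) (gt_eqF p2) (gt_eqF p3) (gt_eqF p4).
    by rewrite (gt_eqF q1) (gt_eqF q2).
  rewrite pmulr_rle0// subr_le0 ler_pdivrMr// mulrAC ler_pdivlMr//.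
  by apply: le_trans kle; rewrite ler_wpM2r ?(ltW q2)// ler_norm.
have A10 : A 1 <= A 0.
  have itv (t : R) : t \in `]0, 1[ -> 0 <= t <= 1.
    by rewrite in_itv/= => /andP[/ltW-> /ltW->].
  pose dA (t : R) := 'D_1 A t.
  have [t t01 e] : exists2 t, t \in `]0, 1[ & A 1 - A 0 = dA t * (1 - 0).
    apply: MVT => // [t /itv/hA[k hk _]|].
      by rewrite /dA; apply: derivableP; case: hk.
    apply: continuous_in_subspaceT => t; rewrite inE/= in_itv/= => /hA[k [dk _] _].
    by apply: differentiable_continuous; exact/derivable1_diffP.
  by rewrite -subr_le0 e subr0 mulr1 /dA; have [k [_ ->]] := hA t (itv t t01).
have v0 : v 0 = 0 by rewrite /v mul0r g0 mulr0.
have v1 : v 1 = normc (g z) by rewrite /v mul1r cg.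
move: A10; rewrite /A v0 v1 mul0r mul1r addr0 subr0 !subrr subr_le0 => hle.
have [vlt1 _] := hg z z1.
rewrite leNgt; apply/negP => rlt.
have : ln (1 + r) < ln (1 + normc (g z)).
  by rewrite ltr_ln ?posrE ?ltrD2l// ltr_pwDl// ?normc_ge0.
have : ln (1 - normc (g z)) < ln (1 - r).
  by rewrite ltr_ln ?posrE ?subr_gt0// ltrD2l ltrN2.
clear -hle; lra.
Qed.

(** If l is nonzero, a step w along q(z) conj l increases |q| to first order: q(z) + w l is q(z)
    times a real number larger than 1. *)
Lemma unimodular_cderiv0 (q : C -> C) z l (d : R) : 0 < d ->
  (forall w, normc w < d -> normc (q (z + w)) = 1) -> cderiv q z l -> l = 0.
Proof.
move=> d0 hq hl; apply/eqP; rewrite -normc_eq0 eq_le normc_ge0 andbT leNgt.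
apply/negP => l0; have l2 : 0 < normc l / 2 by rewrite divr_gt0.
have [e e0 he] := hl _ l2.
have q1 : normc (q z) = 1 by rewrite -[z]addr0 hq// normc0.
(* The step then has length min d e / 2, and the gain s |l|^2 = |l| min d e / 2 is twice the error
   |l| min d e / 4 granted by differentiability. *)
set s := Num.min d e / (2 * normc l).
have m0 : 0 < Num.min d e by rewrite lt_min d0.
have s0 : 0 < s by rewrite divr_gt0// mulr_gt0.
set w := s%:C * (q z * conjC l).
have nw : normc w = Num.min d e / 2.
  rewrite /w !normcM normc_real gtr0_norm// q1 mul1r normcJ /s.
  by field; rewrite gt_eqF.
have wm : normc w < Num.min d e by rewrite nw; clear -m0; lra.
have wd : normc w < d by apply: lt_le_trans wm _; rewrite ge_min lexx.
have we : normc w < e by apply: lt_le_trans wm _; rewrite ge_min lexx orbT.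
have := he w we; have := hq w wd => q2 k.
have e2 : q z + w * l = q z * (1 + s * normc l ^+ 2)%:C.
  rewrite rmorphD rmorph1 rmorphM/= -mulcJ /w; ring.
have n2 : normc (q z + w * l) = 1 + s * normc l ^+ 2.
  rewrite e2 normcM q1 mul1r normc_real ger0_norm//.
  by rewrite addr_ge0// mulr_ge0 ?sqr_ge0// ltW.
have := normc_subr (q z + w * l) (q (z + w)).
rewrite (_ : q z + w * l - q (z + w) = - (q (z + w) - q z - w * l)); last by ring.
rewrite normcN n2 q2 => k2; have := le_trans k2 k.
rewrite nw (_ : s * normc l ^+ 2 = Num.min d e * normc l / 2); last first.
  by rewrite /s; field; rewrite gt_eqF.
have : 0 < Num.min d e * normc l by rewrite mulr_gt0.
set X := Num.min d e * normc l; clear => X0.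
rewrite (_ : normc l / 2 * (Num.min d e / 2) = X / 4); last by rewrite /X; field.
lra.
Qed.

(** On the punctured disc g(z) / z has modulus 1, hence derivative 0. It is therefore constant along
    every ray, and all rays share the limit g'(0) at the centre. *)
Lemma rotation_of_isometry g : self_map g -> g 0 = 0 ->
  (forall z, normc z < 1 -> normc (g z) = normc z) ->
  exists2 c : C, normc c = 1 & forall z, normc z < 1 -> g z = c * z.
Proof.
move=> hg g0 hn.
have [_ [c hc]] := hg 0 (ltac:(by rewrite normc0)).
have hq z : 0 < normc z < 1 -> cderiv (fun z => g z / z) z 0.
  move=> /andP[z0 z1]; have [_ [m hm]] := hg z z1.
  have zn : z != 0 by rewrite -normc_gt0.
  have hd := cderiv_along_mul hm (cderiv_along_inv (cderiv_id z) zn).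
  have d0 : 0 < Num.min (normc z) (1 - normc z) by rewrite lt_min z0 subr_gt0.
  rewrite -[X in cderiv _ _ X](unimodular_cderiv0 d0 _ hd)// => w.
  rewrite lt_min => /andP[w1 w2].
  have n1 : normc (z + w) < 1.
    by apply: le_lt_trans (le_normcD _ _) _; clear -w2; lra.
  have n0 : 0 < normc (z + w).
    have := normc_subr z (- w); rewrite normcN opprK; clear -w1; lra.
  by rewrite normcM normcV hn// mulfV// gt_eqF.
have qc z : 0 < normc z < 1 -> g z / z = c.
  move=> /andP[z0 z1]; apply/eqP; rewrite -subr_eq0 -normc_eq0 eq_le normc_ge0 andbT.
  rewrite leNgt; apply/negP => n0.
  have [d d0 hd] := quotient_center hc g0 (divr_gt0 n0 (ltr0n R 2)).
  set t := Num.min 1 (d / (2 * normc z)).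
  have t0 : 0 < t by rewrite lt_min ltr01 divr_gt0// mulr_gt0.
  have t1 : t <= 1 by rewrite ge_min lexx.
  have tz : normc (t%:C * z) < d.
    rewrite normcM normc_real gtr0_norm//.
    apply: (@le_lt_trans _ _ (d / 2)); last by clear -d0; lra.
    rewrite -ler_pdivlMr// ge_min; apply/orP; right.
    by rewrite le_eqVlt; apply/orP; left; apply/eqP; field; rewrite gt_eqF.
  have tz0 : 0 < normc (t%:C * z) by rewrite normcM normc_real gtr0_norm// mulr_gt0.
  have := hd (t%:C * z); rewrite tz0 tz => /(_ isT).
  have := @curve_mean_value R (fun s => g (s%:C * z) / (s%:C * z)) (fun _ => 0) t 1 0 t1.
  rewrite mulr0 mul0r normc0 (_ : 1%:C * z = z) ?mul1r// => hcm.
  have : normc (g z / z - g (t%:C * z) / (t%:C * z)) <= 0.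
    apply: hcm => // s /andP[ts s1]; rewrite -[X in curve_deriv _ _ X](mul0r z).
    apply: (@cderiv_curve R (fun z => g z / z) _ _ _ _ _ (curve_deriv_ray z s)).
    have s0 := lt_le_trans t0 ts.
    apply: hq; rewrite normcM normc_real gtr0_norm// mulr_gt0//=.
    by apply: le_lt_trans z1; rewrite ler_piMl ?(ltW z0).
  rewrite le_eqVlt ltNge normc_ge0 orbF normc_eq0 subr_eq0 => /eqP <- k.
  by move: n0 k; clear; lra.
have h2 : (normc (2^-1 : C)) = 2^-1 by rewrite normcV normc_nat.
have i2 : 0 < (2^-1 : R) < 1 by rewrite invr_gt0 ltr0n invf_lt1 ?ltr1n.
exists c.
  have /andP[p1 p2] := i2.
  by rewrite -(qc 2^-1) ?h2// normcM normcV hn ?h2// mulfV// gt_eqF.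
move=> z z1; have [->|z0] := eqVneq z 0; first by rewrite g0 mulr0.
by rewrite -(qc z) ?normc_gt0 ?z0//; field.
Qed.

Lemma mobius_self_map g : mobius g -> exists h,
  [/\ self_map g, self_map h, (forall z, normc z < 1 -> h (g z) = z) &
      forall z, normc z < 1 -> g (h z) = z].
Proof.
case=> h [hg hh hb hi]; exists h; split=> z z1; rewrite -disc1E in z1.
- have [/=]:= hb z z1; rewrite !disc1E => g1 _; split=> //.
  by apply/derivable_cderiv; exact: hg.
- have [/=]:= hb z z1; rewrite !disc1E => _ h1; split=> //.
  by apply/derivable_cderiv; exact: hh.
- by have [] := hi z z1.
- by have [] := hi z z1.
Qed.

(** With a the preimage of 0, both g o mob (- a) and its inverse fix 0. The Schwarz lemma for the
    two together makes the first preserve the modulus, so it is a rotation. *)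
Theorem mobius_form g : mobius g -> exists (c a : C),
  [/\ normc c = 1, normc a < 1 & forall z, normc z < 1 -> g z = c * mob a z].
Proof.
case/mobius_self_map => h [hg hh gK hK].
have z0 : normc (0 : C) < 1 by rewrite normc0.
have [a1 _] := hh 0 z0; set a := h 0 in a1 *.
have na1 : normc (- a) < 1 by rewrite normcN.
have G := self_map_comp hg (self_map_mob na1).
have H := self_map_comp (self_map_mob a1) hh.
have G0 : g (mob (- a) 0) = 0 by rewrite mob_at0 opprK hK.
have H0 : mob a (h 0) = 0 by rewrite mob0.
have GK z : normc z < 1 -> mob a (h (g (mob (- a) z))) = z.
  move=> z1; rewrite gK ?normc_mob_lt1//.
  by rewrite -{2}(mobK na1 z1) opprK.
have [z z1|c c1 hc] := rotation_of_isometry G G0.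
  apply/eqP; rewrite eq_le (schwarz G G0 z1) /=.
  by rewrite -[in leLHS](GK z z1); apply: (schwarz H H0); have [] := G z z1.
exists c, a; split=> // z z1.
by rewrite -hc ?normc_mob_lt1// mobK.
Qed.

End DiscAutomorphisms.

(** * Hilbert spaces *)

Section InnerProduct.
Variables (R : realType) (V : lmodType R[i]) (ip : {dot V for conjC}).
Local Notation C := (R[i]).
Implicit Types (x y z : V) (a : C).

Lemma ipDl x y z : ip (x + y) z = ip x z + ip y z.
Proof. exact: linearDl. Qed.
Lemma ipDr x y z : ip x (y + z) = ip x y + ip x z.
Proof. exact: linearDr. Qed.
Lemma ipBl x y z : ip (x - y) z = ip x z - ip y z.
Proof. exact: linearBl. Qed.
Lemma ipBr x y z : ip x (y - z) = ip x y - ip x z.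
Proof. exact: linearBr. Qed.
Lemma ipZl a x y : ip (a *: x) y = a * ip x y.
Proof. exact: linearZl_LR. Qed.
Lemma ipZr a x y : ip x (a *: y) = conjC a * ip x y.
Proof. exact: linearZr_LR. Qed.
Lemma ip0l x : ip 0 x = 0.
Proof. exact: linear0l. Qed.
Lemma ip0r x : ip x 0 = 0.
Proof. exact: linear0r. Qed.
Lemma ipJ x y : conjC (ip x y) = ip y x.
Proof. by rewrite [RHS]hermC mul1r. Qed.

Lemma ip_suml (I : Type) (r : seq I) (F : I -> V) y :
  ip (\sum_(i <- r) F i) y = \sum_(i <- r) ip (F i) y.
Proof. by elim: r => [|i r IH]; rewrite ?big_nil ?ip0l// !big_cons ipDl IH. Qed.
Lemma ip_sumr (I : Type) (r : seq I) (F : I -> V) y :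
  ip y (\sum_(i <- r) F i) = \sum_(i <- r) ip y (F i).
Proof. by elim: r => [|i r IH]; rewrite ?big_nil ?ip0r// !big_cons ipDr IH. Qed.

Definition nr x : R := Num.sqrt (complex.Re (ip x x)).

Lemma nr_ge0 x : 0 <= nr x.
Proof. exact: sqrtr_ge0. Qed.

Lemma ip_nr x : ip x x = (nr x ^+ 2)%:C.
Proof.
have : 0 <= ip x x by exact: dnorm_ge0.
rewrite /nr; case: (ip x x) => p q; rewrite lecE /= => /andP[/eqP -> p0].
by rewrite sqr_sqrtr.
Qed.

Lemma sqr_nrE x : nr x ^+ 2 = complex.Re (ip x x).
Proof. by rewrite ip_nr. Qed.

Lemma nr0 : nr 0 = 0.
Proof. by rewrite /nr ip0l sqrtr0. Qed.

Lemma nr_eq0 x : nr x = 0 -> x = 0.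
Proof.
by move=> h; apply/eqP; rewrite -(dnorm_eq0 ip) [X in X == _]ip_nr h expr0n.
Qed.

Lemma nrZ a x : nr (a *: x) = normc a * nr x.
Proof.
apply/eqP; rewrite -(eqrXn2 (ltn0Sn 1)) ?nr_ge0 ?mulr_ge0 ?normc_ge0 ?nr_ge0//.
by rewrite sqr_nrE ipZl ipZr mulrA mulcJ ip_nr -rmorphM/= exprMn.
Qed.

Lemma nrN x : nr (- x) = nr x.
Proof. by rewrite -scaleN1r nrZ normcN normc1 mul1r. Qed.

Lemma nrBC x y : nr (x - y) = nr (y - x).
Proof. by rewrite -nrN opprB. Qed.

Lemma Re_ipC x y : complex.Re (ip x y) = complex.Re (ip y x).
Proof. by rewrite -ipJ Re_conjC. Qed.

Lemma sqr_nrD x y : nr (x + y) ^+ 2 = nr x ^+ 2 + nr y ^+ 2 + 2 * complex.Re (ip x y).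
Proof.
by rewrite !sqr_nrE !ipDl !ipDr !ReD (Re_ipC y x); ring.
Qed.

Lemma sqr_nrB x y : nr (x - y) ^+ 2 = nr x ^+ 2 + nr y ^+ 2 - 2 * complex.Re (ip x y).
Proof.
by rewrite sqr_nrD nrN -scaleN1r ipZr rmorphN1 mulN1r ReN mulrN.
Qed.

Lemma cauchy_schwarz x y : normc (ip x y) <= nr x * nr y.
Proof.
have [y0|y0] := eqVneq (nr y) 0.
  by rewrite (nr_eq0 y0) ip0r normc0 nr0 mulr0.
have ny : 0 < nr y by rewrite lt_neqAle nr_ge0 eq_sym y0.
set a := ip x y / (nr y ^+ 2)%:C.
have := sqr_ge0 (nr (x - a *: y)); rewrite sqr_nrB nrZ ipZr.
have n0 : 0 < nr y ^+ 2 by rewrite exprn_gt0.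
have e1 : complex.Re (conjC a * ip x y) = normc (ip x y) ^+ 2 / nr y ^+ 2.
  rewrite /a rmorphM fmorphV/= conjC_realE mulrAC (mulrC (conjC _)) mulcJ.
  by rewrite -fmorphV -rmorphM.
rewrite e1 /a normcM normcV normc_real (gtr0_norm n0).
set m := normc (ip x y); move=> h.
have m0 : 0 <= m := normc_ge0 _.
have h2 : m ^+ 2 / nr y ^+ 2 <= nr x ^+ 2.
  rewrite -subr_ge0; apply: le_trans h _; rewrite le_eqVlt; apply/orP; left.
  by apply/eqP; field.
move: h2; rewrite ler_pdivrMr// -exprMn => h2.
by rewrite -(ler_pXn2r (ltn0Sn 1)) ?nnegrE// mulr_ge0 ?nr_ge0.
Qed.

Lemma nrD x y : nr (x + y) <= nr x + nr y.
Proof.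
rewrite -(ler_pXn2r (ltn0Sn 1)) ?nnegrE ?addr_ge0 ?nr_ge0// sqr_nrD sqrrD.
have := le_trans (Re_le_normc _) (cauchy_schwarz x y).
by rewrite mulr2n; lra.
Qed.

Lemma nr_triangle x y z : nr (x - z) <= nr (x - y) + nr (y - z).
Proof. by rewrite (_ : x - z = (x - y) + (y - z)) ?nrD// addrA subrK. Qed.

Lemma nr_sub x y : nr x - nr y <= nr (x - y).
Proof. by rewrite lerBlDr -{1}(subrK y x) nrD. Qed.

Definition nr_lim (u : nat -> V) (l : V) : Prop :=
  forall e : R, 0 < e -> exists N : nat, forall n, (N <= n)%N -> nr (u n - l) <= e.

Lemma nr_complete : hilbert_complete ip -> forall u : nat -> V,
  (forall e : R, 0 < e -> exists N : nat, forall p q : nat,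
     (N <= p)%N -> (N <= q)%N -> nr (u p - u q) <= e) ->
  exists l, nr_lim u l.
Proof.
move=> hc u hu.
have [e e0|l hl] := hc u.
  have s0 : 0 < Num.sqrt e / 2 by rewrite divr_gt0 ?sqrtr_gt0.
  have [N hN] := hu _ s0; exists N => p q hp hq; rewrite ip_nr ltcR.
  apply: (@le_lt_trans _ _ ((Num.sqrt e / 2) ^+ 2)).
    by rewrite lerXn2r ?nnegrE ?nr_ge0 ?(ltW s0) ?hN.
  by rewrite expr_div_n sqr_sqrtr ?(ltW e0)//; lra.
exists l => e e0; have [N hN] := hl (e ^+ 2) (exprn_gt0 2 e0).
exists N => n /hN; rewrite ip_nr ltcR => /ltW h.
by rewrite -(ler_pXn2r (ltn0Sn 1)) ?nnegrE ?nr_ge0 ?(ltW e0).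
Qed.

Lemma nr_lim_ip u l y : nr_lim u l -> clim (fun n => ip (u n) y) (ip l y).
Proof.
move=> hu e e0; have y0 : 0 < 1 + nr y by rewrite ltr_wpDr ?nr_ge0.
have [N hN] := hu _ (divr_gt0 e0 y0); exists N => n /hN; rewrite ler_pdivlMr// => h.
rewrite -ipBl; apply: le_trans (cauchy_schwarz _ _) _; apply: le_trans h.
by rewrite ler_wpM2l ?nr_ge0// lerDr.
Qed.

Definition nr_bounded (T : V -> V) : Prop :=
  linear T /\ exists2 M : R, 0 <= M & forall x, nr (T x) <= M * nr x.

Lemma bounded_operatorP T : bounded_operator ip T <-> nr_bounded T.
Proof.
split=> [[lT [M hM]]|[lT [M M0 hM]]]; split=> //.
  (* The constant M bounds squared norms and has no prescribed sign, hence the square root of its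
     absolute value. *)
  exists (Num.sqrt `|M|) => [|x]; first exact: sqrtr_ge0.
  rewrite -(ler_pXn2r (ltn0Sn 1)) ?nnegrE ?nr_ge0 ?mulr_ge0 ?sqrtr_ge0 ?nr_ge0//.
  rewrite exprMn (sqr_sqrtr (normr_ge0 M)); have := hM x; rewrite !ip_nr -rmorphM/= lecR.
  by move/le_trans; apply; rewrite ler_wpM2r ?sqr_ge0// ler_norm.
exists (M ^+ 2) => x; rewrite !ip_nr -rmorphM/= lecR -exprMn.
by rewrite lerXn2r ?nnegrE ?mulr_ge0 ?nr_ge0.
Qed.

Lemma linear_lin (T : V -> V) : linear T -> [/\ T 0 = 0,
  (forall x y, T (x + y) = T x + T y), (forall x y, T (x - y) = T x - T y) &
  (forall a x, T (a *: x) = a *: T x)].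
Proof.
move=> lT; have T0 : T 0 = 0.
  by have := lT (-1) 0 0; rewrite scaler0 addr0 scaleN1r addNr.
have TZ a x : T (a *: x) = a *: T x by rewrite -[a *: x]addr0 lT T0 addr0.
have TD x y : T (x + y) = T x + T y by rewrite -[x]scale1r lT !scale1r.
split=> // x y; by rewrite TD -scaleN1r TZ scaleN1r.
Qed.

Lemma nr_bounded_id : nr_bounded id.
Proof. by split=> //; exists 1 => // x; rewrite mul1r. Qed.

Lemma nr_bounded_comp S T : nr_bounded S -> nr_bounded T ->
  nr_bounded (fun x => S (T x)).
Proof.
move=> [lS [M M0 hM]] [lT [N N0 hN]]; split=> [a x y|]; first by rewrite lT lS.
exists (M * N) => [|x]; first exact: mulr_ge0.
by apply: le_trans (hM _) _; rewrite -mulrA ler_wpM2l.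
Qed.

Lemma nr_bounded_add S T : nr_bounded S -> nr_bounded T ->
  nr_bounded (fun x => S x + T x).
Proof.
move=> [lS [M M0 hM]] [lT [N N0 hN]]; split=> [a x y|].
  by rewrite lT lS scalerDr addrACA.
exists (M + N) => [|x]; first exact: addr_ge0.
by apply: le_trans (nrD _ _) _; rewrite mulrDl lerD.
Qed.

Lemma nr_bounded_scale a T : nr_bounded T -> nr_bounded (fun x => a *: T x).
Proof.
move=> [lT [M M0 hM]]; split=> [b x y|].
  by rewrite lT scalerDr !scalerA mulrC.
exists (normc a * M) => [|x]; first by rewrite mulr_ge0 ?normc_ge0.
by rewrite nrZ -mulrA ler_wpM2l ?normc_ge0.
Qed.

Lemma polarization T : linear T -> (forall x, nr (T x) = nr x) ->
  forall x y, ip (T x) (T y) = ip x y.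
Proof.
move=> /linear_lin[_ TD _ TZ] hT.
have hR x y : complex.Re (ip (T x) (T y)) = complex.Re (ip x y).
  have := sqr_nrD (T x) (T y); rewrite -TD !hT sqr_nrD.
  set b := complex.Re _; set c := complex.Re _; clear; lra.
move=> x y; apply/eqP; rewrite eq_complex hR eqxx /=.
have := hR x ('i%C *: y); rewrite TZ !ipZr.
have e (w : C) : complex.Re (conjC ('i%C : C) * w) = complex.Im w.
  by case: w => p q /=; ring.
by rewrite !e => ->.
Qed.

Section Riesz.
Hypothesis hc : hilbert_complete ip.
(** G is the graph of a linear functional on a subspace. A relation allows a functional to be
    prescribed on linear combinations of kernel functions whose coefficients are not unique:
    linearity and the bound already make it single-valued. *)
Variables (G : V -> C -> Prop) (B : R).
Hypothesis B0 : 0 <= B.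
Hypothesis G00 : G 0 0.
Hypothesis Glin : forall a u v k l, G u k -> G v l -> G (a *: u + v) (a * k + l).
Hypothesis Gb : forall u k, G u k -> normc k <= B * nr u.

Let J (u : V) (k : C) : R := nr u ^+ 2 - 2 * complex.Re k.

(* The representing vector minimizes nr u ^+ 2 - 2 Re k over the graph G. *)
Lemma riesz : exists h, [/\ (forall u k, G u k -> k = ip u h), nr h <= B &
  forall e, 0 < e -> exists u k, G u k /\ nr (u - h) <= e].
Proof.
pose E := [set r | exists u k, G u k /\ r = J u k].
(* By the bound on G, J u k >= |u|^2 - 2 B |u| >= - B^2. *)
have Elb : lbound E (- B ^+ 2).
  move=> _ [u [k [g ->]]]; have := le_trans (Re_le_normc k) (Gb g).
  by have := sqr_ge0 (nr u - B); rewrite /J sqrrB mulr2n; lra.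
have hE : has_inf E.
  by split; [exists (J 0 0), 0, 0|exists (- B ^+ 2)].
set I := inf E.
have Ile u k : G u k -> I <= J u k by move=> g; apply: ge_inf; [case: hE|exists u, k].
have [dl dpos arch] : exists2 dl : nat -> R, forall n, 0 < dl n &
    forall e, 0 < e -> exists N : nat, forall n, (N <= n)%N -> dl n <= e.
  exists (fun n => n.+1%:R^-1) => [n|e e0]; first by rewrite invr_gt0 ltr0n.
  exists (Num.bound (e^-1)) => n hn.
  rewrite -(invrK e) lef_pV2 ?posrE ?invr_gt0// ?ltr0n//.
  apply: le_trans (ltW (archi_boundP (ltW _))) _; first by rewrite invr_gt0.
  by rewrite ler_nat ltnW.
have near n : exists p : V * C, G p.1 p.2 /\ J p.1 p.2 < I + dl n.
  have [_ [u [k [g ->]]] hr] := inf_adherent (dpos n) hE.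
  by exists (u, k).
pose p n := projT1 (cid (near n)).
have pG n : G (p n).1 (p n).2 by rewrite /p; case: cid => ? [].
have pJ n : J (p n).1 (p n).2 < I + dl n by rewrite /p; case: cid => ? [].
(* The parallelogram identity, combined with J >= I at the midpoint, makes the minimizing sequence
   Cauchy. *)
have mid m n : nr ((p m).1 - (p n).1) ^+ 2 <= 2 * (dl m + dl n).
  have g : G (2^-1 *: ((p m).1 + (p n).1)) (2^-1 * ((p m).2 + (p n).2)).
    rewrite -[_ *: _]addr0 -[_ * _]addr0; apply: Glin G00.
    by rewrite -[(p m).1]scale1r -[(p m).2]mul1r; exact: Glin.
  have := Ile _ _ g; rewrite /J nrZ normcV normc_nat exprMn (sqr_nrD (p m).1 (p n).1).
  have h2 : complex.Re (2^-1 * ((p m).2 + (p n).2)) =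
      (complex.Re (p m).2 + complex.Re (p n).2) / 2.
    by rewrite -[2%:R](rmorph_nat (real_complex R)) -fmorphV Re_real_complexM ReD mulrC.
  rewrite h2 sqr_nrB.
  have := pJ m; have := pJ n; rewrite /J => hn hm.
  rewrite (_ : 2^-1 ^+ 2 = 4^-1 :> R); last by field.
  by lra.
have [e e0|h hh] := nr_complete hc (u := fun n => (p n).1).
  have e4 : 0 < e ^+ 2 / 4 by rewrite divr_gt0 ?exprn_gt0.
  have [N hN] := arch _ e4; exists N => m n /hN hm /hN hn.
  rewrite -(ler_pXn2r (ltn0Sn 1)) ?nnegrE ?nr_ge0 ?(ltW e0)//.
  apply: le_trans (mid m n) _; lra.
have Reh w c : G w c -> complex.Re (ip w h) = complex.Re c.
  move=> g; apply/eqP; rewrite -subr_eq0 -normr_eq0 eq_le normr_ge0 andbT leNgt.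
  apply/negP => n0; set D := `| _ | in n0.
  set W := nr w ^+ 2; have W0 : 0 <= W := sqr_ge0 _.
  have nw0 : 0 < 1 + nr w by rewrite ltr_wpDr ?nr_ge0.
  have W10 : 0 < W + 1 by rewrite ltr_wpDl.
  have q1 : 0 < (D / 3) ^+ 2 / (W + 1) by rewrite divr_gt0// exprn_gt0// divr_gt0.
  have [N1 hN1] := arch _ q1.
  have q2 : 0 < D / 3 / (1 + nr w) by rewrite !divr_gt0.
  have [N2 hN2] := hh _ q2.
  set n := maxn N1 N2.
  have h1 := hN1 n (leq_maxl _ _); have h2 := hN2 n (leq_maxr _ _).
  set d := complex.Re (ip w (p n).1) - complex.Re c.
  (* Comparing J at p n + s w with its infimum gives a quadratic in s that is nonnegative up to
     [dl n], so its linear coefficient d is small. It is evaluated at s = -d / (W + 1), where W + 1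
     replaces W because W may vanish. *)
  have quad s : 0 <= s ^+ 2 * W + 2 * s * d + dl n.
    have := Ile _ _ (Glin (s%:C) g (pG n)); rewrite /J sqr_nrD nrZ normc_real.
    rewrite ipZl Re_real_complexM ReD Re_real_complexM exprMn real_normK ?num_real//.
    by have := pJ n; rewrite /J /W /d => hp; lra.
  have d2 : d ^+ 2 <= (D / 3) ^+ 2.
    have := quad (- d / (W + 1)).
    have -> : (- d / (W + 1)) ^+ 2 * W + 2 * (- d / (W + 1)) * d =
       - (d ^+ 2 * ((W + 2) / (W + 1) ^+ 2)) by field; rewrite gt_eqF.
    move=> k; have k2 : d ^+ 2 * ((W + 2) / (W + 1) ^+ 2) <= (D / 3) ^+ 2 / (W + 1).
      by apply: le_trans h1; lra.
    have k3 : d ^+ 2 / (W + 1) <= d ^+ 2 * ((W + 2) / (W + 1) ^+ 2).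
      rewrite ler_wpM2l ?sqr_ge0// ler_pdivlMr ?exprn_gt0//.
      rewrite (_ : (W + 1)^-1 * (W + 1) ^+ 2 = W + 1); last by field; rewrite gt_eqF.
      by rewrite lerD2l ler1n.
    by have := le_trans k3 k2; rewrite ler_pM2r ?invr_gt0.
  have d3 : `|d| <= D / 3.
    rewrite -(ler_pXn2r (ltn0Sn 1)) ?nnegrE// ?real_normK ?num_real//.
    by rewrite divr_ge0// ltW.
  have k4 : `|complex.Re (ip w (h - (p n).1))| <= D / 3.
    apply: le_trans (ler_Re_normc _) _; apply: le_trans (cauchy_schwarz _ _) _.
    move: h2; rewrite ler_pdivlMr// nrBC => h2; apply: le_trans h2.
    by rewrite mulrC ler_wpM2l ?nr_ge0// lerDr.
  have : D <= `|d| + `|complex.Re (ip w (h - (p n).1))|.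
    rewrite /D /d ipBr ReD ReN; apply: le_trans (ler_normD _ _).
    by rewrite le_eqVlt; apply/orP; left; apply/eqP; congr `| _ |; ring.
  by lra.
have rep u k : G u k -> k = ip u h.
  move=> g; apply/eqP; rewrite eq_complex (Reh _ _ g) eqxx /=.
  have := Glin (- 'i%C) g G00; rewrite !addr0 => /Reh; rewrite ipZl.
  have e (w : C) : complex.Re (- 'i%C * w) = complex.Im w by case: w => x y /=; ring.
  by rewrite !e => ->.
exists h; split=> // [|e e0]; last first.
  by have [N hN] := hh e e0; exists (p N).1, (p N).2; split; [exact: pG|exact: hN].
(* The vector h is a limit of vectors u of the domain, for which |ip u h| <= B |u|; in the limit
   |h|^2 <= B |h|. The chosen e is close enough to the limit to contradict B < |h|. *)
rewrite leNgt; apply/negP => Bh; have h0 := le_lt_trans B0 Bh.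
have s0 : 0 < B + nr h by rewrite ltr_wpDl.
have d0 : 0 < nr h - B by rewrite subr_gt0.
have e0 : 0 < nr h * (nr h - B) / (2 * (B + nr h)) by rewrite !(divr_gt0, mulr_gt0).
set e := _ / _ in e0; have [N /(_ N (leqnn _)) hN] := hh e e0.
have k1 : nr h ^+ 2 <= B * nr (p N).1 + e * nr h.
  have -> : nr h ^+ 2 = complex.Re (ip (p N).1 h - ip ((p N).1 - h) h).
    by rewrite ipBl opprB addrC subrK sqr_nrE.
  apply: le_trans (Re_le_normc _) _; apply: le_trans (normc_sub _ _) _.
  rewrite -(rep _ _ (pG N)); apply: lerD; first exact: Gb (pG N).
  by apply: le_trans (cauchy_schwarz _ _) _; rewrite ler_wpM2r ?nr_ge0.
have k2 : B * nr (p N).1 <= B * (nr h + e).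
  rewrite ler_wpM2l//; have := nrD ((p N).1 - h) h; rewrite subrK.
  by lra.
have k3 : e * (B + nr h) = nr h * (nr h - B) / 2 by rewrite /e; field; rewrite gt_eqF.
have k4 : 0 < nr h * (nr h - B) by rewrite mulr_gt0.
by move: k1 k2 k3 k4; rewrite expr2; set x := nr h; lra.
Qed.

End Riesz.

End InnerProduct.

(** * Orthogonal projections *)

Section Projection.
Variables (R : realType) (V : lmodType R[i]) (ip : {dot V for conjC}) (S : set V).
Hypothesis hc : hilbert_complete ip.
Local Notation Q := (orthc ip S).

Lemma orth_predP (x : V) : x \in orth_pred ip S <-> forall y, S y -> ip x y = 0.
Proof. by split=> [/asboolP|h] //; apply/asboolP. Qed.

Lemma orthcP (q : Q) y : S y -> ip (val q) y = 0.
Proof. by case: q => x /= /asboolP; apply. Qed.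

(** Riesz for u |-> ip u f on the orthogonal complement of S. The representing vector is only known
    to be a limit of elements of the complement, and Cauchy-Schwarz shows that such a limit is still
    orthogonal to S. *)
Lemma projection_exists : exists P : V -> Q, orthogonal_projection P.
Proof.
suff /choice[P hP] : forall f, exists q : Q, forall r : Q, ip (f - val q) (val r) = 0.
  by exists P => f q; exact: hP.
move=> f; pose G u k := u \in orth_pred ip S /\ k = ip u f.
have [||a u v k l [hu ->] [hv ->]|u k [_ ->]|h [hG _ hcl]] := @riesz R V ip hc G (nr ip f).
- exact: nr_ge0.
- by split; [exact: rpred0|rewrite ip0l].
- by split; [by rewrite rpredD ?rpredZ|rewrite ipDl ipZl].
- by rewrite mulrC; exact: cauchy_schwarz.
have hin : orth_pred ip S h.
  apply/asboolP => y Sy; apply/eqP; rewrite -normc_eq0 eq_le normc_ge0 andbT leNgt.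
  apply/negP => n0; have y0 : 0 < 1 + nr ip y by rewrite ltr_wpDr ?nr_ge0.
  have [u [k [[/orth_predP hu _] hd]]] := hcl _ (divr_gt0 (divr_gt0 n0 (ltr0n R 2)) y0).
  have e : ip h y = - ip (u - h) y by rewrite ipBl hu// sub0r opprK.
  have := cauchy_schwarz ip (u - h) y; rewrite -normcN -e.
  move: hd; rewrite ler_pdivlMr// => hd hcs.
  have : nr ip (u - h) * nr ip y <= nr ip (u - h) * (1 + nr ip y).
    by rewrite ler_wpM2l ?nr_ge0// lerDr.
  by clear -hd hcs n0; lra.
exists (Orthc hin) => r /=; rewrite -ipJ ipBr.
have hGr : G (val r) (ip (val r) f) by split=> //; case: (r) => x hx; exact: hx.
by rewrite -(hG _ _ hGr) subrr rmorph0.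
Qed.

Variable P : V -> Q.
Hypothesis hP : orthogonal_projection P.

Lemma proj_ip f (q : Q) : ip f (val q) = ip (val (P f)) (val q).
Proof. by apply/eqP; rewrite -subr_eq0 -ipBl hP. Qed.

Lemma orthc_ext (q r : Q) : (forall s : Q, ip (val q) (val s) = ip (val r) (val s)) ->
  q = r.
Proof.
move=> h; apply/val_inj/eqP; rewrite -subr_eq0; apply/eqP; apply: (@nr_eq0 _ _ ip).
have e : val q - val r = val (q - r) by rewrite raddfB.
apply/eqP; rewrite -sqrf_eq0 sqr_nrE {2}e ipBl h subrr //.
Qed.

Lemma projK (q : Q) : P (val q) = q.
Proof. by apply: orthc_ext => s; rewrite -proj_ip. Qed.

Lemma proj_linear : linear P.
Proof.
move=> a f g; apply: orthc_ext => s; rewrite -proj_ip linearP ipDl ipZl.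
by rewrite [in RHS]ipDl [in RHS]ipZl -!proj_ip.
Qed.

Lemma proj_nr f : nr ip (val (P f)) <= nr ip f.
Proof.
have [->|n0] := eqVneq (nr ip (val (P f))) 0; first exact: nr_ge0.
have p0 : 0 < nr ip (val (P f)) by rewrite lt_neqAle nr_ge0 eq_sym n0.
rewrite -(ler_pM2r p0) -expr2 sqr_nrE -proj_ip.
exact: le_trans (Re_le_normc _) (cauchy_schwarz _ _ _).
Qed.

End Projection.

(** * Joint spectrum and holomorphic calculus *)

Section KoszulExactness.
Variables (R : realType) (V : lmodType R[i]) (n : nat).
Variables (T : 'I_n -> V -> V) (lambda : 'I_n -> R[i]).
Hypothesis Tlin : forall i, linear (T i).
Hypothesis Tcomm : forall i j x, T i (T j x) = T j (T i x).
Implicit Types (A : {set 'I_n}) (i j : 'I_n).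

Let below j A : nat := #|[set l in A | (l < j)%N]|.
Let L j x := T j x - lambda j *: x.

Lemma below_add i j A : i \notin A -> below j (i |: A) = ((i < j) + below j A)%N.
Proof.
move=> iA; rewrite /below; case: ltnP => ij /=.
  rewrite -[RHS](_ : #|i |: [set l in A | (l < j)%N]| = _); last first.
    by rewrite cardsU1 inE (negbTE iA).
  apply: eq_card => l; rewrite !inE.
  by have [->|_] := eqVneq l i; rewrite ?ij.
rewrite add0n; apply: eq_card => l; rewrite !inE.
by have [->|_] := eqVneq l i; rewrite //= (negbTE iA) ltnNge ij.
Qed.

(** For distinct indices, contraction with e_i and exterior multiplication by e_j anticommute; this
    is that fact on the signs of the coefficients. *)
Lemma koszul_sign i j A : i \notin A -> j \in A ->
  (-1) ^+ below j A * (-1) ^+ below i (i |: A :\ j)%SET =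
  - ((-1) ^+ below i (i |: A)%SET * (-1) ^+ below j (i |: A)%SET) :> R[i].
Proof.
move=> iA jA; have ij : i != j by apply: contraNneq iA => ->.
have iA' : i \notin (A :\ j)%SET by rewrite !inE (negbTE iA) andbF.
rewrite !below_add// ltnn !add0n exprD.
have e : below i A = ((j < i) + below i (A :\ j)%SET)%N.
  by rewrite -{1}(finset.setD1K jA) below_add// !inE eqxx.
rewrite e exprD; have [lt|gt|/val_inj eij] := ltngtP i j.
- by rewrite /= expr1 expr0 !mul1r mulN1r mulrN opprK mulrC.
- by rewrite /= expr1 expr0 !mul1r mulrC !mulN1r mulNr opprK.
- by rewrite eij eqxx in ij.
Qed.

(* Contraction against the inverse of T_i - lambda_i is a homotopy. *)
Lemma koszul_exact i (S : V -> V) : linear S -> (forall x, L i (S x) = x) ->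
  (forall x, S (L i x) = x) -> forall x, koszul T lambda x = 0 ->
  exists y, koszul T lambda y = x.
Proof.
move=> Slin LS SL x hx.
have Llin j : linear (L j).
  by move=> a u v; rewrite /L Tlin scalerDr scalerBr !scalerA (mulrC a) opprD addrACA.
have Lcomm j k u : L j (L k u) = L k (L j u).
  rewrite /L; have [_ _ TB TZ] := linear_lin (Tlin j); have [_ _ TB' TZ'] := linear_lin (Tlin k).
  rewrite TB TB' TZ TZ' !scalerBr Tcomm !scalerA (mulrC (lambda k)) !opprB.
  by rewrite addrACA [RHS]addrACA; congr (_ + _); exact: addrC.
have Scomm j u : S (L j u) = L j (S u).
  by rewrite -{1}[u]LS Lcomm SL.
have [_ _ _ SZ] := linear_lin Slin.
have Ssum (I : Type) (r : seq I) (P : pred I) F :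
    S (\sum_(k <- r | P k) F k) = \sum_(k <- r | P k) S (F k).
  have [S0 SD _ _] := linear_lin Slin.
  by elim/big_rec2: _ => [//|k y1 y2 _ <-]; rewrite SD.
exists [ffun A : {set 'I_n} => if i \in A then 0
         else (-1) ^+ below i (i |: A)%SET *: S (x (i |: A)%SET)].
apply/ffunP => A; rewrite ffunE.
have [iA|iA] := boolP (i \in A).
  rewrite (bigD1 i)//= big1 ?addr0; last first.
    move=> j /andP[jA ji]; rewrite ffunE !inE iA (eq_sym i) ji /=.
    have [L0 _ _ _] := linear_lin (Llin j).
    by rewrite -/(L j 0) L0 scaler0.
  rewrite ffunE !inE eqxx /= finset.setD1K// -/(below i A).
  have [_ _ _ LZ] := linear_lin (Llin i).
  rewrite -/(L i _) LZ LS scalerA -exprD addnn -muln2 mulnC exprM sqrrN expr1n.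
  by rewrite expr1n scale1r.
(* For i outside A, read the cocycle condition at i |: A: its term of index i recovers x_A after
   applying S, and the other terms are those of the differential at A, with opposite signs. *)
have := congr1 (fun f : {ffun {set 'I_n} -> V} => f (i |: A)%SET) hx.
rewrite !ffunE (bigD1 i) ?setU11//= finset.setU1K// -/(below i _) -/(L i _).
move=> /(congr1 (fun v => (-1) ^+ below i (i |: A)%SET *: S v)).
have [S0 SD _ _] := linear_lin Slin.
rewrite S0 scaler0 SD SZ SL scalerDr scalerA -exprD addnn -muln2 mulnC exprM.
rewrite sqrrN !expr1n scale1r => /eqP; rewrite addr_eq0 => /eqP ->.
rewrite Ssum scaler_sumr -sumrN.
rewrite [RHS](eq_bigl (fun j => j \in A)); last first.
  move=> j; rewrite !inE; have [->|_] := eqVneq j i; last by rewrite andbT.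
  by rewrite (negbTE iA).
apply: eq_bigr => j jA; have ij : i != j by apply: contraNneq iA => ->.
rewrite ffunE !inE (negbTE iA) andbF -/(below j A) -/(below j _).
have e : (i |: A :\ j)%SET = ((i |: A) :\ j)%SET.
  by apply/setP => l; rewrite !inE; have [->|] := eqVneq l i; rewrite ?ij ?andbT.
have [_ _ _ LZ] := linear_lin (Llin j).
rewrite -!/(L j _) LZ -e SZ Scomm !scalerA -scaleNr; congr (_ *: _).
by rewrite koszul_sign.
Qed.

Lemma joint_spectrum_resolvent (ip : {dot V for conjC}) i S :
  is_resolvent ip (T i) (lambda i) S -> ~ joint_spectrum T lambda.
Proof.
(* A resolvent inverts lambda_i - T_i, whereas the Koszul differential is built from T_i - lambda_i;
   hence the sign. *)
move=> [[Slin _] h1 h2]; apply=> x; apply: (@koszul_exact i (fun x => - S x)).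
- by move=> a u v; rewrite Slin opprD scalerN.
- move=> u; have [_ TD TB TZ] := linear_lin (Tlin i).
  have TN w : T i (- w) = - T i w by rewrite -scaleN1r TZ scaleN1r.
  by rewrite /L TN scalerN opprK addrC h1.
- move=> u; have [_ SD SB SZ] := linear_lin Slin.
  by rewrite -scaleN1r -SZ scaleN1r /L opprB h2.
Qed.

End KoszulExactness.

(** * The Riesz-Dunford calculus of disc automorphisms *)

Section HolomorphicCalculus.
Variables (R : realType) (V : lmodType R[i]) (ip : {dot V for conjC}).
Local Notation C := (R[i]).
Local Notation nr := (nr ip).
Variables (T : V -> V) (res : C -> V -> V).
Hypothesis hT : nr_bounded ip T.
Hypothesis hres : forall z : C, 1 < normc z -> is_resolvent ip T z (res z).

Let Tlin := linear_lin hT.1.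

Lemma res_bounded z : 1 < normc z -> nr_bounded ip (res z).
Proof. by move=> /hres[/bounded_operatorP]. Qed.

Lemma resT z x : 1 < normc z -> res z (T x) = z *: res z x - x.
Proof.
move=> hz; have [_ _ /(_ x)] := hres hz.
have [_ _ rB rZ] := linear_lin (res_bounded hz).1.
by rewrite rB rZ => /eqP; rewrite subr_eq addrC -subr_eq => /eqP.
Qed.

Lemma Tres z x : 1 < normc z -> T (res z x) = z *: res z x - x.
Proof.
move=> hz; have [_ /(_ x) + _] := hres hz.
by move=> /eqP; rewrite subr_eq addrC -subr_eq => /eqP.
Qed.

Lemma resolvent_identity z w x : 1 < normc z -> 1 < normc w ->
  res z x - res w x = (w - z) *: res z (res w x).
Proof.
move=> hz hw; have [_ _ rB rZ] := linear_lin (res_bounded hz).1.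
have := resT (res w x) hz; rewrite Tres// rB rZ scalerBl.
by move=> /eqP; rewrite subr_eq => /eqP ->; rewrite addrAC (addrC (z *: _)) addrK addrC.
Qed.

(** By the resolvent identity res (z + h) x = res z x - h res z (res (z + h) x). Once |h| M <= 1/2,
    the last term is absorbed in the left-hand side, at the price of a factor 2. *)
Lemma res_local_bound z : 1 < normc z -> exists M d : R, [/\ 0 <= M, 0 < d &
  forall h x, normc h < d -> 1 < normc (z + h) /\ nr (res (z + h) x) <= M * nr x].
Proof.
move=> hz; have [_ [M M0 hM]] := res_bounded hz.
have d0 : 0 < Num.min (normc z - 1) ((2 * (M + 1))^-1).
  by rewrite lt_min subr_gt0 hz invr_gt0 mulr_gt0// ltr_wpDl.
exists (2 * M), (Num.min (normc z - 1) ((2 * (M + 1))^-1)).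
split=> //; first exact: mulr_ge0.
move=> h x; rewrite lt_min => /andP[h1 h2].
have zh : 1 < normc (z + h).
  have := normc_subr z (- h); rewrite normcN opprK.
  by lra.
split=> //; have e : res (z + h) x = res z x - h *: res z (res (z + h) x).
  have := resolvent_identity x hz zh.
  rewrite (_ : z + h - z = h); last by ring.
  by move=> <-; rewrite subKr.
have k1 : nr (res (z + h) x) <= M * nr x + normc h * (M * nr (res (z + h) x)).
  rewrite {1}e; apply: le_trans (nrD _ _ _) _; rewrite nrN nrZ lerD//.
  by rewrite ler_wpM2l ?normc_ge0.
have k2 : normc h * (M * nr (res (z + h) x)) <= 2^-1 * nr (res (z + h) x).
  rewrite mulrA ler_wpM2r ?nr_ge0//.
  move: h2; rewrite -[_^-1]mul1r ltr_pdivlMr; last by rewrite mulr_gt0// ltr_wpDl.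
  have := mulr_ge0 (normc_ge0 h) M0; have := normc_ge0 h.
  by move=> *; lra.
lra.
Qed.

Lemma cderiv_res x y z : 1 < normc z ->
  cderiv (fun z => ip (res z x) y) z (- ip (res z (res z x)) y).
Proof.
move=> hz eps e0; have [M [d [M0 d0 hM]]] := res_local_bound hz.
set K := M * nr (res z (res z x)) * nr y.
have K0 : 0 <= K by rewrite !mulr_ge0 ?nr_ge0.
have K10 : 0 < K + 1 by rewrite ltr_wpDl.
exists (Num.min d (eps / (K + 1))) => [|h]; first by rewrite lt_min d0 divr_gt0.
rewrite lt_min => /andP[h1 h2].
have [zh _] := hM h x h1.
have e1 w : res (z + h) w - res z w = (- h) *: res (z + h) (res z w).
  by rewrite resolvent_identity//; congr (_ *: _); ring.
have e2 : ip (res (z + h) x) y - ip (res z x) y - h * - ip (res z (res z x)) y =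
    h * (h * ip (res (z + h) (res z (res z x))) y).
  rewrite -ipBl e1 ipZl; have := congr1 (ip^~ y) (e1 (res z x)).
  rewrite /= ipBl ipZl => /eqP; rewrite subr_eq => /eqP ->; ring.
rewrite e2 normcM mulrC ler_wpM2r ?normc_ge0// normcM.
apply: (@le_trans _ _ (normc h * K)).
  rewrite ler_wpM2l ?normc_ge0//; apply: le_trans (cauchy_schwarz _ _ _) _.
  by rewrite ler_wpM2r ?nr_ge0//; have [] := hM h (res z (res z x)) h1.
move: h2; rewrite ltr_pdivlMr// mulrDr mulr1 => h2.
by have := normc_ge0 h; lra.
Qed.

(** The difference z (z - T)^-1 x - x is T (z - T)^-1 x, of norm at most B |x| / (|z| - B). *)
Lemma res_infty x y eps : 0 < eps -> exists2 d : R, 1 < d & forall z, d <= normc z ->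
  normc (z * ip (res z x) y - ip x y) <= eps.
Proof.
move=> e0; have [_ [B B0 hB]] := hT.
set K := B * nr x * nr y; have K0 : 0 <= K by rewrite !mulr_ge0 ?nr_ge0.
exists (B + K / eps + 2) => [|z hz].
  have : 0 <= K / eps by rewrite divr_ge0 ?(ltW e0).
  by lra.
have q0 : 0 <= K / eps by rewrite divr_ge0 ?(ltW e0).
have hz1 : 1 < normc z by lra.
have zB : 0 < normc z - B by lra.
rewrite -ipZl -ipBl -Tres//; apply: le_trans (cauchy_schwarz _ _ _) _.
have k1 : nr (res z x) * (normc z - B) <= nr x.
  have := nr_sub ip (z *: res z x) (z *: res z x - x).
  rewrite subKr nrZ -Tres// => k.
  have := hB (res z x); rewrite mulrBr mulrC (mulrC _ B); lra.
apply: (@le_trans _ _ (K / (normc z - B))).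
  rewrite /K ler_pdivlMr// mulrAC ler_wpM2r ?nr_ge0//.
  apply: (@le_trans _ _ (B * nr (res z x) * (normc z - B))).
    by rewrite ler_wpM2r ?(ltW zB).
  by rewrite -mulrA ler_wpM2l.
rewrite ler_pdivrMr// mulrC -ler_pdivrMr//; lra.
Qed.

(** Let u = c (T - a) S x. Then g(z) (z - T)^-1 x = (z - T)^-1 u + c (1 - |a|^2) / (1 - conj a z) S
    x. Since dz = i z dt, both terms get a factor z: the first product tends to u at infinity, and
    the second is holomorphic in |z| <= r and vanishes at 0. *)
Lemma holomorphic_calculus_mob (g : C -> C) (c a : C) (S : V -> V) :
  normc a < 1 -> (forall z, normc z < 1 -> g z = c * mob a z) ->
  linear S ->
  (forall x, S x - conjC a *: T (S x) = x) ->
  holomorphic_calculus ip T g (fun x => c *: (T (S x) - a *: S x)).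
Proof.
move=> a1 hg Slin hS.
(* The pole of [mob a] is at 1 / conj a; for a = 0 there is none, and 2 is an arbitrary radius
   larger than 1. *)
pose rho : R := if a == 0 then 2 else (normc a)^-1.
have rho1 : 1 < rho.
  rewrite /rho; case: eqVneq => [_|a0]; first by rewrite ltr1n.
  by rewrite invf_gt1// normc_gt0.
have den z : normc z < rho -> 1 - conjC a * z != 0.
  rewrite /rho; case: eqVneq => [->|a0] zr.
    by rewrite rmorph0 mul0r subr0 oner_eq0.
  rewrite -normc_gt0; apply: Re_gt0_neq0; apply: Re_1sub_gt0.
  by rewrite normcM normcJ mulrC -ltr_pdivlMr ?normc_gt0// div1r.
exists rho, (fun z => c * mob a z), res; split=> //.
- move=> z; rewrite discE => /den dz.
  by apply/derivable_cderiv; eexists; apply: cderiv_along_scale; exact: cderiv_mob.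
- by move=> z; rewrite disc1E => /hg.
- by move=> z; rewrite normr_normc (_ : 1 = 1%:C)// ltcR; exact: hres.
move=> r /andP[r1 rr] x y.
have r0 : 0 < r by apply: lt_trans r1.
set u := c *: (T (S x) - a *: S x).
pose psi1 z := z * ip (res z u) y.
pose psi2 z := z / (1 - conjC a * z).
have key z : normc z = r -> c * mob a z * ip (res z x) y * ('i%C * z) =
    'i%C * (psi1 z + c * (1 - a * conjC a) * ip (S x) y * psi2 z).
  move=> zr; have z1 : 1 < normc z by rewrite zr.
  have dz := den z; rewrite zr in dz; have {}dz := dz rr.
  have [_ _ rB rZ] := linear_lin (res_bounded z1).1.
  have e1 : ip (res z x) y = (1 - conjC a * z) * ip (res z (S x)) y + conjC a * ip (S x) y.
    rewrite -{1}(hS x) rB rZ resT// ipBl ipZl ipBl ipZl; ring.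
  have e2 : ip (res z u) y = c * ((z - a) * ip (res z (S x)) y - ip (S x) y).
    rewrite /u rZ rB rZ resT// ipZl !ipBl !ipZl; ring.
  by rewrite /psi1 /psi2 e2 e1 /mob; field.
have d1 z : r <= normc z -> exists l, cderiv psi1 z l.
  move=> rz; have z1 := lt_le_trans r1 rz.
  by eexists; exact: cderiv_along_mul (cderiv_id z) (cderiv_res u y z1).
have d2 z : normc z <= r -> exists l, cderiv psi2 z l.
  move=> zr; have dz := den z (le_lt_trans zr rr).
  have h2 := cderiv_along_sub (cderiv_along_cst (fun z => z) 1 z) (cderiv_scale (conjC a) z).
  by eexists; exact: cderiv_along_mul (cderiv_id z) (cderiv_along_inv h2 dz).
have i1 : circle_int psi1 r = ip u y * (2 * pi)%:C.
  apply: circle_int_infty => // eps e0; have [d d1' hd] := res_infty u y e0.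
  by exists d => //; apply: lt_trans d1'.
have i2 : circle_int psi2 r = 0 * (2 * pi)%:C.
  apply: circle_int_center => // [z /andP[_ /d2]//|eps e0].
  have z0 : normc (0 : C) <= r by rewrite normc0 ltW.
  have [l hl] := d2 0 z0; have [d d0 hd] := cderiv_along_cont hl e0.
  exists d => // z /andP[_ /hd]; rewrite add0r /psi2 mul0r subr0//.
have ci z : normc z = r -> (exists l, cderiv psi1 z l) /\ (exists l, cderiv psi2 z l).
  by move=> zr; split; [apply: d1|apply: d2]; rewrite zr.
have -> : contour_integral r (fun z => c * mob a z * ip (res z x) y) =
    'i%C * (circle_int psi1 r + c * (1 - a * conjC a) * ip (S x) y * circle_int psi2 r).
  have hc1 : cdiff_on (fun t => psi1 (r%:C * expi t)) 0 (2 * pi).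
    by apply: circle_cdiff => [|z /ci[]//]; exact: ltW.
  have hc2 : cdiff_on (fun t => psi2 (r%:C * expi t)) 0 (2 * pi).
    by apply: circle_cdiff => [|z /ci[]//]; exact: ltW.
  have hc3 k : cdiff_on (fun t => k * psi2 (r%:C * expi t)) 0 (2 * pi).
    by move=> t /hc2[l hl]; exists (k * l); exact: cderiv_along_scale.
  rewrite /circle_int -(cint_scale _ hc2) -cint_add// -cint_scale; last first.
    move=> t ht; have [l hl] := hc1 t ht; have [m hm] := hc3 (c * (1 - a * conjC a) * ip (S x) y) t ht.
    by exists (l + m); exact: cderiv_along_add hl hm.
  by apply: eq_cint => t _; rewrite -key// normc_circle// ltW.
rewrite i1 i2 mul0r mulr0 addr0 rmorphM/= rmorph_nat.
have p0 : pi%:C != 0 :> C by rewrite -normc_gt0 normc_real gtr0_norm ?pi_gt0.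
have i0 : 'i%C != 0 :> C by rewrite -normc_gt0 normc_i.
move: p0 i0; set p := pi%:C; set j := 'i%C; clearbody p j => p0 i0.
by field; rewrite p0 i0.
Qed.

End HolomorphicCalculus.

(** * Operators on the weighted Bergman space *)

Section ReproducingKernelOperators.
Variables (R : realType) (m : nat) (D : set 'rV[R[i]]_m).
Variables (K : 'rV[R[i]]_m -> 'rV[R[i]]_m -> R[i]) (H : lmodType R[i]).
Variables (ip : {dot H for conjC}) (ev : H -> 'rV[R[i]]_m -> R[i]).
Hypothesis hH : reproducing_kernel_space D K ip ev.
Local Notation C := (R[i]).
Local Notation T := 'rV[R[i]]_m.
Local Notation nr := (nr ip).
Implicit Types (z w : T) (f : H) (s : seq (C * T)) (phi : T -> T) (psi : T -> C).

Definition kf w : H := xget 0 [set k : H | (forall z, D z -> ev k z = K z w) /\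
  (forall f, ev f w = ip f k)].

Lemma kfP w : D w -> (forall z, D z -> ev (kf w) z = K z w) /\
  (forall f, ev f w = ip f (kf w)).
Proof.
move=> /(rk_reproducing hH)[k hk]; rewrite /kf; case: xgetP => [_ -> //|h].
by have := h k hk.
Qed.

Lemma ev_kf w z : D w -> D z -> ev (kf w) z = K z w.
Proof. by move=> /kfP[h _]; exact: h. Qed.

Lemma ev_ip f w : D w -> ev f w = ip f (kf w).
Proof. by move=> /kfP[_]. Qed.

Lemma ip_kf w v : D w -> D v -> ip (kf w) (kf v) = K v w.
Proof. by move=> hw hv; rewrite -ev_ip// ev_kf. Qed.

Lemma evZ a f z : D z -> ev (a *: f) z = a * ev f z.
Proof. by move=> hz; rewrite !ev_ip// ipZl. Qed.

Lemma evD f g z : D z -> ev (f + g) z = ev f z + ev g z.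
Proof. by move=> hz; rewrite !ev_ip// ipDl. Qed.

Lemma evB f g z : D z -> ev (f - g) z = ev f z - ev g z.
Proof. by move=> hz; rewrite !ev_ip// ipBl. Qed.

Definition comb (a : C * T -> C) (x : C * T -> H) s : H := \sum_(p <- s) a p *: x p.

Lemma sqr_nr_comb a x s :
  (nr (comb a x s) ^+ 2)%:C = \sum_(p <- s) \sum_(q <- s) a p * conjC (a q) * ip (x p) (x q).
Proof.
rewrite -ip_nr /comb ip_suml; apply: eq_bigr => p _.
by rewrite ip_sumr; apply: eq_bigr => q _; rewrite ipZl ipZr; ring.
Qed.

Definition inD s := forall p, p \in s -> D p.2.

(* A function belongs to the space as soon as it induces a bounded functional on
   the span of the kernel functions. *)
Lemma rk_member (g : T -> C) (B : R) : 0 <= B ->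
  (forall s, inD s -> normc (\sum_(p <- s) p.1 * conjC (g p.2)) <=
     B * nr (\sum_(p <- s) p.1 *: kf p.2)) ->
  exists h, (forall z, D z -> ev h z = g z) /\ nr h <= B.
Proof.
move=> B0 hB.
pose G u k := exists s, [/\ inD s, u = \sum_(p <- s) p.1 *: kf p.2 &
   k = \sum_(p <- s) p.1 * conjC (g p.2)].
have [|a u v k l [s [hs -> ->]] [t [ht -> ->]]|u k [s [hs -> ->]]|h [hG hb _]] :=
  @riesz R H ip (rk_complete hH) G B B0.
- by exists [::]; rewrite !big_nil.
- exists ([seq (a * p.1, p.2) | p <- s] ++ t); split.
  + move=> p; rewrite mem_cat => /orP[/mapP[q /hs hq ->]//|/ht//].
  + rewrite big_cat big_map scaler_sumr; congr (_ + _).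
    by apply: eq_bigr => p _; rewrite scalerA.
  + rewrite big_cat big_map mulr_sumr; congr (_ + _).
    by apply: eq_bigr => p _; rewrite mulrA.
- exact: hB.
exists h; split=> // z hz.
have e : conjC (g z) = ip (kf z) h; last by rewrite ev_ip// -ipJ -e conjCK.
apply: hG; exists [:: (1, z)]; rewrite !big_seq1 scale1r mul1r; split=> // p.
by rewrite inE => /eqP ->.
Qed.

Definition wcop phi psi (X : H -> H) :=
  forall f z, D z -> ev (X f) z = psi z * ev f (phi z).

Lemma wcop_linear phi psi X : (forall z, D z -> D (phi z)) -> wcop phi psi X ->
  linear X.
Proof.
move=> hphi hX a f g; apply: (rk_inj hH) => z hz; have hp := hphi z hz.
rewrite hX// (rk_linear hH hp) (rk_linear hH hz) !hX//; ring.
Qed.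

(** The hypothesis bounds, on the span of the kernel functions, the prospective adjoint, which sends
    K_w to conj (psi w) K_(phi w). Pairing it with f gives the bounded functional from which
    [rk_member] produces X f. *)
Lemma wcop_exists phi psi (B : R) : 0 <= B -> (forall z, D z -> D (phi z)) ->
  (forall s, inD s -> nr (\sum_(p <- s) (p.1 * conjC (psi p.2)) *: kf (phi p.2)) <=
     B * nr (\sum_(p <- s) p.1 *: kf p.2)) ->
  exists2 X, wcop phi psi X & linear X /\ forall f, nr (X f) <= B * nr f.
Proof.
move=> B0 hphi hB.
have /choice[X hX] : forall f, exists g,
    (forall z, D z -> ev g z = psi z * ev f (phi z)) /\ nr g <= B * nr f.
  move=> f; apply: rk_member => [|s hs]; first by rewrite mulr_ge0 ?nr_ge0.
  have -> : \sum_(p <- s) p.1 * conjC (psi p.2 * ev f (phi p.2)) =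
      ip (\sum_(p <- s) (p.1 * conjC (psi p.2)) *: kf (phi p.2)) f.
    rewrite ip_suml; apply: eq_big_seq => p /hs hp; have hq := hphi _ hp.
    by rewrite ipZl rmorphM/= ev_ip// ipJ mulrA.
  apply: le_trans (cauchy_schwarz _ _ _) _.
  rewrite mulrAC; apply: ler_wpM2r; first exact: nr_ge0.
  exact: hB.
have wX : wcop phi psi X by move=> f z hz; have [-> //] := hX f.
exists X => //; split; first exact: wcop_linear wX.
by move=> f; have [] := hX f.
Qed.

(** Quasi-invariance says that the prospective adjoint preserves the inner products of kernel
    functions, so it is isometric on their span. The same holds for the inverse data, and two
    mutually inverse contractions are isometries. *)
Lemma wcop_unitary phi phi' psi :
  (forall z, D z -> D (phi z)) -> (forall z, D z -> D (phi' z)) ->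
  (forall z, D z -> phi (phi' z) = z) -> (forall z, D z -> phi' (phi z) = z) ->
  (forall z, D z -> psi z != 0) ->
  (forall z w, D z -> D w ->
     K z w = psi z * K (phi z) (phi w) * conjC (psi w)) ->
  exists U U', [/\ wcop phi psi U, wcop phi' (fun z => (psi (phi' z))^-1) U',
    linear U /\ linear U', (forall f, nr (U f) = nr f) &
    (forall f, U (U' f) = f) /\ (forall f, U' (U f) = f)].
Proof.
move=> hp hp' pK pK' psi0 hK.
have isom th ps : (forall z, D z -> D (th z)) ->
    (forall z w, D z -> D w -> K z w = ps z * K (th z) (th w) * conjC (ps w)) ->
    forall s, inD s -> nr (\sum_(p <- s) (p.1 * conjC (ps p.2)) *: kf (th p.2)) <=
     1 * nr (\sum_(p <- s) p.1 *: kf p.2).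
  move=> hth hps s hs; rewrite mul1r le_eqVlt; apply/orP; left.
  rewrite -(eqrXn2 (ltn0Sn 1)) ?nr_ge0//; apply/eqP; apply: (@complexI R).
  rewrite (sqr_nr_comb (fun p => p.1 * conjC (ps p.2)) (fun p => kf (th p.2))).
  rewrite (sqr_nr_comb (fun p => p.1) (fun p => kf p.2)).
  apply: eq_big_seq => p /hs dp; apply: eq_big_seq => q /hs dq.
  rewrite !ip_kf//; try exact: hth.
  rewrite (hps q.2 p.2)// rmorphM/= conjCK; ring.
have [U hU [lU bU]] := wcop_exists ler01 hp (isom _ _ hp hK).
pose psi' z := (psi (phi' z))^-1.
have hK' z w : D z -> D w -> K z w = psi' z * K (phi' z) (phi' w) * conjC (psi' w).
  move=> hz hw; rewrite (hK (phi' z) (phi' w)) ?pK//; try exact: hp'.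
  rewrite /psi' fmorphV/=; field; rewrite conjC_eq0 !psi0//; exact: hp'.
have [U' hU' [lU' bU']] := wcop_exists ler01 hp' (isom _ _ hp' hK').
have UU' f : U (U' f) = f.
  apply: (rk_inj hH) => z hz; have d := hp z hz.
  by rewrite hU// hU'// /psi' pK'// mulrA mulfV ?mul1r// psi0.
have U'U f : U' (U f) = f.
  apply: (rk_inj hH) => z hz; have d := hp' z hz.
  by rewrite hU'// hU// pK// mulrA mulVf ?mul1r// psi0.
exists U, U'; split=> // f; apply/eqP; rewrite eq_le.
have := bU f; rewrite mul1r => -> /=.
by rewrite -{1}[f]U'U; have := bU' (U f); rewrite mul1r.
Qed.

Definition multiplier psi (X : H -> H) := wcop id psi X /\ nr_bounded ip X.

Lemma multiplier_id : multiplier (fun _ => 1) id.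
Proof. by split; [move=> f z _; rewrite mul1r|exact: nr_bounded_id]. Qed.

Lemma multiplier_add psi1 psi2 X1 X2 : multiplier psi1 X1 -> multiplier psi2 X2 ->
  multiplier (fun z => psi1 z + psi2 z) (fun f => X1 f + X2 f).
Proof.
move=> [h1 b1] [h2 b2]; split; last exact: nr_bounded_add.
by move=> f z hz; rewrite evD// h1// h2// mulrDl.
Qed.

Lemma multiplier_scale a psi X : multiplier psi X ->
  multiplier (fun z => a * psi z) (fun f => a *: X f).
Proof.
move=> [h b]; split; last exact: nr_bounded_scale.
by move=> f z hz; rewrite evZ// h// mulrA.
Qed.

Lemma multiplier_comp psi1 psi2 X1 X2 : multiplier psi1 X1 -> multiplier psi2 X2 ->
  multiplier (fun z => psi1 z * psi2 z) (fun f => X1 (X2 f)).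
Proof.
move=> [h1 b1] [h2 b2]; split; last exact: nr_bounded_comp.
by move=> f z hz; rewrite h1// h2// mulrA.
Qed.

Lemma multiplier_ext psi psi' X : (forall z, D z -> psi z = psi' z) ->
  multiplier psi X -> multiplier psi' X.
Proof. by move=> e [h b]; split=> // f z hz; rewrite h// e. Qed.

End ReproducingKernelOperators.

(** * Multipliers and Moebius unitaries of the weighted Bergman space *)

Section BergmanSpace.
Variables (R : realType) (m : nat) (alpha : 'I_m -> R).
Hypothesis alpha0 : forall j, 0 < alpha j.
Variables (H : lmodType R[i]) (ip : {dot H for conjC}).
Variable ev : H -> 'rV[R[i]]_m -> R[i].
Hypothesis hH : reproducing_kernel_space (polydisc m) (bergman_kernel alpha) ip ev.
Local Notation C := (R[i]).
Local Notation T := 'rV[R[i]]_m.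
Local Notation nr := (nr ip).
Local Notation D := (polydisc m).
Local Notation K := (bergman_kernel alpha).
Local Notation kf := (kf D K ip ev).
Local Notation multiplier := (multiplier D ip ev).
Implicit Types (z w : T) (f : H) (i j : 'I_m).

Lemma polydiscE z : D z <-> forall j, normc (z 0 j) < 1.
Proof. by split=> h j; have := h j; rewrite disc1E. Qed.

Lemma polydisc_ker z w j : D z -> D w -> normc (z 0 j * conjC (w 0 j)) < 1.
Proof.
move=> /polydiscE hz /polydiscE hw; rewrite normcM normcJ.
by apply: le_lt_trans (hz j); rewrite ler_piMr ?normc_ge0// ltW.
Qed.

Lemma polydisc_Re z w j : D z -> D w -> 0 < complex.Re (1 - z 0 j * conjC (w 0 j)).
Proof. by move=> hz hw; apply: Re_1sub_gt0; exact: polydisc_ker. Qed.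

Definition zero_at i z : T := \row_j (if j == i then 0 else z 0 j).

Lemma zero_atP i z : D z -> D (zero_at i z).
Proof.
move=> /polydiscE h; apply/polydiscE => j; rewrite mxE.
by case: eqP => // _; rewrite normc0.
Qed.

(** A kernel factor is 1 at the origin, so the kernel without its i-th factor is again a value of K.
    It is thus a Gram matrix of kernel functions in the same space, which gives its positivity. *)
Lemma bergman_kernel_split i z w : K z w =
  cpow (1 - z 0 i * conjC (w 0 i)) (- alpha i) * K (zero_at i z) (zero_at i w).
Proof.
rewrite /bergman_kernel (bigD1 i)//= [in RHS](bigD1 i)//= !mxE eqxx mul0r subr0 cpow1.
rewrite mul1r; congr (_ * _); apply: eq_bigr => j ji.
by rewrite !mxE (negbTE ji).
Qed.

(* (b - x) (1 - x)^(-alpha) has nonnegative Taylor coefficients as soon as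
   b >= 1 and b * alpha >= 1, so (b - z_i conj w_i) K(z, w) is a positive kernel
   and multiplication by z_i is bounded by sqrt b. *)
Definition mult_bound i : R := Num.max 1 (alpha i)^-1.

Definition pos_coef i n : R :=
  if n is k.+1 then mult_bound i * bincoef (alpha i) k.+1 - bincoef (alpha i) k
  else mult_bound i.

(** With c_n the binomial coefficients and b = [mult_bound i], (n + 1) (b c_(n+1) - c_n) = (b (alpha
    + n) - (n + 1)) c_n, and b alpha >= 1, b >= 1. *)
Lemma pos_coef_ge0 i n : 0 <= pos_coef i n.
Proof.
have b1 : 1 <= mult_bound i by rewrite le_max lexx.
have b2 : 1 <= mult_bound i * alpha i.
  by rewrite -ler_pdivrMr// mul1r le_max lexx orbT.
case: n => [|n] /=; first exact: le_trans ler01 b1.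
rewrite subr_ge0 -(ler_pM2l (_ : 0 < n.+1%:R)) ?ltr0n// mulrCA bincoefS mulrA.
rewrite ler_wpM2r ?(ltW (bincoef_gt0 _ _))// mulrDr -natr1 addrC lerD//.
by rewrite ler_peMl.
Qed.

Lemma pos_coef_sum i (x : C) n :
  \sum_(k < n.+1) (pos_coef i k)%:C * x ^+ k =
  (mult_bound i)%:C * binsum (alpha i) x n.+1 - x * binsum (alpha i) x n.
Proof.
rewrite /binsum big_ord_recl [in RHS]big_ord_recl /= bincoef0 !expr0 !mulr1.
rewrite mulrDr mulr1 -addrA; congr (_ + _); rewrite !mulr_sumr -sumrB.
by apply: eq_bigr => k _; rewrite /bump /= add1n rmorphB rmorphM/= exprS; ring.
Qed.

Lemma pos_coef_clim i (x : C) : normc x < 1 ->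
  clim (fun n => \sum_(k < n.+1) (pos_coef i k)%:C * x ^+ k)
       (((mult_bound i)%:C - x) * cpow (1 - x) (- alpha i)).
Proof.
move=> x1; have h := binsum_clim (alpha0 i) x1.
have hS : clim (fun n => binsum (alpha i) x n.+1) (cpow (1 - x) (- alpha i)).
  by move=> e /h[N hN]; exists N => n hn; apply: hN; exact: leqW.
have := clim_add (clim_scale (mult_bound i)%:C hS) (clim_scale (- x) h).
rewrite -mulrDl => h2 e /h2[N hN]; exists N => n /hN.
by rewrite pos_coef_sum mulNr.
Qed.

Lemma coord_multiplier i : exists M, multiplier (fun z => z 0 i) M.
Proof.
set b := mult_bound i.
have b0 : 0 <= b by apply: le_trans ler01 _; rewrite le_max lexx.
have [s hs|X hX [lX bX]] := @wcop_exists _ _ _ _ _ _ _ hH id (fun z => z 0 i)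
    (Num.sqrt b) (sqrtr_ge0 _) (fun _ h => h).
  rewrite -(ler_pXn2r (ltn0Sn 1)) ?nnegrE ?mulr_ge0 ?nr_ge0 ?sqrtr_ge0//.
  rewrite exprMn (sqr_sqrtr b0) -subr_ge0.
  pose x (p q : C * T) := q.2 0 i * conjC (p.2 0 i).
  pose k0 (p : C * T) := kf (zero_at i p.2).
  pose u n := \sum_(p <- s) \sum_(q <- s) p.1 * conjC q.1 * ip (k0 p) (k0 q) *
     \sum_(k < n.+1) (pos_coef i k)%:C * x p q ^+ k.
  pose l := \sum_(p <- s) \sum_(q <- s) p.1 * conjC q.1 * ip (k0 p) (k0 q) *
     ((b%:C - x p q) * cpow (1 - x p q) (- alpha i)).
  have -> : b * nr (\sum_(p <- s) p.1 *: kf p.2) ^+ 2 -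
      nr (\sum_(p <- s) (p.1 * conjC (p.2 0 i)) *: kf p.2) ^+ 2 = complex.Re l.
    rewrite -[LHS]/(complex.Re (_%:C)); congr complex.Re.
    rewrite rmorphB rmorphM/=.
    rewrite (sqr_nr_comb ip (fun p => p.1) (fun p => kf p.2)).
    rewrite (sqr_nr_comb ip (fun p => p.1 * conjC (p.2 0 i)) (fun p => kf p.2)).
    rewrite mulr_sumr -sumrB; apply: eq_big_seq => p /hs dp.
    rewrite mulr_sumr -sumrB; apply: eq_big_seq => q /hs dq.
    rewrite /k0 !(ip_kf hH)//; try exact: zero_atP.
    rewrite (bergman_kernel_split i q.2 p.2) rmorphM/= conjCK /x; ring.
  have hu : clim u l.
    apply: clim_sum => p /hs dp; apply: clim_sum => q /hs dq.
    by apply: clim_scale; apply: pos_coef_clim; exact: polydisc_ker.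
  apply: clim_Re_ge0 hu _ => n.
  (* The k-th power of q_i conj p_i splits into a factor for p and a factor for q, which join the
     coefficients of the combination. Each Taylor term thus becomes a nonnegative multiple of a
     squared norm. *)
  have -> : u n = \sum_(k < n.+1) (pos_coef i k)%:C *
      (nr (\sum_(p <- s) (p.1 * conjC (p.2 0 i) ^+ k) *: k0 p) ^+ 2)%:C.
    under [RHS]eq_bigr => k _ do
      rewrite (sqr_nr_comb ip (fun p => p.1 * conjC (p.2 0 i) ^+ k) k0) mulr_sumr.
    rewrite exchange_big /=; apply: eq_bigr => p _.
    under [RHS]eq_bigr => k _ do rewrite mulr_sumr.
    rewrite exchange_big /=; apply: eq_bigr => q _.
    rewrite mulr_sumr; apply: eq_bigr => k _.
    rewrite /x exprMn rmorphM rmorphXn/= conjCK; ring.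
  elim/big_ind: _ => // [y z hy hz|k _]; first by rewrite ReD addr_ge0.
  by rewrite Re_real_complexM mulr_ge0 ?pos_coef_ge0// sqr_ge0.
by exists X; split=> //; split=> //; exists (Num.sqrt b) => //; exact: sqrtr_ge0.
Qed.

Section CoordinatewiseMobius.
Variables (c a : 'I_m -> C).
Hypothesis c1 : forall j, normc (c j) = 1.
Hypothesis a1 : forall j, normc (a j) < 1.

Definition coord_mob z : T := \row_j (c j * mob (a j) (z 0 j)).
Definition coord_mob_inv z : T := \row_j (mob (- a j) (conjC (c j) * z 0 j)).

(** The factor of index j is the power alpha_j / 2 of the derivative of [mob (a j)], which is (1 -
    |a|^2) / (1 - conj a z)^2. *)
Definition cocycle z : C := \prod_j
  (((1 - normc (a j) ^+ 2) `^ (alpha j / 2))%:C *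
   cpow (1 - conjC (a j) * z 0 j) (- alpha j)).

Let cc j : c j * conjC (c j) = 1.
Proof. by rewrite mulcJ c1 expr1n. Qed.

Let na j : 0 < 1 - normc (a j) ^+ 2.
Proof. by rewrite subr_gt0 expr_lt1 ?normc_ge0. Qed.

Lemma coord_mobD z : D z -> D (coord_mob z).
Proof.
move=> /polydiscE hz; apply/polydiscE => j.
by rewrite mxE normcM c1 mul1r normc_mob_lt1.
Qed.

Lemma coord_mob_invD z : D z -> D (coord_mob_inv z).
Proof.
move=> /polydiscE hz; apply/polydiscE => j; rewrite mxE normc_mob_lt1 ?normcN//.
by rewrite normcM normcJ c1 mul1r.
Qed.

Lemma coord_mobK z : D z -> coord_mob (coord_mob_inv z) = z.
Proof.
move=> /polydiscE hz; apply/rowP => j; rewrite !mxE.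
have -> : mob (a j) (mob (- a j) (conjC (c j) * z 0 j)) = conjC (c j) * z 0 j.
  rewrite -{1}(opprK (a j)) mobK ?normcN//.
  by rewrite normcM normcJ c1 mul1r.
by rewrite mulrA cc mul1r.
Qed.

Lemma coord_mob_invK z : D z -> coord_mob_inv (coord_mob z) = z.
Proof.
move=> /polydiscE hz; apply/rowP => j; rewrite !mxE mulrA (mulrC (conjC _)) cc mul1r.
by rewrite mobK.
Qed.

Lemma cocycle_neq0 z : D z -> cocycle z != 0.
Proof.
move=> /polydiscE hz; apply/prodf_neq0 => j _; rewrite mulf_neq0//.
  by rewrite -normc_gt0 normc_real gtr0_norm powR_gt0.
by apply: cpow_neq0; exact: mob_den_Re.
Qed.

(** In each variable this is [mob_kernel] to the power -alpha_j; all factors have positive real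
    part, so principal powers multiply. The constant (1 - |a_j|^2)^(alpha_j) is shared equally
    between the two cocycles, and the rotations c_j cancel. *)
Lemma cocycle_kernel z w : D z -> D w ->
  K z w = cocycle z * K (coord_mob z) (coord_mob w) * conjC (cocycle w).
Proof.
move=> hz hw; have /polydiscE hz1 := hz; have /polydiscE hw1 := hw.
rewrite /cocycle rmorph_prod /bergman_kernel -!big_split /=; apply: eq_bigr => j _.
rewrite !mxE [conjC (_%:C * _)]rmorphM/= conjC_realE.
set cj := c j * _ * _.
have -> : cj = mob (a j) (z 0 j) * conjC (mob (a j) (w 0 j)).
  by rewrite /cj rmorphM/= mulrACA cc mul1r.
set x := 1 - z 0 j * conjC (w 0 j); set v := 1 - _ * conjC (mob _ _).
set p := 1 - conjC (a j) * z 0 j; set q := 1 - conjC (a j) * w 0 j.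
have x0 : 0 < complex.Re x by exact: polydisc_Re.
have v0 : 0 < complex.Re v.
  apply: Re_1sub_gt0; rewrite normcM normcJ.
  have h1 := normc_mob_lt1 (a1 j) (hz1 j); have h2 := normc_mob_lt1 (a1 j) (hw1 j).
  by apply: le_lt_trans h1; rewrite ler_piMr ?normc_ge0// ltW.
have p0 : 0 < complex.Re p by exact: mob_den_Re.
have q0 : 0 < complex.Re q by exact: mob_den_Re.
have q0' : 0 < complex.Re (conjC q) by rewrite Re_conjC.
have gx : 0 < complex.Re ((1 - normc (a j) ^+ 2)%:C * x).
  by rewrite Re_real_complexM mulr_gt0.
have e : (1 - normc (a j) ^+ 2)%:C * x = v * p * conjC q.
  rewrite one_sub_sqr_normc /x -(mob_kernel (a1 j) (hz1 j) (hw1 j)).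
  have -> : conjC q = 1 - a j * conjC (w 0 j) by rewrite /q rmorphB rmorphM/= rmorph1 conjCK.
  by [].
have := cpow_mul3 (- alpha j) gx v0 p0 q0' e.
have g1 : 0 < complex.Re (1 - normc (a j) ^+ 2)%:C by exact: na.
rewrite (cpow_mul (- alpha j) g1 x0 gx) cpow_real// cpowJ// powRN fmorphV/= => e2.
have g0 : ((1 - normc (a j) ^+ 2) `^ alpha j)%:C != 0 :> C.
  by rewrite -normc_gt0 normc_real gtr0_norm powR_gt0.
have gg : ((1 - normc (a j) ^+ 2) `^ (alpha j / 2))%:C *
    ((1 - normc (a j) ^+ 2) `^ (alpha j / 2))%:C =
    ((1 - normc (a j) ^+ 2) `^ alpha j)%:C :> C.
  rewrite -rmorphM/= -powRD; last by rewrite (gt_eqF (na j)) implybT.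
  by congr (_%:C); congr (_ `^ _); field.
have -> : cpow x (- alpha j) = ((1 - normc (a j) ^+ 2) `^ alpha j)%:C *
   (cpow v (- alpha j) * cpow p (- alpha j) * conjC (cpow q (- alpha j))).
  by rewrite -e2 mulrA mulfV// mul1r.
by rewrite -gg; ring.
Qed.

Lemma mobius_unitary : exists U U', [/\ wcop D ev coord_mob cocycle U,
  wcop D ev coord_mob_inv (fun z => (cocycle (coord_mob_inv z))^-1) U',
  linear U /\ linear U', (forall f, nr (U f) = nr f) &
  (forall f, U (U' f) = f) /\ (forall f, U' (U f) = f)].
Proof.
apply: (wcop_unitary hH).
- exact: coord_mobD.
- exact: coord_mob_invD.
- exact: coord_mobK.
- exact: coord_mob_invK.
- exact: cocycle_neq0.
- exact: cocycle_kernel.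
Qed.

End CoordinatewiseMobius.

(** The unitary that moves only the i-th variable conjugates multiplication by z_i into
    multiplication by [mob a] of z_i. *)
Lemma mob_multiplier i (a : C) : normc a < 1 ->
  exists X, multiplier (fun z => mob a (z 0 i)) X.
Proof.
move=> a1; pose aj j : C := if j == i then a else 0.
have c1 (j : 'I_m) : normc (1 : C) = 1 by rewrite normc1.
have aj1 j : normc (aj j) < 1 by rewrite /aj; case: eqP => // _; rewrite normc0.
have [U [U' [wU wU' [lU lU'] isoU [UU' U'U]]]] := mobius_unitary c1 aj1.
have [M [wM bM]] := coord_multiplier i.
have isoU' f : nr (U' f) = nr f by rewrite -{2}[f]UU' isoU.
exists (fun f => U (M (U' f))); split; last first.
  apply: nr_bounded_comp; last apply: nr_bounded_comp => //.
    by split=> //; exists 1 => // f; rewrite isoU mul1r.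
  by split=> //; exists 1 => // f; rewrite isoU' mul1r.
move=> f z hz; have hp := coord_mobD c1 aj1 hz.
rewrite wU// wM// wU'// coord_mob_invK// mxE mul1r /aj eqxx.
by field; exact: cocycle_neq0.
Qed.

(** The function is affine in [mob a]: (1 - |a|^2) (1 - conj a z)^-1 = 1 + conj a mob a z. *)
Lemma inverse_multiplier i (a : C) : normc a < 1 ->
  exists X, multiplier (fun z => (1 - conjC a * z 0 i)^-1) X.
Proof.
move=> a1; have [X hX] := mob_multiplier i a1.
have n0 : 1 - a * conjC a != 0.
  rewrite -one_sub_sqr_normc -normc_gt0 normc_real gtr0_norm;
  by rewrite subr_gt0 expr_lt1 ?normc_ge0.
exists (fun f => (1 - a * conjC a)^-1 *: (f + conjC a *: X f)).
have h := multiplier_scale hH (1 - a * conjC a)^-1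
  (multiplier_add hH (multiplier_id D ip ev) (multiplier_scale hH (conjC a) hX)).
apply: multiplier_ext h => z /polydiscE hz.
by rewrite /mob; field; rewrite n0 mob_den.
Qed.

Lemma resolvent_multiplier i (l : C) : 1 < normc l ->
  exists X, multiplier (fun z => (l - z 0 i)^-1) X.
Proof.
move=> l1; have l0 : l != 0 by rewrite -normc_gt0 (lt_trans _ l1).
pose a := conjC l^-1.
have a1 : normc a < 1 by rewrite normcJ normcV invf_lt1// normc_gt0.
have [X hX] := inverse_multiplier i a1.
exists (fun f => l^-1 *: X f).
apply: multiplier_ext (multiplier_scale hH l^-1 hX) => z _.
rewrite /a conjCK.
have e : l - z 0 i = l * (1 - l^-1 * z 0 i) by rewrite mulrBr mulr1 mulrA mulfV// mul1r.
by rewrite e invfM mulrC.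
Qed.

End BergmanSpace.

(** * Smoothness and vanishing along a set *)

Section PartialDerivatives.
Variables (R : realType) (m : nat).
Local Notation C := (R[i]).
Local Notation T := 'rV[R[i]]_m.
Local Notation D := (polydisc m).
Implicit Types (F G : T -> C) (z w : T) (i : 'I_m).

Definition pderiv i F w (l : C) : Prop := cderiv (fun t : C => F (t *: 'e_i + w)) 0 l.

Lemma pderiv_partial i F w l : pderiv i F w l -> partial i F w = l.
Proof. by move=> /(is_derive_cderiv F)[]. Qed.

Lemma shiftE (t : C) i w j : (t *: 'e_i + w) 0 j = if j == i then t + w 0 j else w 0 j.
Proof. by rewrite !mxE eqxx; case: eqP => _; rewrite ?mulr1 ?mulr0 ?add0r. Qed.

Lemma shift0 i w : (0 : C) *: 'e_i + w = w.
Proof. by rewrite scale0r add0r. Qed.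

Lemma polydisc_shift i w : D w -> exists2 r : R, 0 < r &
  forall t : C, normc t < r -> D (t *: 'e_i + w).
Proof.
move=> /polydiscE hw; exists (1 - normc (w 0 i)); first by rewrite subr_gt0.
move=> t ht; apply/polydiscE => j; rewrite shiftE; case: eqP => [->|_] //.
by apply: le_lt_trans (le_normcD _ _) _; rewrite -ltrBrDr.
Qed.

Lemma pderiv_ext i F G w l : D w -> (forall z, D z -> F z = G z) ->
  pderiv i F w l -> pderiv i G w l.
Proof.
move=> hw FG; have [r r0 hr] := polydisc_shift i hw.
apply: (cderiv_along_ext r0) => // t /hr ht.
by rewrite add0r FG.
Qed.

Lemma pderiv_mul i F G w l l' : pderiv i F w l -> pderiv i G w l' ->
  pderiv i (fun z => F z * G z) w (l * G w + F w * l').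
Proof.
by move=> hF hG; have := cderiv_along_mul hF hG; rewrite shift0.
Qed.

Lemma pderiv_add i F G w l l' : pderiv i F w l -> pderiv i G w l' ->
  pderiv i (fun z => F z + G z) w (l + l').
Proof. exact: cderiv_along_add. Qed.

(** Derivatives along the coordinate axes are enough: products need no more, and the only changes of
    variables are coordinatewise. *)
Fixpoint smooth n F : Prop := if n is k.+1 then
  (forall i w, D w -> exists l, pderiv i F w l) /\ (forall i, smooth k (partial i F))
  else True.

Lemma smooth_pderiv n F i w : smooth n.+1 F -> D w -> pderiv i F w (partial i F w).
Proof.
by move=> [h _] hw; have [l hl] := h i w hw; rewrite (pderiv_partial hl).
Qed.

Lemma partial_ext n F G i w : smooth n.+1 F -> (forall z, D z -> F z = G z) -> D w ->
  partial i F w = partial i G w.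
Proof.
move=> sF FG hw; apply/esym/pderiv_partial/(pderiv_ext hw FG).
exact: smooth_pderiv sF hw.
Qed.

Lemma smooth_ext n F G : (forall z, D z -> F z = G z) -> smooth n F -> smooth n G.
Proof.
elim: n F G => [//|n IH] F G FG sF; have [h1 h2] := sF; split=> [i w hw|i].
  by have [l hl] := h1 i w hw; exists l; exact: pderiv_ext hl.
by apply: IH (h2 i) => z hz; exact: partial_ext sF FG hz.
Qed.

Lemma smooth_mono n F : smooth n.+1 F -> smooth n F.
Proof.
elim: n F => [//|n IH] F [h1 h2]; split=> // i; exact: IH.
Qed.

Lemma smooth_add n F G : smooth n F -> smooth n G -> smooth n (fun z => F z + G z).
Proof.
elim: n F G => [//|n IH] F G sF sG; split=> [i w hw|i].
  by eexists; apply: pderiv_add (smooth_pderiv i sF hw) (smooth_pderiv i sG hw).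
apply: smooth_ext (IH _ _ (sF.2 i) (sG.2 i)) => z hz; apply/esym/pderiv_partial.
exact: pderiv_add (smooth_pderiv i sF hz) (smooth_pderiv i sG hz).
Qed.

Lemma partial_mul n F G i z : smooth n.+1 F -> smooth n.+1 G -> D z ->
  partial i F z * G z + F z * partial i G z = partial i (fun z => F z * G z) z.
Proof.
move=> sF sG hz; apply/esym/pderiv_partial.
exact: pderiv_mul (smooth_pderiv i sF hz) (smooth_pderiv i sG hz).
Qed.

Lemma smooth_mul n F G : smooth n F -> smooth n G -> smooth n (fun z => F z * G z).
Proof.
elim: n F G => [//|n IH] F G sF sG; split=> [i w hw|i].
  by eexists; apply: pderiv_mul (smooth_pderiv i sF hw) (smooth_pderiv i sG hw).
have h : smooth n (fun z => partial i F z * G z + F z * partial i G z).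
  exact: smooth_add (IH _ _ (sF.2 i) (smooth_mono sG)) (IH _ _ (smooth_mono sF) (sG.2 i)).
by apply: smooth_ext h => z hz; exact: (partial_mul i sF sG hz).
Qed.

Section Vanishing.
Variable E : set T.
Hypothesis ED : E `<=` D.
Local Notation van n F := (vanishes_to_order n E F).

Lemma vanishesS n F :
  van n.+1 F <-> (forall z, E z -> F z = 0) /\ forall i, van n (partial i F).
Proof.
split=> [h|[h1 h2] s]; first split=> [z hz|i s hs z hz]; first exact: (h [::]).
  by have := h (rcons s i); rewrite size_rcons foldr_rcons; apply.
(* In [foldr] the last index of s is differentiated first, so s is split at its right end. *)
case/lastP: s => [_ z hz|s i]; first exact: h1.
by rewrite size_rcons foldr_rcons; exact: h2.
Qed.

Lemma vanishes_ext n F G : (forall z, D z -> F z = G z) -> smooth n F ->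
  van n F -> van n G.
Proof.
elim: n F G => [//|n IH] F G FG sF /vanishesS[h1 h2]; apply/vanishesS; split.
  by move=> z hz; rewrite -FG ?h1//; exact: ED.
move=> i; apply: IH (sF.2 i) (h2 i) => z hz; exact: partial_ext sF FG hz.
Qed.

Lemma vanishes_mono n F : van n.+1 F -> van n F.
Proof. by move=> h s hs; apply: h; exact: ltnW. Qed.

Lemma vanishes_add n F G : smooth n F -> smooth n G -> van n F -> van n G ->
  van n (fun z => F z + G z).
Proof.
elim: n F G => [//|n IH] F G sF sG /vanishesS[f1 f2] /vanishesS[g1 g2].
apply/vanishesS; split=> [z hz|i]; first by rewrite f1// g1// addr0.
have h := IH _ _ (sF.2 i) (sG.2 i) (f2 i) (g2 i).
apply: vanishes_ext (smooth_add (sF.2 i) (sG.2 i)) h => z hz.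
by apply/esym/pderiv_partial; exact: pderiv_add (smooth_pderiv i sF hz) (smooth_pderiv i sG hz).
Qed.

Lemma vanishes_mul n F G : smooth n F -> smooth n G -> van n F ->
  van n (fun z => F z * G z).
Proof.
elim: n F G => [//|n IH] F G sF sG vF; have /vanishesS[f1 f2] := vF.
apply/vanishesS; split=> [z hz|i]; first by rewrite f1// mul0r.
have mF := smooth_mono sF; have mG := smooth_mono sG.
have s1 := smooth_mul (sF.2 i) mG; have s2 := smooth_mul mF (sG.2 i).
have h := vanishes_add s1 s2 (IH _ _ (sF.2 i) mG (f2 i))
            (IH _ _ mF (sG.2 i) (vanishes_mono vF)).
by apply: vanishes_ext (smooth_add s1 s2) h => z hz; exact: (partial_mul i sF sG hz).
Qed.

Variables (g dg : 'I_m -> C -> C).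
Let phi z : T := \row_j g j (z 0 j).
Hypothesis gD : forall z, D z -> D (phi z).
Hypothesis gE : forall z, E z -> E (phi z).
Hypothesis gd : forall j z, D z -> cderiv (g j) (z 0 j) (dg j (z 0 j)).
Hypothesis dg_smooth : forall n j, smooth n (fun z => dg j (z 0 j)).

(** A coordinatewise map sends a line parallel to e_i into a line parallel to e_i, so the
    one-variable chain rule applies. *)
Lemma pderiv_comp i F z l : D z -> pderiv i F (phi z) l ->
  pderiv i (fun z => F (phi z)) z (l * dg i (z 0 i)).
Proof.
move=> hz hF; rewrite /pderiv.
pose u t := g i (z 0 i + t) - g i (z 0 i).
have e t : phi (t *: 'e_i + z) = u t *: 'e_i + phi z.
  apply/rowP => j; rewrite !mxE eqxx /=; case: eqP => [->|_].
    by rewrite !mulr1 /u subrK (addrC t).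
  by rewrite !mulr0 !add0r.
have -> : (fun t => F (phi (t *: 'e_i + z))) = (fun t => F (u t *: 'e_i + phi z)).
  by apply/funext => t; rewrite e.
have hu : cderiv u 0 (dg i (z 0 i)).
  move=> eps /(gd i hz)[d d0 hd]; exists d => // h /hd.
  by rewrite /u add0r addr0 subrr subr0.
apply: (cderiv_along_comp hu (G := fun s : C => F (s *: 'e_i + phi z))).
by rewrite /u addr0 subrr.
Qed.

Lemma partial_comp n i F z : smooth n.+1 F -> D z ->
  partial i F (phi z) * dg i (z 0 i) = partial i (fun z => F (phi z)) z.
Proof.
move=> sF hz; apply/esym/pderiv_partial/pderiv_comp => //.
exact: smooth_pderiv sF (gD hz).
Qed.

Lemma smooth_comp n F : smooth n F -> smooth n (fun z => F (phi z)).
Proof.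
elim: n F => [//|n IH] F sF; split=> [i w hw|i].
  by eexists; apply: (pderiv_comp hw); exact: smooth_pderiv sF (gD hw).
by apply: smooth_ext (smooth_mul (IH _ (sF.2 i)) (@dg_smooth n i)) => z hz;
  exact: (partial_comp i sF hz).
Qed.

Lemma vanishes_comp n F : smooth n F -> van n F -> van n (fun z => F (phi z)).
Proof.
elim: n F => [//|n IH] F sF /vanishesS[f1 f2]; apply/vanishesS; split=> [z hz|i].
  by rewrite f1//; exact: gE.
have s := smooth_comp (sF.2 i).
apply: vanishes_ext (smooth_mul s (@dg_smooth n i))
  (vanishes_mul s (@dg_smooth n i) (IH _ (sF.2 i) (f2 i))) => z hz.
exact: (partial_comp i sF hz).
Qed.

End Vanishing.
End PartialDerivatives.

(** * Norm-convergent power series of a bounded operator *)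

Section GeometricSeries.
Variables (R : realType) (V : lmodType R[i]) (ip : {dot V for conjC}).
Hypothesis hc : hilbert_complete ip.
Local Notation C := (R[i]).
Local Notation nr := (nr ip).
Implicit Types (x y g : V) (N : V -> V).

Lemma sum_geometric_le (r : R) k n : 0 <= r -> r <= 2^-1 ->
  \sum_(k <= p < n) r ^+ p <= 2 * r ^+ k.
Proof.
move=> r0 r1; have [kn|nk] := leqP k n; last first.
  by rewrite big_geq ?(ltnW nk)// mulr_ge0// exprn_ge0.
suff h : \sum_(k <= p < n) r ^+ p <= 2 * (r ^+ k - r ^+ n).
  by apply: le_trans h _; rewrite ler_pM2l// gerBl exprn_ge0.
elim: n kn => [|n IH]; first by rewrite leqn0 => /eqP ->; rewrite big_geq// subrr mulr0.
rewrite leq_eqVlt => /predU1P[->|kn]; first by rewrite big_geq// subrr mulr0.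
rewrite big_nat_recr//=; apply: le_trans (lerD (IH kn) (lexx _)) _.
have : r ^+ n.+1 <= 2^-1 * r ^+ n by rewrite exprS ler_wpM2r ?exprn_ge0.
by move=> h; clear -h; lra.
Qed.

Lemma exists_half_power (c eps : R) : 0 <= c -> 0 < eps ->
  exists n, c * 2^-1 ^+ n <= eps.
Proof.
move=> c0 e0.
have h2 : 0 <= 2^-1 :> R by rewrite invr_ge0.
have [|n|n _|n hn] := @ratio_lim0 R (fun n => c * (2^-1) ^+ n) 2^-1 0 h2 _ _ _ eps e0.
- by rewrite invf_lt1// ltr1n.
- by rewrite mulr_ge0// exprn_ge0.
- by rewrite exprS mulrCA.
- by exists n; exact: hn.
Qed.

(* The vector is the sum of b_p s^p N^p x. *)
Lemma power_series_vector N x (B c : R) (b : nat -> R) (s : C) :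
  linear N -> (forall y, nr (N y) <= B * nr y) -> 0 <= B -> 0 <= c ->
  b 0%N = 1 -> (forall p, 0 <= b p <= c ^+ p) -> c * B * normc s <= 2^-1 ->
  exists y, (forall g, clim (fun n => \sum_(p < n) (b p)%:C * s ^+ p * ip (iter p N x) g)
                         (ip y g)) /\
    nr (y - x - (b 1%N)%:C * s *: N x) <= 2 * nr x * (c * B) ^+ 2 * normc s ^+ 2.
Proof.
move=> lN hN B0 c0 b0 hb hs.
set r := c * B * normc s in hs.
have r0 : 0 <= r by rewrite !mulr_ge0 ?normc_ge0.
have nN p : nr (iter p N x) <= B ^+ p * nr x.
  elim: p => [|p IH]; first by rewrite expr0 mul1r.
  by apply: le_trans (hN _) _; rewrite exprS -mulrA ler_wpM2l.
pose t p := ((b p)%:C * s ^+ p) *: iter p N x.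
have nt p : nr (t p) <= r ^+ p * nr x.
  rewrite /t nrZ normcM normc_real normcX; have /andP[b1 b2] := hb p.
  rewrite (ger0_norm b1) /r !exprMn.
  apply: le_trans (ler_wpM2l _ (nN p)) _; first by rewrite mulr_ge0// exprn_ge0// normc_ge0.
  rewrite -!mulrA [leRHS](_ : _ = c ^+ p * (normc s ^+ p * (B ^+ p * nr x))); last by ring.
  by rewrite ler_wpM2r// !mulr_ge0 ?exprn_ge0 ?normc_ge0 ?nr_ge0.
pose y n := \sum_(p < n) t p.
have yd k n : (k <= n)%N -> nr (y n - y k) <= 2 * r ^+ k * nr x.
  move=> kn; have -> : y n - y k = \sum_(k <= p < n) t p.
    rewrite /y -(big_mkord xpredT t) -(big_mkord xpredT t) (@big_cat_nat _ _ _ k)//=.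
    by rewrite addrAC subrr add0r.
  apply: (@le_trans _ _ (\sum_(k <= p < n) r ^+ p * nr x)).
    elim/big_rec2: _ => [|p a v _ h]; first by rewrite nr0.
    by apply: le_trans (nrD _ _ _) _; rewrite lerD.
  by rewrite -mulr_suml ler_wpM2r ?nr_ge0// sum_geometric_le.
have [eps e0|l hl] := nr_complete hc (u := y).
  have c1 : 0 <= 4 * nr x by rewrite mulr_ge0 ?nr_ge0.
  have [k hk] := exists_half_power c1 e0; exists k => p q hp hq.
  apply: le_trans (nr_triangle ip _ (y k) _) _; rewrite (nrBC ip (y k)).
  have rk : r ^+ k <= 2^-1 ^+ k by rewrite lerXn2r ?nnegrE// invr_ge0.
  have := ler_wpM2r (nr_ge0 ip x) rk.
  have := yd _ _ hp; have := yd _ _ hq; clear -hk; lra.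
exists l; split=> [g|].
  have := nr_lim_ip g hl; congr clim; apply/funext => n.
  by rewrite /y ip_suml; apply: eq_bigr => p _; rewrite ipZl.
(* The first two terms of the series are exactly those subtracted in the claim, so the tail estimate
   from index 2 gives an error of second order in s. *)
have y2 : y 2 = x + (b 1%N)%:C * s *: N x.
  by rewrite /y !big_ord_recl big_ord0 /t /= b0 expr0 mulr1 scale1r expr1 addr0.
rewrite -addrA -opprD -y2.
have -> : 2 * nr x * (c * B) ^+ 2 * normc s ^+ 2 = 2 * r ^+ 2 * nr x.
  by rewrite /r [in RHS]exprMn; ring.
apply/ler_addgt0Pr => eps e0; have [n hn] := hl _ e0.
apply: le_trans (nr_triangle ip _ (y (maxn n 2)) _) _; rewrite (nrBC ip l) addrC.
by apply: lerD; [apply: yd; exact: leq_maxr|apply: hn; exact: leq_maxl].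
Qed.

End GeometricSeries.

(** * Differentiability of the functions of the space through their kernel vectors *)

Section BergmanSmoothness.
Variables (R : realType) (m : nat) (alpha : 'I_m -> R).
Hypothesis alpha0 : forall j, 0 < alpha j.
Variables (H : lmodType R[i]) (ip : {dot H for conjC}).
Variable ev : H -> 'rV[R[i]]_m -> R[i].
Hypothesis hH : reproducing_kernel_space (polydisc m) (bergman_kernel alpha) ip ev.
Local Notation C := (R[i]).
Local Notation T := 'rV[R[i]]_m.
Local Notation nr := (nr ip).
Local Notation D := (polydisc m).
Local Notation K := (bergman_kernel alpha).
Local Notation kf := (kf D K ip ev).
Local Notation multiplier := (multiplier D ip ev).
Implicit Types (z w : T) (f : H) (i j : 'I_m) (beta : 'I_m -> R) (X : H -> H).

(* Differentiating ip f (K_w) in w_i raises the exponent beta_i by one, up to a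
   multiplication by z_i. The functions ip f (X K^beta_w), with X bounded, are
   therefore closed under partial derivatives. *)
Definition kernel_at beta w f := forall z, D z -> ev f z = bergman_kernel beta z w.

(** Kernels with other exponents are only needed as functions inside the given space. Starting from
    alpha, raising an exponent stays inside, because it multiplies K_w by (1 - conj w_i z_i)^-1. *)
Definition admissible beta := (forall j, 0 < beta j) /\ forall w, D w -> exists f, kernel_at beta w f.

Definition kernel_vector beta w : H := xget 0 (kernel_at beta w).

Lemma kernel_vectorP beta w z : admissible beta -> D w -> D z -> ev (kernel_vector beta w) z = bergman_kernel beta z w.
Proof. by move=> [_ h] /h[f hf]; rewrite /kernel_vector; case: xgetP => [_ -> |/(_ f)//]; exact. Qed.

Lemma kernel_vector_unique beta w f : admissible beta -> D w -> kernel_at beta w f -> f = kernel_vector beta w.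
Proof. by move=> hb hw hf; apply: (rk_inj hH) => z hz; rewrite hf// kernel_vectorP. Qed.

Lemma admissible_alpha : admissible alpha.
Proof. by split=> // w hw; exists (kf w) => z hz; exact: (ev_kf hH). Qed.

Definition incr_at i beta j : R := beta j + (j == i)%:R.

Lemma bergman_kernel_incr i beta z w : D z -> D w ->
  bergman_kernel (incr_at i beta) z w =
  (1 - conjC (w 0 i) * z 0 i)^-1 * bergman_kernel beta z w.
Proof.
move=> hz hw; rewrite /bergman_kernel (bigD1 i)//= [in RHS](bigD1 i)//= mulrA.
have hR := polydisc_Re i hz hw.
congr (_ * _); last by apply: eq_bigr => j ji; rewrite /incr_at (negbTE ji) addr0.
have -> : - incr_at i beta i = -1 - beta i by rewrite /incr_at eqxx mulr1n opprD addrC.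
by rewrite (cpowD _ _ hR) (cpowN 1 hR) (cpow_pow1 hR) [in RHS](mulrC (conjC _)).
Qed.

Lemma admissible_incr i beta : admissible beta -> admissible (incr_at i beta).
Proof.
move=> gb; split=> [j|w hw]; first by rewrite /incr_at ltr_wpDr ?ler0n ?gb.1.
have /polydiscE hw1 := hw; have [X [hX _]] := inverse_multiplier alpha0 hH i (hw1 i).
by exists (X (kernel_vector beta w)) => z hz; rewrite hX// kernel_vectorP// bergman_kernel_incr.
Qed.

(** Factor 1 - z_i conj (t + w_i) as (1 - conj t zeta) (1 - z_i conj w_i) with zeta = z_i / (1 -
    conj w_i z_i). A shift of w thereby becomes a binomial series in the multiplier zeta. *)
Lemma bergman_kernel_shift i beta z w (t : C) : D z -> D w -> D (t *: 'e_i + w) ->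
  normc (conjC t * (z 0 i / (1 - conjC (w 0 i) * z 0 i))) < 1 ->
  bergman_kernel beta z (t *: 'e_i + w) =
  cpow (1 - conjC t * (z 0 i / (1 - conjC (w 0 i) * z 0 i))) (- beta i) *
  bergman_kernel beta z w.
Proof.
move=> hz hw ht small; rewrite /bergman_kernel (bigD1 i)//= [in RHS](bigD1 i)//= mulrA.
have hR := polydisc_Re i hz hw; have hR' := polydisc_Re i hz ht.
congr (_ * _); last by apply: eq_bigr => j ji; rewrite shiftE (negbTE ji).
rewrite shiftE eqxx in hR' *.
have h0 : 1 - z 0 i * conjC (w 0 i) != 0 by rewrite -normc_gt0 Re_gt0_neq0.
have e : 1 - z 0 i * conjC (t + w 0 i) =
   (1 - conjC t * (z 0 i / (1 - conjC (w 0 i) * z 0 i))) * (1 - z 0 i * conjC (w 0 i)).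
  by rewrite rmorphD/= (mulrC (conjC (w 0 i)) (z 0 i)); field.
rewrite e in hR' *; rewrite -cpow_mul//; exact: Re_1sub_gt0.
Qed.

Lemma bincoef1 (b : R) : bincoef b 1 = b.
Proof. by have := bincoefS b 0; rewrite mul1r bincoef0 addr0 mulr1. Qed.

Lemma quotient_multiplier i w : D w ->
  exists N, multiplier (fun z => z 0 i / (1 - conjC (w 0 i) * z 0 i)) N.
Proof.
move=> /polydiscE hw; have [M hM] := coord_multiplier alpha0 hH i.
have [X hX] := inverse_multiplier alpha0 hH i (hw i).
by exists (fun f => M (X f)); exact: (multiplier_comp hM hX).
Qed.

(** The shifted kernel vector is (1 - conj t N)^(- beta_i) applied to the old one, expanded by the
    binomial series; the estimate is that of the series without its first two terms. *)
Lemma kernel_vector_expansion i beta w N : admissible beta -> D w ->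
  multiplier (fun z => z 0 i / (1 - conjC (w 0 i) * z 0 i)) N ->
  exists r A : R, [/\ 0 < r, 0 <= A & forall t : C, normc t < r ->
    nr (kernel_vector beta (t *: 'e_i + w) - kernel_vector beta w - (beta i)%:C * conjC t *: N (kernel_vector beta w)) <=
      A * normc t ^+ 2].
Proof.
move=> gb hw [hN [lN [B B0 bN]]].
have [r0 r00 hr0] := polydisc_shift i hw.
(* By [bincoef_le] the powers of c dominate the binomial coefficients. *)
set c := Num.max 1 (beta i); have c0 : 0 <= c by rewrite le_max ler01.
have w0 : 0 < 1 - normc (w 0 i) by have /polydiscE/(_ i) := hw; rewrite subr_gt0.
have cB : 0 <= c * B by exact: mulr_ge0.
have d0 : 0 < 2 * (c * B + 1) by rewrite mulr_gt0// ltr_wpDl.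
(* The three radii keep the shifted point in the polydisc, ensure |conj t zeta| < 1, and make the
   ratio of the geometric majorant at most 1/2. *)
exists (Num.min r0 (Num.min (1 - normc (w 0 i)) (2 * (c * B + 1))^-1)),
  (2 * nr (kernel_vector beta w) * (c * B) ^+ 2).
split; first by rewrite !lt_min r00 w0 invr_gt0.
  by rewrite !mulr_ge0 ?nr_ge0 ?sqr_ge0.
move=> t; rewrite !lt_min => /andP[t1 /andP[t2 t3]].
have ht : D (t *: 'e_i + w) by exact: hr0.
have hs : c * B * normc (conjC t) <= 2^-1.
  rewrite normcJ; move: t3; rewrite -[_^-1]mul1r ltr_pdivlMr// => t3.
  by have := normc_ge0 t; have := mulr_ge0 cB (normc_ge0 t); lra.
have hb p : 0 <= bincoef (beta i) p <= c ^+ p.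
  by rewrite ltW ?bincoef_gt0 ?gb.1//= bincoef_le// gb.1.
have [y [hy1 hy2]] := power_series_vector (rk_complete hH) (kernel_vector beta w) lN bN B0 c0
  (bincoef0 _) hb hs.
rewrite -[X in nr (X - _ - _)](_ : y = _); last first.
  apply: kernel_vector_unique => // z hz.
  set zeta := z 0 i / (1 - conjC (w 0 i) * z 0 i).
  have /polydiscE/(_ i) hzi := hz.
  have small : normc (conjC t * zeta) < 1.
    have k1 : normc zeta * (1 - normc (w 0 i)) <= 1.
      rewrite /zeta normcM normcV.
      have k2 : 1 - normc (w 0 i) <= normc (1 - conjC (w 0 i) * z 0 i).
        apply: le_trans (normc_subr _ _); rewrite normc1 normcM normcJ lerD2l lerN2.
        by rewrite ler_piMr ?normc_ge0// ltW.
      have k3 := lt_le_trans w0 k2.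
      rewrite mulrAC ler_pdivrMr// mul1r; apply: le_trans k2.
      by rewrite ler_piMl ?(ltW w0)// ltW.
    have [->|z0] := eqVneq zeta 0; first by rewrite mulr0 normc0 ltr01.
    rewrite normcM normcJ; apply: lt_le_trans k1.
    by rewrite mulrC ltr_pM2l// normc_gt0.
  rewrite (bergman_kernel_shift beta hz hw ht small) -kernel_vectorP// !(ev_ip hH)//.
  have h2 := clim_scale (ip (kernel_vector beta w) (kf z)) (binsum_clim (gb.1 i) small).
  rewrite [RHS]mulrC; apply: clim_unique (hy1 (kf z)) _.
  move: h2; congr clim; apply/funext => n; rewrite /binsum mulr_sumr; apply: eq_bigr => p _.
  have -> : ip (iter p N (kernel_vector beta w)) (kf z) = zeta ^+ p * ip (kernel_vector beta w) (kf z).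
    elim: (nat_of_ord p) => [|q IH]; first by rewrite mul1r.
    by rewrite /= -(ev_ip hH)// hN// (ev_ip hH)// IH exprS mulrA.
  by rewrite exprMn; ring.
by move: hy2; rewrite bincoef1 normcJ.
Qed.

Definition kernel_pairing f beta X w := ip f (X (kernel_vector beta w)).

(** The kernel vector has first-order term beta_i conj t N K_w, and the pairing is conjugate linear
    in its second argument, so the dependence on t is holomorphic. Moreover N K_w is z_i times the
    kernel vector with beta_i raised by one. *)
Lemma pderiv_kernel_pairing f beta X i M w : admissible beta -> nr_bounded ip X ->
  multiplier (fun z => z 0 i) M -> D w ->
  pderiv i (kernel_pairing f beta X) w
    (kernel_pairing f (incr_at i beta) (fun g => (beta i)%:C *: X (M g)) w).
Proof.
move=> gb [lX [B B0 bX]] hM hw; have [N hN] := quotient_multiplier i hw.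
have [_ _ XB XZ] := linear_lin lX.
have [r [A [r0 A0 hA]]] := kernel_vector_expansion gb hw hN.
have eN : N (kernel_vector beta w) = M (kernel_vector (incr_at i beta) w).
  apply: (rk_inj hH) => z hz; have gi := admissible_incr i gb.
  by rewrite hN.1// hM.1// !kernel_vectorP// bergman_kernel_incr// mulrA.
rewrite /kernel_pairing ipZr conjC_realE -eN => eps e0.
set L := nr f * (B * A); have L0 : 0 <= L by rewrite !mulr_ge0 ?nr_ge0.
exists (Num.min r (eps / (L + 1))) => [|t].
  by rewrite lt_min r0 divr_gt0// ltr_wpDl.
rewrite lt_min => /andP[/hA h1]; rewrite ltr_pdivlMr ?ltr_wpDl// => h2.
rewrite add0r shift0.
set y := kernel_vector beta _ - _ - _ in h1.
have -> : ip f (X (kernel_vector beta (t *: 'e_i + w))) - ip f (X (kernel_vector beta w)) -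
    t * ((beta i)%:C * ip f (X (N (kernel_vector beta w)))) = ip f (X y).
  by rewrite /y !XB XZ !ipBr ipZr rmorphM/= conjC_realE conjCK; ring.
apply: le_trans (cauchy_schwarz _ _ _) _.
apply: (@le_trans _ _ (L * normc t * normc t)).
  rewrite -!mulrA -expr2 ler_wpM2l ?nr_ge0//.
  by apply: le_trans (bX _) _; rewrite ler_wpM2l.
rewrite ler_wpM2r ?normc_ge0//; apply: le_trans (ltW h2).
by rewrite mulrC ler_wpM2l ?normc_ge0// lerDl.
Qed.

Lemma pairing_bounded (beta : 'I_m -> R) i X M : nr_bounded ip X ->
  multiplier (fun z => z 0 i) M -> nr_bounded ip (fun g => (beta i)%:C *: X (M g)).
Proof. by move=> bX [_ bM]; apply: nr_bounded_scale; exact: nr_bounded_comp. Qed.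

Lemma smooth_kernel_pairing n F f beta X : admissible beta -> nr_bounded ip X ->
  (forall w, D w -> kernel_pairing f beta X w = F w) -> smooth n F.
Proof.
elim: n F beta X => [//|n IH] F beta X gb bX FE.
have h i M w : multiplier (fun z => z 0 i) M -> D w -> pderiv i F w
    (kernel_pairing f (incr_at i beta) (fun g => (beta i)%:C *: X (M g)) w).
  by move=> hM hw; apply: (pderiv_ext hw FE); exact: pderiv_kernel_pairing.
split=> [i w hw|i]; have [M hM] := coord_multiplier alpha0 hH i.
  by eexists; exact: h hM hw.
apply: IH (admissible_incr i gb) (pairing_bounded beta bX hM) _ => w hw.
by apply/esym/pderiv_partial; exact: h.
Qed.

Lemma ev_kernel_pairing f w : D w -> kernel_pairing f alpha id w = ev f w.
Proof.
move=> hw; rewrite (ev_ip hH)//; congr (ip f _); apply/esym/kernel_vector_unique => //.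
  exact: admissible_alpha.
by move=> z hz; exact: (ev_kf hH).
Qed.

Lemma smooth_ev n f : smooth n (ev f).
Proof.
apply: smooth_kernel_pairing admissible_alpha (nr_bounded_id ip) _.
exact: ev_kernel_pairing.
Qed.

Lemma iterated_partial_ip (s : seq 'I_m) w : D w ->
  exists q, forall f, foldr (@partial R m) (ev f) s w = ip f q.
Proof.
move=> hw; suff [beta [X [_ _ h]]] : exists beta X, [/\ admissible beta, nr_bounded ip X &
    forall f z, D z -> foldr (@partial R m) (ev f) s z = kernel_pairing f beta X z].
  by exists (X (kernel_vector beta w)) => f; exact: h.
elim: s => [|i s [beta [X [gb bX h]]]].
  exists alpha, id; split; [exact: admissible_alpha|exact: nr_bounded_id|].
  by move=> f z hz; rewrite ev_kernel_pairing.
have [M hM] := coord_multiplier alpha0 hH i.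
exists (incr_at i beta), (fun g => (beta i)%:C *: X (M g)); split.
- exact: admissible_incr.
- exact: pairing_bounded.
move=> f z hz; apply: pderiv_partial.
apply: (pderiv_ext hz (F := kernel_pairing f beta X)) => [w' hw'|].
  by apply/esym; exact: (h f w' hw').
exact: pderiv_kernel_pairing.
Qed.

End BergmanSmoothness.

(** * Compression to the quotient *)

Section Compression.
Variables (R : realType) (V : lmodType R[i]) (ip : {dot V for conjC}) (S : set V).
Local Notation Q := (orthc ip S).
Variable P : V -> Q.
Hypothesis hP : orthogonal_projection P.
(** Closedness of S in the form in which it is used: S contains its double orthogonal complement. *)
Hypothesis S_closed : forall y, (forall q : Q, ip y (val q) = 0) -> S y.
Implicit Types (X Y U : V -> V) (q : Q).

Definition compression X q : Q := P (X (val q)).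

Definition stable X := forall y, S y -> S (X y).

Lemma proj_eq0 y : S y -> P y = 0.
Proof.
move=> Sy; apply: orthc_ext => r; rewrite -(proj_ip hP) raddf0 ip0l.
by rewrite -ipJ orthcP// rmorph0.
Qed.

(** The difference f - P f lies in S, X keeps it there, and P annihilates S. Hence P X P = P X,
    which makes compression multiplicative. *)
Lemma proj_stable X f : linear X -> stable X -> P (X (val (P f))) = P (X f).
Proof.
move=> lX sX; have [_ _ XB _] := linear_lin lX.
have /sX/proj_eq0 : S (f - val (P f)) by apply: S_closed => q; exact: hP.
rewrite XB -scaleN1r addrC (proj_linear hP) scaleN1r => /eqP.
by rewrite addrC subr_eq0 => /eqP.
Qed.

Lemma compression_id q : compression id q = q.
Proof. exact: projK. Qed.

Lemma compression_comp X Y q : linear X -> stable X ->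
  compression X (compression Y q) = compression (fun f => X (Y f)) q.
Proof. exact: proj_stable. Qed.

Lemma compression_scale a X q : a *: compression X q = compression (fun f => a *: X f) q.
Proof.
have P0 : P 0 = 0 by apply/proj_eq0/S_closed => r; exact: ip0l.
by rewrite /compression -[a *: X _]addr0 (proj_linear hP) P0 addr0.
Qed.

Lemma compression_sub a X b Y q :
  a *: compression X q - b *: compression Y q =
  compression (fun f => a *: X f - b *: Y f) q.
Proof.
rewrite [RHS]/compression (proj_linear hP); congr (_ + _).
by have := compression_scale (- b) Y q; rewrite /compression !scaleNr => ->.
Qed.

Lemma compression_ext X Y q : (forall f, X f = Y f) -> compression X q = compression Y q.
Proof. by rewrite /compression => ->. Qed.

Lemma compression_bounded X : nr_bounded ip X ->
  nr_bounded (orth_dot ip S) (compression X).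
Proof.
move=> [lX [B B0 hB]]; split=> [a q r|].
  by rewrite /compression linearP lX (proj_linear hP).
exists B => // q; apply: le_trans (hB (val q)).
exact: (proj_nr hP (X (val q))).
Qed.

Lemma compression_resolvent X Y z : nr_bounded ip X -> stable X ->
  nr_bounded ip Y -> stable Y ->
  (forall f, z *: Y f - X (Y f) = f) -> (forall f, Y (z *: f - X f) = f) ->
  is_resolvent (orth_dot ip S) (compression X) z (compression Y).
Proof.
move=> bX sX bY sY h1 h2; split=> [|q|q].
- by apply/bounded_operatorP; exact: compression_bounded.
- have := compression_sub z Y 1 (fun f => X (Y f)) q; rewrite scale1r => e.
  rewrite (compression_comp Y q bX.1 sX); apply: etrans e _.
  by rewrite -[RHS]compression_id; apply: compression_ext => f; rewrite scale1r h1.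
- have := compression_sub z id 1 X q; rewrite compression_id scale1r => e.
  apply: etrans (congr1 _ e) _; rewrite (compression_comp _ q bY.1 sY) -[RHS]compression_id.
  by apply: compression_ext => f; rewrite scale1r h2.
Qed.

(** U' is the adjoint of U, and U preserves S, so U' preserves the orthogonal complement: its
    compression is its restriction. *)
Lemma compression_unitary U U' : linear U -> linear U' ->
  (forall f, nr ip (U f) = nr ip f) -> (forall f, U (U' f) = f) ->
  (forall f, U' (U f) = f) -> stable U -> stable U' ->
  unitary (orth_dot ip S) (compression U').
Proof.
move=> lU lU' iU UU' U'U sU sU'; have pU := polarization lU iU.
have iU' f : nr ip (U' f) = nr ip f by rewrite -{2}[f]UU' iU.
have vU q : val (compression U' q) = U' (val q).
  have hq : orth_pred ip S (U' (val q)).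
    by apply/asboolP => y Sy; rewrite -pU UU' orthcP//; exact: sU.
  have -> : compression U' q = Orthc hq by rewrite -(projK hP (Orthc hq)).
  by [].
split=> [a q r|q|q r].
- by rewrite /compression linearP lU' (proj_linear hP).
- exists (compression U q); rewrite compression_comp//.
  by rewrite -[RHS]compression_id; exact: compression_ext.
- have := polarization lU' iU' (val q) (val r).
  by rewrite -!vU.
Qed.

End Compression.

(** * The quotient by the functions vanishing along the diagonal *)

Section QuotientModule.
Variables (R : realType) (m d k : nat) (alpha : 'I_m -> R).
Hypothesis hd : (0 < d <= m)%N.
Hypothesis alpha0 : forall j, 0 < alpha j.
Variables (H : lmodType R[i]) (ip : {dot H for conjC}).
Variable ev : H -> 'rV[R[i]]_m -> R[i].
Hypothesis hH : reproducing_kernel_space (polydisc m) (bergman_kernel alpha) ip ev.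
Local Notation C := (R[i]).
Local Notation T := 'rV[R[i]]_m.
Local Notation D := (polydisc m).
Local Notation E := (@Defs.diagonal R m d).
Local Notation K := (bergman_kernel alpha).
Local Notation kf := (kf D K ip ev).
Local Notation multiplier := (multiplier D ip ev).
Local Notation S := [set f : H | vanishes_to_order k E (ev f)].
Local Notation Q := (quotient_space d k ip ev).
Implicit Types (z w : T) (f : H) (i : 'I_m) (j : 'I_(m - d + 1)) (X : H -> H).

Lemma diagonal_polydisc : E `<=` D.
Proof. by move=> z []. Qed.

(* Partial derivatives at a point are bounded functionals, so the functions
   vanishing to order k form a closed subspace. *)
Lemma vanishing_closed f : (forall q : Q, ip f (val q) = 0) -> S f.
Proof.
move=> h s hs z hz; have hD := diagonal_polydisc hz.
have [q hq] := iterated_partial_ip alpha0 hH s hD.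
have hin : orth_pred ip S q.
  by apply/asboolP => y Sy; rewrite -ipJ -hq (Sy s hs z hz) rmorph0.
by rewrite hq; exact: (h (Orthc hin)).
Qed.

Lemma one_member : exists f1, forall z, D z -> ev f1 z = 1.
Proof.
have h0 : D (0 : T) by apply/polydiscE => j; rewrite mxE normc0.
exists (kf 0) => z hz; rewrite (ev_kf hH)// /bergman_kernel big1// => j _.
by rewrite mxE rmorph0 mulr0 subr0 cpow1.
Qed.

(** The constant 1 is the kernel function at the origin, so a multiplier psi = X 1 is itself a
    function of the space and inherits smoothness from [smooth_ev]. *)
Lemma smooth_multiplier n psi X : multiplier psi X -> smooth n psi.
Proof.
move=> [hX _]; have [f1 h1] := one_member.
apply: smooth_ext (smooth_ev alpha0 hH n (X f1)) => z hz.
by rewrite hX// h1// mulr1.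
Qed.

(** Vanishing passes to f o phi by the chain rule, since phi maps the diagonal into itself, and to
    the product with the smooth weight psi = X 1 by the Leibniz rule. *)
Lemma wcop_stable (g dg : 'I_m -> C -> C) phi psi X :
  (forall z, phi z = \row_i g i (z 0 i)) ->
  (forall z, D z -> D (phi z)) -> (forall z, E z -> E (phi z)) ->
  (forall i z, D z -> cderiv (g i) (z 0 i) (dg i (z 0 i))) ->
  (forall n i, smooth n (fun z => dg i (z 0 i))) ->
  wcop D ev phi psi X -> stable S X.
Proof.
move=> phiE phiD phiEE gd sdg hX f Sf.
have {}phiE : phi = fun z => \row_i g i (z 0 i) by apply/funext.
rewrite phiE in phiD phiEE hX.
have [f1 h1] := one_member.
have psiE z : D z -> ev (X f1) z = psi z.
  by move=> hz; rewrite hX// h1 ?mulr1//; exact: phiD.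
have sf n := smooth_ev alpha0 hH n f; have s1 n := smooth_ev alpha0 hH n (X f1).
have sc := smooth_comp phiD gd sdg (sf k).
have vc := vanishes_comp diagonal_polydisc phiD phiEE gd sdg (sf k) Sf.
apply: (vanishes_ext diagonal_polydisc _ (smooth_mul sc (s1 k))
  (vanishes_mul diagonal_polydisc sc (s1 k) vc)) => z hz.
by rewrite psiE// hX// mulrC.
Qed.

Lemma multiplier_stable psi X : multiplier psi X -> stable S X.
Proof.
move=> [hX _]; apply: (wcop_stable (g := fun _ x => x) (dg := fun _ _ => 1) _ _ _ _ _ hX) => //.
- by move=> z; apply/rowP => i; rewrite mxE.
- by move=> i z _; exact: cderiv_id.
- by move=> n i; exact: smooth_multiplier (multiplier_id D ip ev).
Qed.

Lemma smooth_mob_deriv n (c a : C) i : normc a < 1 ->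
  smooth n (fun z => c * ((1 - a * conjC a) / (1 - conjC a * z 0 i) ^+ 2)).
Proof.
move=> a1; have [X hX] := inverse_multiplier alpha0 hH i a1.
have h := multiplier_scale hH (c * (1 - a * conjC a)) (multiplier_comp hX hX).
apply: smooth_multiplier (multiplier_ext _ h) => z _.
by rewrite -mulrA expr2 invfM.
Qed.

Fact diag_index_proof i : ((if (i < d)%N then 0 else i - d + 1) < m - d + 1)%N.
Proof.
case: (ltnP i d) => [_|di]; first by rewrite addn1.
by rewrite ltn_add2r ltn_sub2r// (leq_ltn_trans di).
Qed.

(** The parameter of the diagonal that governs z_i: the first d variables share the parameter 0, and
    so receive the same automorphism. *)
Definition diag_index i : 'I_(m - d + 1) := Ordinal (diag_index_proof i).

Lemma diag_indexK j : diag_index (diag_coord hd j) = j.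
Proof.
apply/val_inj; case/andP: hd => d0 dm; case: j => [[|j] hj] /=; first by rewrite d0.
by rewrite addnS /= ltnNge leq_addr /= addKn addn1.
Qed.

Lemma diag_index0 i i' : (i < d)%N -> (i' < d)%N -> diag_index i = diag_index i'.
Proof. by move=> h h'; apply/val_inj; rewrite /= h h'. Qed.

Section Mobius.
Variables (c a : 'I_(m - d + 1) -> C).
Hypothesis c1 : forall j, normc (c j) = 1.
Hypothesis a1 : forall j, normc (a j) < 1.

Let cm i := c (diag_index i).
Let am i := a (diag_index i).

Lemma diag_mobius_unitary : exists U U', [/\ linear U /\ linear U',
  (forall f, nr ip (U f) = nr ip f),
  (forall f, U (U' f) = f) /\ (forall f, U' (U f) = f),
  stable S U /\ stable S U' &
  (forall j M X, multiplier (fun z => z 0 (diag_coord hd j)) M ->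
     multiplier (fun z => c j * mob (a j) (z 0 (diag_coord hd j))) X ->
     forall f, U' (X f) = M (U' f))].
Proof.
have cm1 i : normc (cm i) = 1 by exact: c1.
have am1 i : normc (am i) < 1 by exact: a1.
have [U [U' [wU wU' lUU' iU UU']]] := mobius_unitary hH cm1 am1.
have pD := coord_mobD cm1 am1; have pD' := coord_mob_invD cm1 am1.
exists U, U'; split=> //.
  have e z i i' : E z -> (i < d)%N -> (i' < d)%N ->
      [/\ cm i = cm i', am i = am i' & z 0 i = z 0 i'].
    by move=> [_ hz] hi hi'; rewrite /cm /am (diag_index0 hi hi'); split=> //; exact: hz.
  split.
  - apply: (wcop_stable (g := fun i x => cm i * mob (am i) x)
      (dg := fun i x => cm i * ((1 - am i * conjC (am i)) / (1 - conjC (am i) * x) ^+ 2))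
      _ pD _ _ _ wU) => [z|z hz|i z /polydiscE hz|n i] //.
    + split=> [|i i' hi hi']; first exact/pD/diagonal_polydisc.
      by rewrite !mxE; have [-> -> ->] := e z i i' hz hi hi'.
    + by apply: cderiv_along_scale; apply: cderiv_mob; exact: mob_den.
    + exact: smooth_mob_deriv.
  - have cc i : conjC (cm i) * cm i = 1 by rewrite mulrC mulcJ cm1 expr1n.
    (* The inverse of c mob a is conj c mob (- c a); in this form the derivative formula used for
       the direct map applies again. *)
    pose b i := - (cm i * am i).
    have b1 i : normc (b i) < 1 by rewrite normcN normcM cm1 mul1r.
    apply: (wcop_stable (g := fun i x => conjC (cm i) * mob (b i) x)
      (dg := fun i x => conjC (cm i) * ((1 - b i * conjC (b i)) / (1 - conjC (b i) * x) ^+ 2))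
      _ pD' _ _ _ wU')
      => [z|z hz|i z /polydiscE hz|n i] //.
    + apply/rowP => i; rewrite !mxE /mob /b !rmorphN/= rmorphM/= opprK.
      have -> : conjC (cm i) * z 0 i + am i = conjC (cm i) * (z 0 i - - (cm i * am i)).
        by rewrite opprK mulrDr mulrA cc mul1r.
      by rewrite !mulNr !mulrA (mulrC (conjC (am i))).
    + split=> [|i i' hi hi']; first exact/pD'/diagonal_polydisc.
      by rewrite !mxE; have [-> -> ->] := e z i i' hz hi hi'.
    + by apply: cderiv_along_scale; apply: cderiv_mob; exact: mob_den.
    + exact: smooth_mob_deriv.
(* Both sides at z carry the weight of U' and the value of f at the preimage of z; the remaining
   factor on the left is the j-th automorphism at that preimage, which is the corresponding
   coordinate of z. *)
move=> j M X [hM _] [hX _] f; apply: (rk_inj hH) => z hz.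
have hz' := pD' z hz; rewrite wU'// hX// hM// wU'//.
have := coord_mobK cm1 am1 hz => /(congr1 (fun w : T => w 0 (diag_coord hd j))).
rewrite mxE /cm /am diag_indexK => ->.
by ring.
Qed.

End Mobius.
End QuotientModule.

Theorem corollary3p13 (R : realType) (m d k : nat) (hd : (0 < d <= m)%N)
    (alpha : 'I_m -> R) (halpha : forall j, 0 < alpha j)
    (H : lmodType R[i]) (ip : {dot H for conjC})
    (ev : H -> 'rV[R[i]]_m -> R[i])
    (hH : reproducing_kernel_space (polydisc m) (bergman_kernel alpha) ip ev) :
  exists (M : 'I_m -> H -> H) (P : H -> quotient_space d k ip ev),
    [/\ (forall i, bounded_operator ip (M i)),
        (forall i, multiplication_operator (polydisc m) ev i (M i)),
        orthogonal_projection P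
      & homogeneous (orth_dot ip _)
          (fun (j : 'I_(m - d + 1)) (x : quotient_space d k ip ev) =>
             P (M (diag_coord hd j) (val x)))].
Proof.
have /choice[M hM] := coord_multiplier halpha hH.
have [P hP] := projection_exists [set f : H | vanishes_to_order k (Defs.diagonal d) (ev f)]
  (rk_complete hH).
pose mult := multiplier (polydisc m) ip ev.
have Scl := @vanishing_closed R m d k alpha halpha H ip ev hH.
have stab psi X : mult psi X ->
    stable [set f : H | vanishes_to_order k (Defs.diagonal d) (ev f)] X.
  exact: (multiplier_stable halpha hH).
have bM i := (hM i).2.
have sM i := stab _ _ (hM i).
(* The value [id] for |l| <= 1 is a placeholder; it makes the family of multipliers total. *)
have /choice[X hX] (iz : 'I_m * R[i]) : exists X, 1 < normc iz.2 ->
    mult (fun z => (iz.2 - z 0 iz.1)^-1) X.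
  case: iz => i l /=; have [l1|l1] := boolP (1 < normc l); last by exists id.
  by have [X hX] := resolvent_multiplier halpha hH i l1; exists X.
have res i z : 1 < normc z ->
    is_resolvent (orth_dot ip _) (compression P (M i)) z (compression P (X (i, z))).
  move=> z1; have hXi := hX (i, z) z1; have lM := linear_lin (bM i).1.
  have [lX0 lXD lXB lXZ] := linear_lin hXi.2.1.
  have e f w : polydisc m w -> z * ((z - w 0 i)^-1 * ev f w) - w 0 i * ((z - w 0 i)^-1 * ev f w) = ev f w.
    move=> /polydiscE/(_ i) wi; field.
    by rewrite subr_eq0; apply: contraTneq z1 => ->; rewrite -leNgt ltW.
  apply: compression_resolvent => //; [exact: hXi.2|exact: stab hXi|move=> f|move=> f].
    apply: (rk_inj hH) => w hw.
    by rewrite (evB hH)// (evZ hH)// (hM i).1// hXi.1//= e.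
  apply: (rk_inj hH) => w hw.
  by rewrite hXi.1// (evB hH)// (evZ hH)// (hM i).1//= mulrBr mulrCA (mulrCA _^-1) e.
exists M, P; split=> //.
- by move=> i; apply/bounded_operatorP.
- by move=> i f z hz; rewrite (hM i).1.
have MC i Y q := compression_comp hP Scl Y q (bM i).1 (sM i).
have bT i : nr_bounded (orth_dot ip _) (compression P (M i)) by exact: compression_bounded.
have Tcomm i i' x : compression P (M i) (compression P (M i') x) =
    compression P (M i') (compression P (M i) x).
  rewrite !MC.
  apply: compression_ext => f; apply: (rk_inj hH) => z hz.
  by rewrite !(hM _).1//; ring.
split.
- by move=> j; apply/bounded_operatorP; exact: bT.
- by move=> i j x; exact: Tcomm.
(* If |lambda_j| > 1, invertibility of T_j - lambda_j alone makes the whole Koszul complex exact. *)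
- move=> lambda hl j; rewrite normr_normc (_ : 1 = 1%:C)// lecR leNgt; apply/negP => l1.
  move: hl; apply: (joint_spectrum_resolvent (ip := orth_dot ip _) _ _ (res _ _ l1)).
  + by move=> i; exact: (bT _).1.
  + by move=> i i' x; exact: Tcomm.
move=> g hg.
have /choice[ca hca] j : exists ca : R[i] * R[i], [/\ normc ca.1 = 1, normc ca.2 < 1 &
    forall z, normc z < 1 -> g j z = ca.1 * mob ca.2 z].
  by have [c [a h]] := mobius_form (hg j); exists (c, a).
have c1 j : normc (ca j).1 = 1 by have [] := hca j.
have a1 j : normc (ca j).2 < 1 by have [] := hca j.
have /choice[Y hY] j := inverse_multiplier halpha hH (diag_coord hd j) (a1 j).
have [U [U' [[lU lU'] iU [UU' U'U] [sU sU'] hU]]] :=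
  @diag_mobius_unitary R m d k alpha hd halpha H ip ev hH _ _ c1 a1.
(* Multiplication by g_j of the coordinate, factored as c (z - a) times (1 - conj a z)^-1 to match
   the shape of [holomorphic_calculus_mob]. *)
pose F j f := (ca j).1 *: (M (diag_coord hd j) (Y j f) - (ca j).2 *: Y j f).
have hF j : mult (fun z => (ca j).1 * mob (ca j).2 (z 0 (diag_coord hd j))) (F j).
  have h := multiplier_scale hH (ca j).1 (multiplier_add hH
    (multiplier_comp (hM (diag_coord hd j)) (hY j)) (multiplier_scale hH (- (ca j).2) (hY j))).
  have -> : F j = fun f => (ca j).1 *: (M (diag_coord hd j) (Y j f) + - (ca j).2 *: Y j f).
    by apply/funext => f; rewrite /F scaleNr.
  by apply: multiplier_ext h => z _; rewrite /mob; ring.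
(* The inverse U' is the right choice: it satisfies U' F_j = M_j U', the direction required of the
   unitary equivalence. *)
exists (fun j => compression P (F j)), (compression P U'); split.
- by move=> j; apply/bounded_operatorP/compression_bounded => //; exact: (hF j).2.
- move=> j; have [_ _ hgj] := hca j.
  have -> : compression P (F j) = fun x => (ca j).1 *:
     (compression P (M (diag_coord hd j)) (compression P (Y j) x) - (ca j).2 *: compression P (Y j) x).
    apply/funext => x; rewrite MC.
    have := compression_sub hP Scl 1 (fun f => M (diag_coord hd j) (Y j f)) (ca j).2 (Y j) x.
    rewrite scale1r => e; apply/esym/(etrans (congr1 _ e))/(etrans (compression_scale hP Scl _ _ _)).
    by apply: compression_ext => f; rewrite scale1r.
  apply: (holomorphic_calculus_mob (bT _) (res _) (a1 j) hgj).
  + exact: (compression_bounded hP (hY j).2).1.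
  + move=> x; rewrite MC.
    have := compression_sub hP Scl 1 (Y j) (conjC (ca j).2)
      (fun f => M (diag_coord hd j) (Y j f)) x.
    rewrite scale1r => e; apply: etrans e _; rewrite -[RHS](compression_id hP).
    apply: compression_ext => f; rewrite scale1r; apply: (rk_inj hH) => z hz.
    have /polydiscE/(_ (diag_coord hd j)) zj := hz; have dz := mob_den (a1 j) zj.
    rewrite (evB hH)// (evZ hH)// (hM _).1// (hY j).1//=.
    by move: (conjC _) dz => b dz; field.
- exact: compression_unitary lU lU' iU UU' U'U sU sU'.
- move=> j x; rewrite (compression_comp hP Scl _ _ lU' sU').
  apply: etrans (esym (MC _ _ _)).
  by apply: compression_ext => f; exact: (hU j _ _ (hM _) (hF j)).
Qed.
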